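(* Let $(M,\mathsf c,D^{ew})$ be a selfdual Einstein-Weyl $4$-manifold and let $\xi$ be a selfdual conformal submersion on $M$ with minimal Weyl derivative $D^0$. Then $M$ admits a canonical compatible K\''ahler-Weyl structure on the open set where the antiselfdual part of $(D^0\otimes D^{ew})\xi$ is nonzero. More precisely, if this antiselfdual part is $\tau J$ where $J^2=-\mathrm{id}$ (and $\tau$ is a nonvanishing section of $L^{-1}$), then $J$ is integrable, with K\''ahler-Weyl connection $$D=D^{ew}-\tau^{-1}D^0\tau=D^{ew}+D^0-D^\tau,$$ where $D^\tau$ is the Weyl derivative defined by $D^\tau\tau=0$; in particular $DJ=0$.
   Context: Everything is smooth and local. On an $n$-manifold $M$, $L^w$ is the oriented real line bundle of densities of weight $w$, associated to the frame bundle by the representation $A\mapsto|\det A|^{w/n}$ of $GL(n)$; $L=L^1$. A conformal structure $\mathsf c$ is a (unit determinant) metric on $L^{-1}TM$, i.e. an $L^2$-valued inner product $\langle\cdot,\cdot\rangle$ on $TM$; it identifies vectors and $1$-forms of the same weight (a section of $L^w\otimes(TM)^{\otimes j}\otimes(T^*M)^{\otimes k}$ has weight $w+j-k$). A Weyl derivative $D$ is a covariant derivative on $L$ (hence on every $L^w$); its curvature is a $2$-form $F^D$ (Faraday curvature). On a conformal manifold $D$ determines a unique torsion-free connection on $TM$, also denoted $D$, with $D\mathsf c=0$; for a $1$-form $\gamma$, $(D+\gamma)_XY=D_XY+\gamma(X)Y+\gamma(Y)X-\langle X,Y\rangle\gamma$. $D$ is Einstein-Weyl if the symmetric tracefree part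 of its Ricci tensor vanishes. $M$ is an oriented $4$-manifold; the star operator on weighted forms is normalized by $\iota_X{*\alpha}=*(\langle X,\cdot\rangle\wedge\alpha)$ with $*1$ the orientation, $*^2=1$ on $2$-forms, and (anti)selfdual refers to its $\pm1$ eigenspaces. Skew endomorphisms $J$ of $TM$ (of any weight) are identified with $2$-forms $\langle J\cdot,\cdot\rangle$. A selfdual Einstein-Weyl $4$-manifold is an oriented conformal $4$-manifold with selfdual Weyl curvature (antiselfdual part zero) and a compatible Einstein-Weyl derivative $D^{ew}$ (whose Faraday curvature is then known to be selfdual). A congruence is a section $\xi$ of $L^{-1}TM$ with $\langle\xi,\xi\rangle=1$; $\mathcal H=\xi^\perp$. Its minimal Weyl derivative $D^0$ is the unique Weyl derivative with $D^0_\xi\xi=0$ and $\mathrm{tr}\,D^0\xi=0$. $\xi$ is a conformal submersion if it is tangent to the (oriented, one dimensional) fibres of a surjective submersion $\pi\colon M\to B$ onto a conformal manifold with $d\pi_x|_{\mathcal H_x}$ a nonzero conformal linear map for all $x$; it is selfdual if the Faraday curvature $F^0$ of $D^0$ is selfdual. $(D^0\otimes D)\xi$ is the covariant derivative of $\xi\in L^{-1}\otimes TM$ using $D^0$ on $L^{-1}$ and $D$ on $TM$: an $L^{-1}$-valued endomorphism of $TM$, whose skew part has selfdual and antiselfdual components. A compatible K\''ahler-Weyl structure is an orthogonal integrable complex structure $J$ together with a Weyl derivative $D$ such that $DJ=0$; $D$ is the K\''ahler-Weyl connection of $J$. *)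

(* Defs.v *)
From HB Require Import structures.
From mathcomp Require Import all_boot all_order all_algebra.
From mathcomp Require Import all_classical all_reals all_analysis.
From mathcomp Require Import ring.

Set Implicit Arguments.
Unset Strict Implicit.
Unset Printing Implicit Defensive.

Import Order.TTheory GRing.Theory Num.Theory.
Import numFieldNormedType.Exports.

Local Open Scope classical_set_scope.
Local Open Scope ring_scope.

(** * Calculus on open subsets of R^n *)

(* The partial derivative of f in the i-th coordinate direction. *)
Definition pd (R : realType) (n : nat) (i : 'I_n) (f : 'cV[R]_n -> R)
  : 'cV[R]_n -> R := 'D_(delta_mx i 0) f.

(* Class C^k and C^oo on U; only meaningful for open U. *)
Fixpoint Ck (R : realType) (n : nat) (k : nat) (U : set 'cV[R]_n)
    (f : 'cV[R]_n -> R) : Prop :=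
  (forall y, U y -> {for y, continuous f}) /\
  match k with
  | 0%N => True
  | k'.+1 => forall i : 'I_n,
      (forall y, U y -> derivable f y (delta_mx i 0)) /\ Ck k' U (pd i f)
  end.

Definition smooth_on (R : realType) (n : nat) (U : set 'cV[R]_n)
  (f : 'cV[R]_n -> R) : Prop := forall k, Ck k U f.

Definition smooth_mx (R : realType) (n p q : nat) (U : set 'cV[R]_n)
  (f : 'cV[R]_n -> 'M[R]_(p, q)) : Prop :=
  forall i j, smooth_on U (fun y => f y i j).

Definition grad (R : realType) (n : nat) (f : 'cV[R]_n -> R) (y : 'cV[R]_n)
  : 'rV[R]_n := \row_i pd i f y.

(* (jac f y) *m v is the derivative of f at y along v. *)
Definition jac (R : realType) (n m : nat) (f : 'cV[R]_n -> 'cV[R]_m)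
  (y : 'cV[R]_n) : 'M[R]_(m, n) := \matrix_(i, j) pd j (fun z => f z i 0) y.

(** * Smooth manifolds *)

(* [chart_inv a] is the inverse of the chart [chart a] on [chart a @` chart_dom a]. *)
Record manifold (R : realType) (n : nat) := Manifold {
  pt :> topologicalType ;
  atlas : Type ;
  chart_dom : atlas -> set pt ;
  chart : atlas -> pt -> 'cV[R]_n ;
  chart_inv : atlas -> 'cV[R]_n -> pt ;
  chart_dom_open : forall a, open (chart_dom a) ;
  chart_dom_cover : forall p, exists a, chart_dom a p ;
  chartK : forall a p, chart_dom a p -> chart_inv a (chart a p) = p ;
  chart_open : forall a, open (chart a @` chart_dom a) ;
  chart_continuous : forall a p, chart_dom a p -> {for p, continuous (chart a)} ;
  chart_inv_continuous : forall a y, (chart a @` chart_dom a) y ->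
    {for y, continuous (chart_inv a)} ;
  transition_smooth : forall a b,
    smooth_mx (chart a @` (chart_dom a `&` chart_dom b))
      (fun y => chart b (chart_inv a y)) ;
  manifold_hausdorff : hausdorff_space pt ;
  manifold_second_countable : @second_countable pt
}.

Section ManifoldDefs.
Context {R : realType} {n : nat} (M : manifold R n).
Implicit Types (a b : atlas M) (p : M) (V : set M).

(* The part of the image of the chart a which represents V. *)
Definition cdom V a : set 'cV[R]_n := @chart _ _ M a @` (V `&` chart_dom a).

(* The Jacobian of the change of coordinates from a to b at p. *)
Definition tjac a b p : 'M[R]_n :=
  jac (fun y => chart b (@chart_inv _ _ M a y)) (chart a p).

Definition oriented : Prop :=
  forall a b p, chart_dom a p -> chart_dom b p -> 0 < \det (tjac a b p).

(* A section of a natural bundle is given by its components in each chart, as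
   functions of the coordinates; only the values on [cdom V a] matter when the
   section is defined on V.  L^w is trivialised in a chart by the coordinate
   frame, so that its sections are multiplied by |det J|^(w/n). *)
Definition chart_field (T : Type) : Type := atlas M -> 'cV[R]_n -> T.

Definition dens_factor (w : R) a b p : R := `|\det (tjac a b p)| `^ (w / n%:R).

(* Sections over V of L^w, L^w TM and L^w End(TM). *)
Definition density (w : R) V (s : chart_field R) : Prop :=
  (forall a, smooth_on (cdom V a) (s a)) /\
  (forall a b p, V p -> chart_dom a p -> chart_dom b p ->
    s b (chart b p) = dens_factor w a b p * s a (chart a p)).

Definition vector_field (w : R) V (X : chart_field 'cV[R]_n) : Prop :=
  (forall a, smooth_mx (cdom V a) (X a)) /\
  (forall a b p, V p -> chart_dom a p -> chart_dom b p ->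
    X b (chart b p) = dens_factor w a b p *: (tjac a b p *m X a (chart a p))).

Definition endo_field (w : R) V (A : chart_field 'M[R]_n) : Prop :=
  (forall a, smooth_mx (cdom V a) (A a)) /\
  (forall a b p, V p -> chart_dom a p -> chart_dom b p ->
    A b (chart b p) *m tjac a b p =
    dens_factor w a b p *: (tjac a b p *m A a (chart a p))).

(* An L^2-valued inner product on TM; with this weight, the unit determinant
   condition on its components does not depend on the chart. *)
Definition conformal_structure (c : chart_field 'M[R]_n) : Prop :=
  (forall a, smooth_mx (cdom setT a) (c a)) /\
  (forall a b p, chart_dom a p -> chart_dom b p ->
    (tjac a b p)^T *m c b (chart b p) *m tjac a b p =
    dens_factor 2 a b p *: c a (chart a p)) /\
  (forall a y, cdom setT a y ->
    [/\ (c a y)^T = c a y,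
        forall v : 'cV[R]_n, v != 0 -> 0 < (v^T *m c a y *m v) 0 0
      & \det (c a y) = 1]).

(* A Weyl derivative over V: a covariant derivative on L, which in each chart
   is d + theta with respect to the trivialisation of L; the last term is the
   logarithmic derivative of |det J|^(1/n). *)
Definition weyl_derivative V (D : chart_field 'rV[R]_n) : Prop :=
  (forall a, smooth_mx (cdom V a) (D a)) /\
  (forall a b p, V p -> chart_dom a p -> chart_dom b p ->
    D a (chart a p) =
    D b (chart b p) *m tjac a b p +
    n%:R^-1 *: grad (fun y => ln `|\det (tjac a b (chart_inv a y))|) (chart a p)).

End ManifoldDefs.

(** * Weyl geometry in a chart *)

Section LocalWeyl.
Context {R : realType} {n : nat}.
Implicit Types (g J A : 'cV[R]_n -> 'M[R]_n) (th : 'cV[R]_n -> 'rV[R]_n).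
Implicit Types (s : 'cV[R]_n -> R) (X Y : 'cV[R]_n -> 'cV[R]_n).
Implicit Types (y : 'cV[R]_n) (i j k l : 'I_n).

(* D s for a section s of L^w. *)
Definition dens_deriv (w : R) th s y : 'rV[R]_n :=
  grad s y + (w * s y) *: th y.

(* Components (F^D)_ij of the Faraday curvature. *)
Definition faraday th y : 'M[R]_n :=
  \matrix_(i, j) (pd i (fun z => th z 0 j) y - pd j (fun z => th z 0 i) y).

(* Connection coefficients of D on TM: D_(d_i) d_j = sum_k Gamma k i j d_k.
   For th = 0 these are the Christoffel symbols of g. *)
Definition Gamma g th y k i j : R :=
  2^-1 * (\sum_l invmx (g y) k l *
     (pd i (fun z => g z j l) y + pd j (fun z => g z i l) y
      - pd l (fun z => g z i j) y))
  + th y 0 i * (k == j)%:R + th y 0 j * (k == i)%:R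
  - g y i j * (\sum_l invmx (g y) k l * th y 0 l).

(* The endomorphism Z |-> (D1 (x) D)_Z X of L^w (x) TM, for X a section of
   L^w (x) TM, with D1 used on L^w and D on TM. *)
Definition cov_vector (w : R) th1 g th X y : 'M[R]_n :=
  \matrix_(k, i) (pd i (fun z => X z k 0) y + w * th1 y 0 i * X y k 0
                  + \sum_j Gamma g th y k i j * X y j 0).

(* Components (D_i J)^k_l for a section J of End(TM). *)
Definition cov_endo g th J y i k l : R :=
  pd i (fun z => J z k l) y
  + \sum_m Gamma g th y k i m * J y m l - \sum_m J y k m * Gamma g th y m i l.

(* The d_k component of R(d_i, d_j) d_l, for the connection D on TM. *)
Definition curvature g th y i j k l : R :=
  pd i (fun z => Gamma g th z k j l) y - pd j (fun z => Gamma g th z k i l) y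
  + \sum_m (Gamma g th y k i m * Gamma g th y m j l
            - Gamma g th y k j m * Gamma g th y m i l).

(* ric(X, Y) = tr (Z |-> R(Z, X) Y). *)
Definition ricci g th y : 'M[R]_n :=
  \matrix_(j, l) \sum_k curvature g th y k j k l.

Definition scal g th y : R := \tr (invmx (g y) *m ricci g th y).

Definition sym_tracefree_ricci g th y : 'M[R]_n :=
  2^-1 *: (ricci g th y + (ricci g th y)^T) - (scal g th y / n%:R) *: g y.

(* The Weyl tensor g(W(d_i, d_j) d_l, d_k): it is computed from the
   Levi-Civita connection of the local representative g of the conformal
   structure, and depends on the conformal class only (up to scale). *)
Definition schouten g y : 'M[R]_n :=
  (n%:R - 2)^-1 *: (ricci g (fun=> 0) y
                    - (scal g (fun=> 0) y / (2 * (n%:R - 1))) *: g y).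

Definition weyl_tensor g y i j k l : R :=
  \sum_m g y k m * curvature g (fun=> 0) y i j m l
  - (schouten g y j l * g y i k - schouten g y i l * g y j k
     + g y j l * schouten g y i k - g y i l * schouten g y j k).

Definition lie_bracket X Y y : 'cV[R]_n := jac Y y *m X y - jac X y *m Y y.

Definition nijenhuis J X Y y : 'cV[R]_n :=
  let JX z := J z *m X z in
  let JY z := J z *m Y z in
  lie_bracket JX JY y - lie_bracket X Y y
  - J y *m lie_bracket JX Y y - J y *m lie_bracket X JY y.

(* The 2-form <A., .> attached to a skew endomorphism A: matrices of bilinear
   forms have entries alpha_ij = alpha(d_i, d_j). *)
Definition form_of_endo (g A : 'M[R]_n) : 'M[R]_n := A^T *m g.
Definition endo_of_form (g alpha : 'M[R]_n) : 'M[R]_n := invmx g *m alpha^T.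

Definition skew_part (alpha : 'M[R]_n) : 'M[R]_n := 2^-1 *: (alpha - alpha^T).

End LocalWeyl.

(* The formula for [Gamma] gives the unique torsion-free connection on TM with
   D c = 0, where c is regarded as a section of L^2 (x) S^2 T*M. *)
Lemma Gamma_unique (R : realType) (n : nat) (g : 'cV[R]_n -> 'M[R]_n)
    (th : 'cV[R]_n -> 'rV[R]_n) (y : 'cV[R]_n) (G : 'I_n -> 'I_n -> 'I_n -> R)
    (gsym : forall z, (g z)^T = g z) (gU : g y \in unitmx) :
  ((forall k i j, G k i j = G k j i) /\
   (forall i j k, pd i (fun z => g z j k) y + 2 * th y 0 i * g y j k
      - \sum_l G l i j * g y l k - \sum_l G l i k * g y j l = 0)) <->
  (forall k i j, G k i j = Gamma g th y k i j).
Proof.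
pose h i j l := pd i (fun z => g z j l) y.
pose t i := th y 0 i.
pose E i j l := 2^-1 * (h i j l + h j i l - h l i j)
  + t i * g y j l + t j * g y i l - t l * g y i j.
have gC j l z : g z j l = g z l j by rewrite -{1}(gsym z) mxE.
have hC i j l : h i j l = h i l j.
  by rewrite /h; congr (pd i _ y); apply/funext => z.
have mulVg k j : \sum_l invmx (g y) k l * g y l j = (k == j)%:R.
  by have := mulVmx gU => /matrixP/(_ k j); rewrite !mxE.
have mulgV k j : \sum_l g y k l * invmx (g y) l j = (k == j)%:R.
  by have := mulmxV gU => /matrixP/(_ k j); rewrite !mxE.
have sum_delta (F : 'I_n -> R) m : \sum_l F l * (l == m)%:R = F m.
  rewrite (bigD1 m) //= eqxx mulr1 big1 ?addr0 // => l /negbTE ->.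
  by rewrite mulr0.
have GammaE k i j : Gamma g th y k i j = \sum_l invmx (g y) k l * E i j l.
  rewrite /Gamma -/(t i) -/(t j) -(mulVg k j) -(mulVg k i) !mulr_sumr.
  rewrite -!big_split /= -sumrB; apply: eq_bigr => l _.
  rewrite /E /h /t (gC j l) (gC i l).
  by ring.
have raise (F : 'I_n -> R) m :
    \sum_k (\sum_l invmx (g y) k l * F l) * g y k m = F m.
  under eq_bigr do rewrite mulr_suml.
  rewrite exchange_big /= -[RHS]sum_delta; apply: eq_bigr => l _.
  rewrite eq_sym -(mulgV m l) mulr_sumr; apply: eq_bigr => k _.
  by rewrite (gC k m); ring.
have lower (F : 'I_n -> R) k :
    F k = \sum_l invmx (g y) k l * (\sum_m F m * g y m l).
  under eq_bigr do rewrite mulr_sumr.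
  rewrite exchange_big /= -[LHS]sum_delta; apply: eq_bigr => m _.
  rewrite eq_sym -(mulVg k m) mulr_sumr; apply: eq_bigr => l _.
  by rewrite (gC m l); ring.
split=> [[Gsym Gmet] k i j | GE].
  rewrite GammaE [LHS](lower (fun m => G m i j)); apply: eq_bigr => l _.
  congr (_ * _).
  pose L i j l := \sum_m G m i j * g y m l.
  have LC a b d : L a b d = L b a d by apply: eq_bigr => m _; rewrite Gsym.
  have met a b d : h a b d + 2 * t a * g y b d = L a b d + L a d b.
    have /eqP := Gmet a b d.
    rewrite -addrA -opprD subr_eq0 => /eqP ->; congr (_ + _).
    by apply: eq_bigr => m _; rewrite (gC b m).
  rewrite -/(L i j l) /E.
  have := met i j l; have := met j i l; have := met l i j.
  rewrite (LC l i) (LC l j) (LC j i) => e1 e2 e3.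
  have -> : h l i j = L i l j + L j l i - 2 * t l * g y i j.
    by rewrite -e1; ring.
  have -> : h j i l = L i j l + L j l i - 2 * t j * g y i l.
    by rewrite -e2; ring.
  have -> : h i j l = L i j l + L i l j - 2 * t i * g y j l.
    by rewrite -e3; ring.
  by field.
split=> [k i j | i j k].
  rewrite !GE !GammaE; apply: eq_bigr => l _; congr (_ * _).
  by rewrite /E (hC l i j) (gC i j); ring.
rewrite -/(h i j k) -/(t i).
under eq_bigr do rewrite GE GammaE.
under [X in _ - X = 0]eq_bigr do rewrite GE GammaE (gC j).
by rewrite !raise /E (hC i k j) (gC k j); field.
Qed.

(** * Selfduality in dimension 4 *)

Section Dim4.
Context {R : realType}.

(* vol(d_i, d_j, d_k, d_l) in a positively oriented chart; vol is a section of
   L^4 (x) Lambda^4 T*M. *)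
Definition levi_civita (i j k l : 'I_4) : R :=
  \det (\matrix_(r < 4, s < 4) (tnth [tuple i; j; k; l] r == s)%:R).

(* The normalisation iota_X (star alpha) = star (X /\ alpha), star 1 = vol,
   yields star (X /\ Y) = iota_X iota_Y vol = vol(Y, X, ., .); on 2-forms this
   is the opposite of the usual Hodge star. *)
Definition star2 (g alpha : 'M[R]_4) : 'M[R]_4 :=
  \matrix_(i, j) (2^-1 * \sum_k \sum_l
    (invmx g *m alpha *m (invmx g)^T) k l * levi_civita l k i j).

Definition selfdual_form (g alpha : 'M[R]_4) : Prop := star2 g alpha = alpha.

Definition asd_form (g alpha : 'M[R]_4) : 'M[R]_4 :=
  2^-1 *: (alpha - star2 g alpha).

(* Antiselfdual component of the skew part of a (weighted) endomorphism. *)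
Definition asd_endo (g A : 'M[R]_4) : 'M[R]_4 :=
  endo_of_form g (asd_form g (skew_part (form_of_endo g A))).

End Dim4.

(** * Weyl geometry on a conformal manifold *)

Section ConformalManifold.
Context {R : realType} {n : nat} (M : manifold R n) (c : chart_field M 'M[R]_n).
Implicit Types (V : set M) (D : chart_field M 'rV[R]_n) (J : chart_field M 'M[R]_n).
Implicit Types (xi : chart_field M 'cV[R]_n).

Definition einstein_weyl D : Prop :=
  weyl_derivative setT D /\
  (forall a y, cdom setT a y -> sym_tracefree_ricci (c a) (D a) y = 0).

Definition congruence xi : Prop :=
  vector_field (-1) setT xi /\
  (forall a y, cdom setT a y -> ((xi a y)^T *m c a y *m xi a y) 0 0 = 1).

Definition minimal_weyl xi D : Prop :=
  weyl_derivative setT D /\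
  (forall a y, cdom setT a y ->
    let Dxi := cov_vector (-1) (D a) (c a) (D a) (xi a) y in
    Dxi *m xi a y = 0 /\ \tr Dxi = 0).

(* X and Y range over the vector fields on the part of V covered by a. *)
Definition integrable V J : Prop :=
  forall a (X Y : 'cV[R]_n -> 'cV[R]_n),
    smooth_mx (cdom V a) X -> smooth_mx (cdom V a) Y ->
    forall y, cdom V a y -> nijenhuis (J a) X Y y = 0.

Definition parallel_endo V D J : Prop :=
  forall a y, cdom V a y -> forall i k l, cov_endo (c a) (D a) (J a) y i k l = 0.

Definition kahler_weyl V J D : Prop :=
  [/\ endo_field 0 V J /\ weyl_derivative V D,
      forall a y, cdom V a y -> J a y *m J a y = - 1%:M,
      forall a y, cdom V a y -> (J a y)^T *m c a y *m J a y = c a y,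
      integrable V J
    & parallel_endo V D J].

End ConformalManifold.

(* The representative of a map f in the charts a and b. *)
Definition chart_map (R : realType) (n m : nat) (M : manifold R n)
    (B : manifold R m) (f : M -> B) (a : atlas M) (b : atlas B)
  : 'cV[R]_n -> 'cV[R]_m := fun y => chart b (f (chart_inv a y)).

Definition smooth_map (R : realType) (n m : nat) (M : manifold R n)
    (B : manifold R m) (f : M -> B) : Prop :=
  continuous f /\
  forall a b, smooth_mx (chart a @` (chart_dom a `&` f @^-1` chart_dom b)) (chart_map f a b).

(* xi is tangent to the fibres of a surjective submersion f onto a conformal
   manifold whose differential is conformal and nonzero on xi^perp; [mu] is the
   (positive) conformal factor with respect to the two coordinate charts. *)
Definition conformal_submersion (R : realType) (n : nat) (M : manifold R n.+1)
    (c : chart_field M 'M[R]_n.+1) (xi : chart_field M 'cV[R]_n.+1) : Prop :=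
  exists (B : manifold R n) (h : chart_field B 'M[R]_n) (f : M -> B),
    [/\ conformal_structure h, smooth_map f, forall q, exists p, f p = q
      & forall a b p, chart_dom a p -> chart_dom b (f p) ->
        let y := chart a p in
        let df := jac (chart_map f a b) y in
        [/\ forall u : 'cV[R]_n, exists v : 'cV[R]_n.+1, df *m v = u,
            df *m xi a y = 0
          & exists2 mu : R, 0 < mu & forall v w : 'cV[R]_n.+1,
              (v^T *m c a y *m xi a y) 0 0 = 0 ->
              (w^T *m c a y *m xi a y) 0 0 = 0 ->
              ((df *m v)^T *m h b (chart b (f p)) *m (df *m w)) 0 0 =
              mu * (v^T *m c a y *m w) 0 0]].

Section FourManifold.
Context {R : realType} (M : manifold R 4) (c : chart_field M 'M[R]_4).
Implicit Types (D : chart_field M 'rV[R]_4) (xi : chart_field M 'cV[R]_4).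

Definition selfdual_weyl_curvature : Prop :=
  forall a y, cdom setT a y -> forall k l,
    selfdual_form (c a y) (\matrix_(i, j) weyl_tensor (c a) y i j k l).

Definition selfdual_einstein_weyl D : Prop :=
  [/\ oriented M, conformal_structure c, selfdual_weyl_curvature
    & einstein_weyl c D].

Definition selfdual_faraday D : Prop :=
  forall a y, cdom setT a y -> selfdual_form (c a y) (faraday (D a) y).

(* The antiselfdual part of (D0 (x) D) xi, a section of L^-1 (x) End(TM). *)
Definition asd_deriv (D0 : chart_field M 'rV[R]_4) D xi : chart_field M 'M[R]_4 := fun a y =>
  asd_endo (c a y) (cov_vector (-1) (D0 a) (c a) (D a) (xi a) y).

Definition asd_deriv_support (D0 : chart_field M 'rV[R]_4) D xi : set M :=
  [set p | exists2 a, chart_dom a p & asd_deriv D0 D xi a (chart a p) != 0].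

(* The antiselfdual part of (D0 (x) D) xi is tau J over V, with J^2 = -id and
   tau a nonvanishing section of L^-1. *)
Definition asd_decomposition (D0 : chart_field M 'rV[R]_4) D xi (V : set M) (tau : chart_field M R)
    (J : chart_field M 'M[R]_4) : Prop :=
  [/\ density (-1) V tau /\ (forall a y, cdom V a y -> tau a y != 0),
      endo_field 0 V J,
      forall a y, cdom V a y -> J a y *m J a y = - 1%:M
    & forall a y, cdom V a y -> asd_deriv D0 D xi a y = tau a y *: J a y].

(* D - tau^-1 D0 tau, for a section tau of L^-1. *)
Definition gauge_change (D0 : chart_field M 'rV[R]_4) D (tau : chart_field M R) : chart_field M 'rV[R]_4 := fun a y =>
  D a y - (tau a y)^-1 *: dens_deriv (-1) (D0 a) (tau a) y.

End FourManifold.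

(* Main.v *)
Require Import Defs.
From HB Require Import structures.
From mathcomp Require Import all_boot all_order all_algebra.
From mathcomp Require Import all_classical all_reals all_analysis.
From mathcomp Require Import perm.
From mathcomp Require Import ring lra.

Set Implicit Arguments.
Unset Strict Implicit.
Unset Printing Implicit Defensive.

Import Order.TTheory GRing.Theory Num.Theory.
Import numFieldNormedType.Exports.

Local Open Scope classical_set_scope.
Local Open Scope ring_scope.

(** * Calculus of smooth functions on an open set *)

Section Smooth.
Context {R : realType} {n : nat}.
Implicit Types (U V : set 'cV[R]_n) (f g : 'cV[R]_n -> R) (y : 'cV[R]_n).

Lemma open_near U y (P : 'cV[R]_n -> Prop) :
  open U -> U y -> (forall z, U z -> P z) -> \forall z \near y, P z.
Proof.
move=> oU Uy UP; have : nbhs y U by apply: open_nbhs_nbhs.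
by apply: filterS.
Qed.

Lemma pd_eq U f g y i : open U -> U y -> (forall z, U z -> f z = g z) ->
  pd i f y = pd i g y.
Proof. by move=> oU Uy fg; have H := open_near oU Uy fg; exact: near_eq_derive. Qed.

Lemma continuous_eq_on U f g y : open U -> U y ->
  (forall z, U z -> f z = g z) ->
  {for y, continuous f} -> {for y, continuous g}.
Proof.
move=> oU Uy fg; rewrite /prop_for /continuous_at -(fg y Uy) => cf.
have H := open_near oU Uy fg.
exact: (cvg_trans (@near_eq_cvg _ _ (nbhs y) _ f g H) cf).
Qed.

Lemma Ck_eq k U f g : open U -> (forall z, U z -> f z = g z) ->
  Ck k U f -> Ck k U g.
Proof.
move=> oU; elim: k f g => [|k IH] f g fg /= [cf df].
  by split=> // y Uy; apply: (continuous_eq_on oU Uy fg); apply: cf.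
split=> [y Uy|i]; first by apply: (continuous_eq_on oU Uy fg); apply: cf.
have [df1 df2] := df i; split=> [y Uy|].
  by apply: near_eq_derivable (df1 y Uy); apply: (open_near (P := fun z => f z = g z) oU Uy) => z Uz; exact: fg.
by apply: IH df2 => z Uz; apply: pd_eq fg.
Qed.

Lemma CkW k U f : Ck k.+1 U f -> Ck k U f.
Proof.
elim: k f => [|k IH] f /= [cf df]; first by split.
split=> // i; have [df1 df2] := df i; split=> //; exact: IH.
Qed.

Lemma Ck_sub k U V f : V `<=` U -> Ck k U f -> Ck k V f.
Proof.
move=> VU; elim: k f => [|k IH] f /= [cf df]; (split; first by move=> y /VU/cf) => // i.
have [df1 df2] := df i; split; last exact: IH.
by move=> y /VU/df1.
Qed.

Lemma Ck_cst k U (a : R) : Ck k U (fun=> a).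
Proof.
have E i b : pd i (fun=> b : R) = (fun=> 0 : R).
  by apply/funext => y; apply: derive_cst.
elim: k a => [|k IH] a /=; (split; first by move=> y _; exact: (@cst_continuous _ _ a y)) => // i.
by split; [move=> y _; apply: derivable_cst|rewrite E].
Qed.

Lemma CkD k U f g : open U -> Ck k U f -> Ck k U g -> Ck k U (fun z => f z + g z).
Proof.
move=> oU; elim: k f g => [|k IH] f g /= [cf df] [cg dg].
  by split=> // y Uy; apply: continuousD; [apply: cf|apply: cg].
split=> [y Uy|i]; first by apply: continuousD; [apply: cf|apply: cg].
have [df1 df2] := df i; have [dg1 dg2] := dg i; split=> [y Uy|].
  by apply: derivableD; [apply: df1|apply: dg1].
apply: (Ck_eq oU _ (IH _ _ df2 dg2)) => y Uy.
by rewrite /pd; symmetry; apply: deriveD; [apply: df1|apply: dg1].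
Qed.

Lemma CkM k U f g : open U -> Ck k U f -> Ck k U g -> Ck k U (fun z => f z * g z).
Proof.
move=> oU; elim: k f g => [|k IH] f g Hf Hg.
  move: Hf Hg => [cf _] [cg _].
  by split=> // y Uy; apply: continuousM; [apply: cf|apply: cg].
have Hf1 := CkW Hf; have Hg1 := CkW Hg; move: Hf Hg => /= [cf df] [cg dg].
split=> [y Uy|i]; first by apply: continuousM; [apply: cf|apply: cg].
have [df1 df2] := df i; have [dg1 dg2] := dg i; split=> [y Uy|].
  by apply: derivableM; [apply: df1|apply: dg1].
apply: (Ck_eq oU _ (CkD oU (IH _ _ Hf1 dg2) (IH _ _ Hg1 df2))) => y Uy.
by rewrite /pd; symmetry; apply: deriveM; [apply: df1|apply: dg1].
Qed.

Lemma CkN k U f : open U -> Ck k U f -> Ck k U (fun z => - f z).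
Proof.
move=> oU Hf; apply: (Ck_eq oU _ (CkM oU (Ck_cst k U (-1)) Hf)) => y _.
by rewrite mulN1r.
Qed.

Lemma CkV k U f : open U -> (forall y, U y -> f y != 0) ->
  Ck k U f -> Ck k U (fun z => (f z)^-1).
Proof.
move=> oU f0; elim: k f f0 => [|k IH] f f0 Hf.
  by case: Hf => cf _; split=> // y Uy; apply: continuousV; [apply: f0|apply: cf].
have Hf1 := CkW Hf; move: Hf => /= [cf df].
split=> [y Uy|i]; first by apply: continuousV; [apply: f0|apply: cf].
have [df1 df2] := df i; split=> [y Uy|].
  by apply: derivableV; [apply: f0|apply: df1].
have Hv := IH _ f0 Hf1.
apply: (Ck_eq oU _ (CkN oU (CkM oU (CkM oU Hv Hv) df2))) => y Uy.
rewrite /pd deriveV ?f0 //; last exact: df1.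
by rewrite expr2 invfM scaleNr.
Qed.

Lemma is_derive_comp_fct (h : R -> R) f y (v : 'cV[R]_n) dh :
  derivable f y v -> is_derive (f y) 1 h dh ->
  is_derive y v (h \o f) (dh * 'D_v f y).
Proof.
move=> /derivableP df dh1.
have E (F : 'cV[R]_n -> R) dF : is_derive y v F dF <->
    is_derive (0 : R) 1 (fun t : R => F (t *: v + y)) dF.
  have e : (fun t : R => t^-1 *: ((F \o shift y) (t *: v) - F y)) =
     (fun t : R => t^-1 *: (((fun t : R => F (t *: v + y)) \o shift 0) t%:A -
        F (0 *: v + y))).
    by apply/funext => t /=; rewrite addr0 scale0r add0r [_%:A]mulr1.
  split=> -[d1 d2]; split.
  - by rewrite /derivable -e.
  - by rewrite /derive -e.
  - by rewrite /derivable e.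
  - by rewrite /derive e.
apply/E; have d1 := (E f _).1 df.
apply: (@is_derive1_comp _ h (fun t : R => f (t *: v + y)) 0).
  by rewrite scale0r add0r.
Qed.

Lemma Ck_sqrt k U f : open U -> (forall y, U y -> 0 < f y) ->
  Ck k U f -> Ck k U (fun z => Num.sqrt (f z)).
Proof.
move=> oU f0; elim: k f f0 => [|k IH] f f0 Hf.
  case: Hf => cf _; split=> // y Uy.
  by apply: continuous_comp; [apply: cf|apply: sqrt_continuous].
have Hf1 := CkW Hf; move: Hf => /= [cf df].
split=> [y Uy|i].
  by apply: continuous_comp; [apply: cf|apply: sqrt_continuous].
have [df1 df2] := df i.
have D y : U y -> is_derive y (delta_mx i 0) (fun z => Num.sqrt (f z))
    ((2 * Num.sqrt (f y))^-1 * pd i f y).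
  move=> Uy; apply: is_derive_comp_fct; first exact: df1.
  exact: is_derive1_sqrt (f0 y Uy).
split=> [y Uy|]; first by have [] := D y Uy.
have Hv : Ck k U (fun z => (2 * Num.sqrt (f z))^-1).
  apply: CkV => //; last by apply: CkM => //; [apply: Ck_cst|apply: IH].
  by move=> y Uy; rewrite mulf_neq0 // ?pnatr_eq0 // gt_eqF // sqrtr_gt0 f0.
by apply: (Ck_eq oU _ (CkM oU Hv df2)) => y Uy; have [_ <-] := D y Uy.
Qed.

End Smooth.

Section MeanValue.
Context {R : realType} {n : nat}.
Implicit Types (U V : set 'cV[R]_n) (f g : 'cV[R]_n -> R) (y z v h : 'cV[R]_n).

Lemma norm_coord v i : `|v i 0| <= `|v|.
Proof.
rewrite [leRHS]/Num.Def.normr /= mx_normrE.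
exact: (le_bigmax _ (fun ij : 'I_n * 'I_1 => `|v ij.1 ij.2|) (i, 0)).
Qed.

Lemma norm_le_coord v (r : R) : 0 <= r -> (forall i, `|v i 0| <= r) -> `|v| <= r.
Proof.
move=> r0 vr; rewrite [leLHS]/Num.Def.normr /= mx_normrE.
by apply: bigmax_le => // -[i j] _ /=; rewrite ord1.
Qed.

Lemma is_derive_line f z v (t : R) : derivable f (z + t *: v) v ->
  is_derive t 1 (fun s : R => f (z + s *: v)) ('D_v f (z + t *: v)).
Proof.
move=> df.
have e : (fun s : R => s^-1 *: ((f \o shift (z + t *: v)) (s *: v) - f (z + t *: v)))
  = (fun s : R => s^-1 *: (((fun s : R => f (z + s *: v)) \o shift t) s%:A -
        f (z + t *: v))).
  apply/funext => s /=; congr (_ *: (f _ - _)).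
  by rewrite [_%:A]mulr1 scalerDl addrCA.
by split; [rewrite /derivable -e|rewrite /derive -e].
Qed.

Lemma mean_value f z v (T : R) :
  (forall t : R, `|t| <= `|T| -> derivable f (z + t *: v) v) ->
  exists2 t : R, `|t| <= `|T| & f (z + T *: v) - f z = T * 'D_v f (z + t *: v).
Proof.
move=> df.
have D (t : R) : `|t| <= `|T| -> is_derive t 1 (fun s : R => f (z + s *: v)) ('D_v f (z + t *: v)).
  by move=> /df; exact: is_derive_line.
have C (t : R) : `|t| <= `|T| -> {for t, continuous (fun s : R => f (z + s *: v))}.
  by move=> /D [d _]; apply/differentiable_continuous/derivable1_diffP.
have [T0|T0] := leP 0 T.
  have I (t : R) : t \in `[0, T]%R -> `|t| <= `|T|.
    by rewrite in_itv /= => /andP[t0 tT]; rewrite !ger0_norm.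
  have [t tI E] : exists2 t : R, t \in `[0, T]%R &
     f (z + T *: v) - f (z + 0 *: v) = 'D_v f (z + t *: v) * (T - 0).
    apply: (MVT_segment T0 (f := fun s : R => f (z + s *: v))
      (df := fun t => 'D_v f (z + t *: v))) => [x xI|].
      by apply/D/I; move: xI; rewrite !in_itv /= => /andP[/ltW -> /ltW ->].
    by apply: continuous_in_subspaceT => x /[1!inE] /= xI; apply/C/I.
  exists t; first exact: I.
  by move: E; rewrite scale0r addr0 subr0 mulrC.
have I (t : R) : t \in `[T, 0]%R -> `|t| <= `|T|.
  by rewrite in_itv /= => /andP[t0 tT]; rewrite (ler0_norm tT) ltr0_norm // lerN2.
have [t tI E] : exists2 t : R, t \in `[T, 0]%R &
   f (z + 0 *: v) - f (z + T *: v) = 'D_v f (z + t *: v) * (0 - T).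
  apply: (MVT_segment (ltW T0) (f := fun s : R => f (z + s *: v))
      (df := fun t => 'D_v f (z + t *: v))) => [x xI|].
    by apply/D/I; move: xI; rewrite !in_itv /= => /andP[/ltW -> /ltW ->].
  by apply: continuous_in_subspaceT => x /[1!inE] /= xI; apply/C/I.
exists t; first exact: I.
by move: E; rewrite scale0r addr0 sub0r mulrN => /eqP; rewrite -eqr_oppLR opprB mulrC => /eqP.
Qed.

(* the point of h whose coordinates of index at least k are put to zero *)
Definition trunc (h : 'cV[R]_n) (k : nat) : 'cV[R]_n :=
  \col_i (if (i < k)%N then h i 0 else 0).

Lemma truncS h (k : 'I_n) : trunc h k.+1 = trunc h k + h k 0 *: delta_mx k 0.
Proof.
apply/matrixP => i j; rewrite ord1 !mxE ltnS leq_eqVlt eqxx andbT.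
have [->|ne] := eqVneq i k; first by rewrite eqxx ltnn /= mulr1 add0r.
by rewrite val_eqE (negbTE ne) /= mulr0 addr0.
Qed.

Lemma norm_trunc_line h (k : 'I_n) (t : R) : `|t| <= `|h k 0| ->
  `|trunc h k + t *: delta_mx k 0| <= `|h|.
Proof.
move=> th; apply: norm_le_coord => // i; rewrite !mxE eqxx andbT.
have [->|ne] := eqVneq i k.
  by rewrite ltnn add0r mulr1; apply: (le_trans th); exact: norm_coord.
rewrite mulr0 addr0; case: ifP => _; first exact: norm_coord.
by rewrite normr0.
Qed.

Lemma C1_estimate U f y (e : R) : open U -> U y -> Ck 1 U f -> 0 < e ->
  \forall h \near (0 : 'cV[R]_n),
    `|f (y + h) - f y - \sum_i pd i f y * h i 0| <= e * `|h|.
Proof.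
move=> oU Uy [_ C1] e0.
pose e' := e / (n%:R + 1).
have e'0 : 0 < e' by rewrite divr_gt0 // ltr_wpDl.
have N1 : \forall z \near y, U z := open_near oU Uy (fun z Uz => Uz).
have N2 : \forall z \near y, forall i, `|pd i f y - pd i f z| <= e'.
  apply: (@filter_forall _ _ (fun i z => `|pd i f y - pd i f z| <= e') (nbhs y)) => i.
  have [_ [ci _]] := C1 i.
  by have /cvgrPdist_le := ci y Uy; apply.
have N : \forall z \near y, U z /\ forall i, `|pd i f y - pd i f z| <= e'.
  exact: filterI N1 N2.
have /nbhs_ballP[d d0 Bd] := N.
have M : \forall h \near (0 : 'cV[R]_n), `|h| < d.
  by have := @cvgr0_norm_lt _ _ _ (nbhs (0 : 'cV[R]_n)) _ id; apply.
near=> h.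
have hd : `|h| < d by near: h.
have inB z : `|z| <= `|h| -> U (y + z) /\ forall i, `|pd i f y - pd i f (y + z)| <= e'.
  move=> zh; apply: Bd; rewrite mx_norm_ball /ball_ /=.
  by rewrite opprD addNKr normrN; exact: le_lt_trans hd.
have -> : f (y + h) - f y = \sum_(0 <= k < n) (f (y + trunc h k.+1) - f (y + trunc h k)).
  rewrite telescope_sumr //; congr (f _ - f _).
    by congr (_ + _); apply/matrixP => i j; rewrite ord1 mxE ltn_ord.
  by rewrite -[LHS]addr0; congr (_ + _); apply/matrixP => i j; rewrite !mxE.
rewrite big_mkord -sumrB.
apply: (@le_trans _ _ (\sum_(i < n) e' * `|h|)).
  apply: (le_trans (ler_norm_sum _ _ _)); apply: ler_sum => k _.
  rewrite truncS addrA.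
  have [t tT ->] : exists2 t : R, `|t| <= `|h k 0| &
      f (y + trunc h k + h k 0 *: delta_mx k 0) - f (y + trunc h k) =
      h k 0 * pd k f (y + trunc h k + t *: delta_mx k 0).
    apply: mean_value => t tT; rewrite -addrA.
    have [dk _] := C1 k; apply: dk.
    by have [] := inB _ (norm_trunc_line tT).
  rewrite mulrC -mulrBl normrM ler_pM // ?norm_coord // distrC -addrA.
  by have [_] := inB _ (norm_trunc_line tT); exact.
rewrite sumr_const card_ord -mulr_natr mulrAC ler_wpM2r // /e'.
rewrite mulrAC ler_pdivrMr ?ltr_wpDl //.
by apply: ler_wpM2l; [exact: ltW|rewrite lerDl].
Unshelve. all: by end_near. Qed.

Definition dotr (a : 'rV[R]_n) (h : 'cV[R]_n) : R := \sum_i a 0 i * h i 0.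

Lemma dotr_is_linear a : linear (dotr a).
Proof.
move=> k u v; rewrite /dotr scaler_sumr -big_split /=; apply: eq_bigr => i _.
by rewrite !mxE mulrDr mulrCA.
Qed.
HB.instance Definition _ a :=
  GRing.isLinear.Build R 'cV[R]_n R _ (dotr a) (dotr_is_linear a).

Lemma dotr_continuous a : continuous (dotr a).
Proof.
move=> y; rewrite /dotr.
have -> : (fun h : 'cV[R]_n => \sum_i a 0 i * h i 0) =
    \sum_i (fun h : 'cV[R]_n => a 0 i * h i 0).
  by apply/funext => h; rewrite fct_sumE.
elim/big_ind: _ => [|f g cf cg|i _]; first exact: cst_continuous.
  exact: continuousD.
by apply: continuousM; [exact: cst_continuous|exact: coord_continuous].
Qed.

Lemma C1_diff U f y : open U -> U y -> Ck 1 U f ->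
  differentiable f y /\ 'd f y = dotr (grad f y) :> ('cV[R]_n -> R).
Proof.
move=> oU Uy C1.
have E : f \o shift y = cst (f y) + dotr (grad f y) +o_ (0 : 'cV[R]_n) id.
  apply/eqaddoP => _/posnumP[e].
  near=> h.
  rewrite -![(_ + _ : _ -> _) _]/(_ + _) -![(- _ : _ -> _) _]/(- _) /=.
  rewrite opprD addrA [h + y]addrC /dotr.
  under eq_bigr do rewrite mxE.
  near: h; exact: (C1_estimate oU Uy C1).
have dE := diff_unique (@dotr_continuous (grad f y)) E.
split=> //; apply/diff_locallyP; rewrite dE; split=> //; exact: dotr_continuous.
Unshelve. all: by end_near. Qed.

End MeanValue.

Section Chain.
Context {R : realType} {m n : nat}.

Lemma chain_rule (U : set 'cV[R]_m) (V : set 'cV[R]_n) (f : 'cV[R]_n -> R)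
    (phi : 'cV[R]_m -> 'cV[R]_n) y i :
  open U -> open V -> U y -> V (phi y) -> Ck 1 V f ->
  (forall j, Ck 1 U (fun z => phi z j 0)) ->
  derivable (fun z => f (phi z)) y (delta_mx i 0) /\
  pd i (fun z => f (phi z)) y =
  \sum_j pd j f (phi y) * pd i (fun z => phi z j 0) y.
Proof.
move=> oU oV Uy Vy Cf Cphi.
have [df dfE] := C1_diff oV Vy Cf.
have dphi : differentiable phi y.
  have -> : phi = \sum_j (fun z => phi z j 0 *: (delta_mx j 0 : 'cV[R]_n)).
    apply/funext => z; rewrite fct_sumE; apply/matrixP => r s.
    rewrite summxE (bigD1 r) //= big1 ?addr0 => [|k kr].
      by rewrite !mxE ord1 !eqxx mulr1.
    by rewrite !mxE eq_sym (negbTE kr) mulr0.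
  apply: differentiable_sum => j; apply: differentiableZl.
  by have [] := C1_diff oU Uy (Cphi j).
have dc : differentiable (f \o phi) y by apply: differentiable_comp.
split; first exact: diff_derivable.
rewrite /pd -[LHS]/('D_(delta_mx i 0) (f \o phi) y) deriveE // diff_comp //= dfE.
rewrite -deriveE // derive_mx; last exact: diff_derivable.
by rewrite /dotr; apply: eq_bigr => j _; rewrite !mxE.
Qed.
End Chain.

Section Schwarz.
Context {R : realType} {n : nat}.
Implicit Types (U : set 'cV[R]_n) (f : 'cV[R]_n -> R) (y z v w : 'cV[R]_n).

Lemma is_derive_shift_arg f z v w : derivable f (z + w) v ->
  is_derive z v (fun x => f (x + w)) ('D_v f (z + w)).
Proof.
move=> df.
have e : (fun s : R => s^-1 *: ((f \o shift (z + w)) (s *: v) - f (z + w))) =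
  (fun s : R => s^-1 *: (((fun x => f (x + w)) \o shift z) (s *: v) - f (z + w))).
  by apply/funext => s /=; rewrite addrA.
by split; [rewrite /derivable -e|rewrite /derive -e].
Qed.

Lemma second_difference U f y i j (s : R) :
  (forall t u : R, `|t| <= `|s| -> `|u| <= `|s| ->
     U (y + t *: delta_mx i 0 + u *: delta_mx j 0)) ->
  Ck 2 U f ->
  exists t u : R, [/\ `|t| <= `|s|, `|u| <= `|s| &
    f (y + s *: delta_mx i 0 + s *: delta_mx j 0) - f (y + s *: delta_mx i 0)
    - f (y + s *: delta_mx j 0) + f y =
    s * s * pd j (pd i f) (y + t *: delta_mx i 0 + u *: delta_mx j 0)].
Proof.
move=> HU [_ C2].
pose F z := f (z + s *: delta_mx j 0) - f z.
have D1 (t u : R) : `|t| <= `|s| -> `|u| <= `|s| ->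
    derivable f (y + t *: delta_mx i 0 + u *: delta_mx j 0) (delta_mx i 0).
  by move=> ts us; have [d1 _] := C2 i; apply: d1; exact: HU.
have D0 (t : R) : `|t| <= `|s| -> derivable f (y + t *: delta_mx i 0) (delta_mx i 0).
  by move=> ts; have := @D1 t 0 ts; rewrite scale0r addr0; apply; rewrite normr0.
have DF (t : R) : `|t| <= `|s| -> is_derive (y + t *: delta_mx i 0) (delta_mx i 0) F
    (pd i f (y + t *: delta_mx i 0 + s *: delta_mx j 0) - pd i f (y + t *: delta_mx i 0)).
  move=> ts; apply: is_deriveB; last exact/derivableP/D0.
  exact/is_derive_shift_arg/D1.
have [t ts E1] := @mean_value _ _ F y (delta_mx i 0) s (fun t ts =>
  @ex_derive _ _ _ _ _ _ _ (DF t ts)).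
have [_ E2] := DF t ts.
have [u us E3] := @mean_value _ _ (pd i f) (y + t *: delta_mx i 0) (delta_mx j 0) s
  (fun u us => (let: conj _ C1 := C2 i in let: conj _ c := C1 in
     let: conj d _ := c j in d) _ (HU _ _ ts us)).
exists t, u; split=> //.
rewrite -mulrA -[pd j _ _]/('D_(delta_mx j 0) (pd i f) _) -E3 -E2 -E1 /F.
by ring.
Qed.

Theorem pdC U f y i j : open U -> U y -> Ck 2 U f ->
  pd i (pd j f) y = pd j (pd i f) y.
Proof.
move=> oU Uy C2.
apply/eqP; rewrite -subr_eq0 -normr_le0; apply/ler_addgt0Pr => e e0; rewrite add0r.
have e20 : 0 < e / 2 by rewrite divr_gt0.
have N0 : \forall z \near y, U z := open_near oU Uy (fun z Uz => Uz).
have Ci k l : {for y, continuous (pd k (pd l f))}.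
  by have [_ C1] := C2; have [_ [_ C0]] := C1 l; have [_ [c _]] := C0 k; exact: c.
have N1 k l : \forall z \near y, `|pd k (pd l f) y - pd k (pd l f) z| <= e / 2.
  by have /cvgrPdist_le := Ci k l; apply.
have N : \forall z \near y, U z /\ (`|pd i (pd j f) y - pd i (pd j f) z| <= e / 2
    /\ `|pd j (pd i f) y - pd j (pd i f) z| <= e / 2).
  exact: filterI N0 (filterI (N1 i j) (N1 j i)).
have /nbhs_ballP[d d0 Bd] := N.
pose s := d / 4.
have s0 : 0 < s by rewrite divr_gt0.
have inB k l (t u : R) : `|t| <= `|s| -> `|u| <= `|s| ->
    ball y d (y + t *: delta_mx k 0 + u *: delta_mx l 0).
  move=> ts us; rewrite mx_norm_ball /ball_ /= -addrA opprD addNKr normrN.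
  have nd k' : `|delta_mx k' 0 : 'cV[R]_n| <= 1.
    apply: norm_le_coord => // r; rewrite mxE.
    by case: (_ && _); rewrite ?normr1 ?normr0.
  apply: (le_lt_trans (ler_normD _ _)); rewrite !normrZ.
  rewrite (gtr0_norm s0) in ts us.
  have b1 : `|t| * `|delta_mx k 0 : 'cV[R]_n| <= s.
    by rewrite -[leRHS]mulr1 ler_pM.
  have b2 : `|u| * `|delta_mx l 0 : 'cV[R]_n| <= s.
    by rewrite -[leRHS]mulr1 ler_pM.
  apply: (le_lt_trans (lerD b1 b2)); by rewrite /s; have d1 : 0 < d := d0; lra.
have [t [u [ts us E1]]] : exists t u : R, [/\ `|t| <= `|s|, `|u| <= `|s| &
    f (y + s *: delta_mx i 0 + s *: delta_mx j 0) - f (y + s *: delta_mx i 0)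
    - f (y + s *: delta_mx j 0) + f y =
    s * s * pd j (pd i f) (y + t *: delta_mx i 0 + u *: delta_mx j 0)].
  exact: (second_difference (fun t u ts us => (Bd _ (inB _ _ _ _ ts us)).1) C2).
have [t' [u' [ts' us' E2]]] : exists t u : R, [/\ `|t| <= `|s|, `|u| <= `|s| &
    f (y + s *: delta_mx j 0 + s *: delta_mx i 0) - f (y + s *: delta_mx j 0)
    - f (y + s *: delta_mx i 0) + f y =
    s * s * pd i (pd j f) (y + t *: delta_mx j 0 + u *: delta_mx i 0)].
  exact: (second_difference (fun t u ts us => (Bd _ (inB _ _ _ _ ts us)).1) C2).
have E : pd j (pd i f) (y + t *: delta_mx i 0 + u *: delta_mx j 0) =
         pd i (pd j f) (y + t' *: delta_mx j 0 + u' *: delta_mx i 0).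
  apply: (@mulfI _ (s * s)); first by rewrite mulf_neq0 // gt_eqF.
  have e3 : y + s *: delta_mx j 0 + s *: delta_mx i 0 =
      y + s *: delta_mx i 0 + s *: delta_mx j 0 by rewrite addrAC.
  refine (etrans (esym E1) (etrans _ E2)).
  rewrite e3; congr (_ + _).
  by move: (f _) (f _) (f _) => a b c; rewrite addrAC.
have [_ [_ B1]] := Bd _ (inB i j _ _ ts us).
have [_ [B2 _]] := Bd _ (inB j i _ _ ts' us').
rewrite -E in B2; rewrite distrC in B1.
by rewrite (splitr e); apply: (le_trans (ler_distD _ _ _)); exact: lerD B2 B1.
Qed.
End Schwarz.

Section SmoothOn.
Context {R : realType} {n : nat}.
Variables (U : set 'cV[R]_n) (oU : open U).
Implicit Types (f g : 'cV[R]_n -> R) (y : 'cV[R]_n).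

Lemma smooth_cst (a : R) : smooth_on U (fun=> a).
Proof. by move=> k; exact: Ck_cst. Qed.

Lemma smoothD f g : smooth_on U f -> smooth_on U g -> smooth_on U (fun z => f z + g z).
Proof. by move=> Hf Hg k; exact: CkD. Qed.

Lemma smoothN f : smooth_on U f -> smooth_on U (fun z => - f z).
Proof. by move=> Hf k; exact: CkN. Qed.

Lemma smoothM f g : smooth_on U f -> smooth_on U g -> smooth_on U (fun z => f z * g z).
Proof. by move=> Hf Hg k; exact: CkM. Qed.

Lemma smoothV f : (forall y, U y -> f y != 0) -> smooth_on U f ->
  smooth_on U (fun z => (f z)^-1).
Proof. by move=> f0 Hf k; exact: CkV. Qed.

Lemma smooth_sqrt f : (forall y, U y -> 0 < f y) -> smooth_on U f ->
  smooth_on U (fun z => Num.sqrt (f z)).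
Proof. by move=> f0 Hf k; exact: Ck_sqrt. Qed.

Lemma smooth_eq f g : (forall y, U y -> f y = g y) -> smooth_on U f -> smooth_on U g.
Proof. by move=> fg Hf k; exact: Ck_eq fg (Hf k). Qed.

Lemma smooth_pd i f : smooth_on U f -> smooth_on U (pd i f).
Proof. by move=> Hf k; have [_ /(_ i) []] := Hf k.+1. Qed.

Lemma smooth_sum (I : Type) (r : seq I) (P : pred I) (F : I -> 'cV[R]_n -> R) :
  (forall i, P i -> smooth_on U (F i)) ->
  smooth_on U (fun z => \sum_(i <- r | P i) F i z).
Proof.
move=> HF; elim: r => [|i r IH].
  by apply: (smooth_eq _ (smooth_cst 0)) => y _; rewrite big_nil.
have [Pi|Pi] := boolP (P i).
  apply: (smooth_eq _ (smoothD (HF i Pi) IH)) => y _.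
  by rewrite big_cons Pi.
by apply: (smooth_eq _ IH) => y _; rewrite big_cons (negbTE Pi).
Qed.

Lemma smooth_prod (I : Type) (r : seq I) (P : pred I) (F : I -> 'cV[R]_n -> R) :
  (forall i, P i -> smooth_on U (F i)) ->
  smooth_on U (fun z => \prod_(i <- r | P i) F i z).
Proof.
move=> HF; elim: r => [|i r IH].
  by apply: (smooth_eq _ (smooth_cst 1)) => y _; rewrite big_nil.
have [Pi|Pi] := boolP (P i).
  apply: (smooth_eq _ (smoothM (HF i Pi) IH)) => y _.
  by rewrite big_cons Pi.
by apply: (smooth_eq _ IH) => y _; rewrite big_cons (negbTE Pi).
Qed.

Lemma smooth_mulmx p q r (A : 'cV[R]_n -> 'M[R]_(p, q)) (B : 'cV[R]_n -> 'M[R]_(q, r)) :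
  smooth_mx U A -> smooth_mx U B -> smooth_mx U (fun y => A y *m B y).
Proof.
move=> HA HB i j.
apply: (@smooth_eq (fun y => \sum_k A y i k * B y k j)) => [y _|]; first by rewrite mxE.
by apply: smooth_sum => k _; apply: smoothM.
Qed.

Lemma smooth_det p (A : 'cV[R]_n -> 'M[R]_p) : smooth_mx U A ->
  smooth_on U (fun y => \det (A y)).
Proof.
move=> HA; apply: smooth_sum => s _; apply: smoothM; first exact: smooth_cst.
by apply: smooth_prod => k _.
Qed.

Lemma smooth_invmx p (A : 'cV[R]_n -> 'M[R]_p) : (forall y, U y -> \det (A y) != 0) ->
  smooth_mx U A -> smooth_mx U (fun y => invmx (A y)).
Proof.
move=> dA HA i j.
apply: (@smooth_eq (fun y => (\det (A y))^-1 * cofactor (A y) j i)) => [y Uy|].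
  by rewrite /invmx unitmxE unitfE dA // !mxE.
apply: smoothM; first by apply: smoothV => //; exact: smooth_det.
apply: smoothM; first exact: smooth_cst.
apply: smooth_det => r s; apply: (@smooth_eq (fun y => A y (lift j r) (lift i s))).
  by move=> y _; rewrite !mxE.
exact: HA.
Qed.

Lemma smooth_derivable f y i : smooth_on U f -> U y -> derivable f y (delta_mx i 0).
Proof. by move=> Hf Uy; have [_ /(_ i) [d _]] := Hf 1%N; exact: d. Qed.

Lemma pd_cst (a : R) y i : pd i (fun=> a) y = 0.
Proof. exact: derive_cst. Qed.

Section Rules.
Variables (y : 'cV[R]_n) (i : 'I_n) (Uy : U y).

Lemma pdD f g : smooth_on U f -> smooth_on U g ->
  pd i (fun z => f z + g z) y = pd i f y + pd i g y.
Proof. by move=> Hf Hg; apply: deriveD; exact: smooth_derivable. Qed.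

Lemma pdM f g : smooth_on U f -> smooth_on U g ->
  pd i (fun z => f z * g z) y = pd i f y * g y + f y * pd i g y.
Proof.
move=> Hf Hg; rewrite addrC [_ * g y]mulrC.
by apply: deriveM; exact: smooth_derivable.
Qed.

Lemma pdZ (a : R) f : smooth_on U f -> pd i (fun z => a * f z) y = a * pd i f y.
Proof. by move=> Hf; rewrite pdM // ?pd_cst ?mul0r ?add0r //; exact: smooth_cst. Qed.

Lemma pdN f : smooth_on U f -> pd i (fun z => - f z) y = - pd i f y.
Proof. by move=> Hf; apply: deriveN; exact: smooth_derivable. Qed.

Lemma pdB f g : smooth_on U f -> smooth_on U g ->
  pd i (fun z => f z - g z) y = pd i f y - pd i g y.
Proof. by move=> Hf Hg; rewrite pdD ?pdN //; exact: smoothN. Qed.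

Lemma pd_sum (I : Type) (r : seq I) (F : I -> 'cV[R]_n -> R) :
  (forall k, smooth_on U (F k)) ->
  pd i (fun z => \sum_(k <- r) F k z) y = \sum_(k <- r) pd i (F k) y.
Proof.
move=> HF; elim: r => [|k r IH].
  rewrite big_nil -[RHS](pd_cst 0 y i); apply: (pd_eq i oU Uy) => z _.
  by rewrite big_nil.
rewrite big_cons -IH -pdD //; last by apply: smooth_sum.
by apply: (pd_eq i oU Uy) => z _; rewrite big_cons.
Qed.

Lemma pd_pdC j f : smooth_on U f -> pd i (pd j f) y = pd j (pd i f) y.
Proof. by move=> Hf; apply: (pdC _ _ oU Uy); exact: Hf. Qed.

End Rules.

(** The Cholesky factorisation is algebraic except for square roots of
    positive functions, so that it depends smoothly on the matrix. *)
Lemma smooth_cholesky p (g : 'cV[R]_n -> 'M[R]_p) :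
  smooth_mx U g -> (forall y, U y -> (g y)^T = g y) ->
  (forall y, U y -> forall v : 'cV[R]_p, v != 0 -> 0 < (v^T *m g y *m v) 0 0) ->
  exists E : 'cV[R]_n -> 'M[R]_p, [/\ smooth_mx U E,
    forall y, U y -> (E y)^T *m E y = g y & forall y, U y -> 0 < \det (E y)].
Proof.
elim: p g => [|p IH] g Hg gT gP.
  exists (fun=> 1%:M); split=> [i|y _|y _]; first by case: i.
    by apply/matrixP; case.
  by rewrite det_mx00.
pose a y := g y 0 0.
pose b y : 'rV[R]_p := ursubmx (g y : 'M[R]_(1 + p)).
pose C y : 'M[R]_p := drsubmx (g y : 'M[R]_(1 + p)).
have aE y : ulsubmx (g y : 'M[R]_(1 + p)) = (a y)%:M.
  apply/matrixP => i j; rewrite !ord1 !mxE eqxx mulr1n /a.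
  by congr (g y _ _); apply/val_inj.
have blockE y : U y -> g y = block_mx (a y)%:M (b y) (b y)^T (C y) :> 'M[R]_(1 + p).
  move=> Uy; apply: (etrans (esym (@submxK R 1 p 1 p (g y)))); rewrite aE; congr block_mx.
  by rewrite /b trmx_ursub gT.
have a0 y : U y -> 0 < a y.
  move=> Uy; have := gP y Uy (delta_mx 0 0).
  rewrite trmx_delta -rowE -colE !mxE; apply.
  by apply/eqP => /matrixP /(_ 0 0) /eqP; rewrite !mxE !eqxx oner_eq0.
have sa : smooth_on U a by exact: Hg.
have sb : smooth_mx U b.
  move=> i j; rewrite /b; apply: (@smooth_eq (fun y => g y (lshift p i) (rshift 1 j))).
    by move=> y _; rewrite !mxE.
  exact: Hg.
have sC : smooth_mx U C.
  move=> i j; apply: (@smooth_eq (fun y => g y (rshift 1 i) (rshift 1 j))).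
    by move=> y _; rewrite !mxE.
  exact: Hg.
have sV : smooth_on U (fun y => (a y)^-1).
  by apply: smoothV => // y /a0 ay; rewrite gt_eqF.
pose S y : 'M[R]_p := C y - (a y)^-1 *: ((b y)^T *m b y).
have [||y Uy v v0|E' [sE' E'E E'd]] := IH S.
- move=> i j; apply: (@smooth_eq (fun y => C y i j - (a y)^-1 * (b y 0 i * b y 0 j))).
    by move=> y _; rewrite !mxE big_ord1 !mxE.
  by apply: smoothD => //; apply: smoothN; apply: smoothM => //; exact: smoothM.
- move=> y Uy; rewrite /S linearB linearZ /= trmx_mul trmxK; congr (_ - _).
  by rewrite /C trmx_drsub gT.
- pose k := - ((a y)^-1 *: (b y *m v)).
  have ane : a y != 0 by rewrite gt_eqF ?a0.
  have E1 : k^T *m (a y)%:M + v^T *m (b y)^T = 0.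
    rewrite /k linearN linearZ /= trmx_mul mulNmx mul_mx_scalar scalerA.
    by rewrite mulfV // scale1r addNr.
  have E2 : k^T *m b y + v^T *m C y = v^T *m S y.
    rewrite /k /S linearN linearZ /= trmx_mul mulmxBr mulNmx -scalemxAl -scalemxAr.
    by rewrite mulmxA addrC.
  have Q : (col_mx k v)^T *m (g y : 'M[R]_(1 + p)) *m col_mx k v = v^T *m S y *m v.
    by rewrite blockE // tr_col_mx mul_row_block mul_row_col E1 E2 mul0mx add0r.
  rewrite -Q; apply: gP => //.
  apply: contra v0 => /eqP /(congr1 (@dsubmx _ 1 p 1)).
  by rewrite col_mxKd => ->; rewrite linear0.
pose r y := Num.sqrt (a y).
have r0 y : U y -> 0 < r y by move=> /a0; rewrite sqrtr_gt0.
have sr : smooth_on U r by exact: smooth_sqrt.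
have sI : smooth_on U (fun y => (r y)^-1).
  by apply: smoothV => // y /r0 ay; rewrite gt_eqF.
exists (fun y => block_mx (r y)%:M ((r y)^-1 *: b y) 0 (E' y) : 'M[R]_(1 + p)).
split=> [i j|y Uy|y Uy].
- case: (@splitP 1 p i) => i' ei; case: (@splitP 1 p j) => j' ej.
  + have -> : i = lshift p i' by apply/val_inj.
    have -> : j = lshift p j' by apply/val_inj.
    apply: (@smooth_eq r) => // y _; apply/esym.
    apply: (etrans (@block_mxEul R 1 p 1 p _ _ _ _ i' j')).
    by rewrite !ord1 mxE eqxx mulr1n.
  + have -> : i = lshift p i' by apply/val_inj.
    have -> : j = rshift 1 j' by apply/val_inj.
    apply: (@smooth_eq (fun y => (r y)^-1 * b y i' j')) => [y _|]; last exact: smoothM.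
    apply/esym; apply: (etrans (@block_mxEur R 1 p 1 p _ _ _ _ i' j')).
    by rewrite mxE.
  + have -> : i = rshift 1 i' by apply/val_inj.
    have -> : j = lshift p j' by apply/val_inj.
    apply: (@smooth_eq (fun=> 0)) => [y _|]; last exact: smooth_cst.
    apply/esym; apply: (etrans (@block_mxEdl R 1 p 1 p _ _ _ _ i' j')).
    by rewrite mxE.
  + have -> : i = rshift 1 i' by apply/val_inj.
    have -> : j = rshift 1 j' by apply/val_inj.
    apply: (@smooth_eq (fun y => E' y i' j')) => [y _|]; last exact: sE'.
    by apply/esym; apply: (@block_mxEdr R 1 p 1 p).
- have rr : r y * r y = a y by rewrite -expr2 sqr_sqrtr // ltW ?a0.
  have rne : r y != 0 by rewrite gt_eqF ?r0.
  rewrite blockE //; apply: (etrans (_ : (block_mx (r y)%:M ((r y)^-1 *: b y) 0 (E' y))^T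
    *m (block_mx (r y)%:M ((r y)^-1 *: b y) 0 (E' y)) = _)); first by [].
  rewrite tr_block_mx mulmx_block trmx0 !mul0mx !mulmx0 !addr0 tr_scalar_mx.
  rewrite -scalar_mxM rr E'E // /S.
  rewrite mul_scalar_mx mul_mx_scalar [((r y)^-1 *: b y)^T]linearZ /= !scalerA mulfV // !scale1r.
  rewrite -scalemxAl -scalemxAr scalerA -invfM rr.
  by rewrite addrCA subrr addr0.
- have D := @det_ublock R 1 p (r y)%:M ((r y)^-1 *: b y) (E' y).
  apply: (@lt_le_trans _ _ (r y * \det (E' y))); first by rewrite mulr_gt0 ?r0 ?E'd.
  by rewrite det_scalar1 in D; rewrite -D.
Qed.

End SmoothOn.

Lemma differentiable_coords (R : realType) (m n : nat) (phi : 'cV[R]_m -> 'cV[R]_n) y :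
  (forall j, differentiable (fun z => phi z j 0) y) -> differentiable phi y.
Proof.
move=> D; have -> : phi = \sum_j (fun z => phi z j 0 *: (delta_mx j 0 : 'cV[R]_n)).
  apply/funext => z; rewrite fct_sumE; apply/matrixP => r s.
  rewrite summxE (bigD1 r) //= big1 ?addr0 => [|k kr].
    by rewrite !mxE ord1 !eqxx mulr1.
  by rewrite !mxE eq_sym (negbTE kr) mulr0.
by apply: differentiable_sum => j; apply: differentiableZl.
Qed.

Lemma smooth_comp (R : realType) (m n : nat) (U : set 'cV[R]_m) (V : set 'cV[R]_n)
    (phi : 'cV[R]_m -> 'cV[R]_n) f : open U -> open V -> (forall y, U y -> V (phi y)) ->
  smooth_mx U phi -> smooth_on V f -> smooth_on U (fun y => f (phi y)).
Proof.
move=> oU oV UV sphi sf k; elim: k f sf => [|k IH] f sf.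
  split=> // y Uy; apply: (@continuous_comp _ _ _ phi f); last first.
    by have [c _] := sf 0%N; exact: c (UV y Uy).
  apply: differentiable_continuous; apply: differentiable_coords => j.
  by have [d _] := C1_diff oU Uy (sphi j 0 1%N).
have CR y i Uy := @chain_rule R _ _ U V f phi y i oU oV Uy (UV y Uy) (sf 1%N) (fun j => sphi j 0 1%N).
split=> [|i]; first by case: k IH => [|k] /(_ f sf) [].
split=> [y Uy|]; first by have [] := CR y i Uy.
apply: (Ck_eq (f := fun y => \sum_j pd j f (phi y) * pd i (fun z => phi z j 0) y) oU).
  by move=> y Uy; have [_ ->] := CR y i Uy.
have: forall r : seq 'I_n, Ck k U (fun y => \sum_(j <- r) pd j f (phi y) * pd i (fun z => phi z j 0) y).
  elim=> [|j r IHr]; first by apply: (Ck_eq oU _ (Ck_cst _ U 0)) => y _; rewrite big_nil.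
  have C := CkM oU (IH _ (smooth_pd j sf)) (smooth_pd i (sphi j 0) k).
  by apply: (Ck_eq oU _ (CkD oU C IHr)) => y _; rewrite big_cons.
by apply.
Qed.

Section Powers.
Context {R : realType} {n : nat}.
Variables (U : set 'cV[R]_n) (oU : open U) (f : 'cV[R]_n -> R).
Hypotheses (f0 : forall y, U y -> 0 < f y) (sf : smooth_on U f).

Lemma derivable_ln y i : U y -> is_derive y (delta_mx i 0) (fun z => ln (f z)) ((f y)^-1 * pd i f y).
Proof.
move=> Uy; apply: is_derive_comp_fct; first exact: smooth_derivable sf Uy.
exact: is_derive1_ln (f0 Uy).
Qed.

Lemma pd_ln y i : U y -> pd i (fun z => ln (f z)) y = (f y)^-1 * pd i f y.
Proof. by move=> Uy; have [_ <-] := derivable_ln i Uy. Qed.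

Let powE (r : R) y : U y -> f y `^ r = expR (r * ln (f y)).
Proof. by move=> Uy; rewrite /powR gt_eqF // f0. Qed.

Let dpow (r : R) y i : U y ->
  is_derive y (delta_mx i 0) (fun z => expR (r * ln (f z))) (r * f y `^ r * ((f y)^-1 * pd i f y)).
Proof.
move=> Uy; have [d1 d2] := derivable_ln i Uy.
have dr : is_derive (ln (f y)) 1 (fun t : R => expR (r * t)) (r * f y `^ r).
  rewrite powE //; have h1 : is_derive (ln (f y)) 1 (fun t : R => r *: t) (r *: 1) by exact: is_deriveZ.
  have h2 := is_derive1_comp (is_derive_expR (r * ln (f y))) h1.
  by rewrite /GRing.scale /= mulr1 mulrC in h2.
by have := is_derive_comp_fct d1 dr; rewrite d2.
Qed.

Lemma pd_powR (r : R) y i : U y ->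
  pd i (fun z => f z `^ r) y = r * f y `^ r * pd i (fun z => ln (f z)) y.
Proof.
move=> Uy; rewrite pd_ln //; have [_ <-] := dpow r i Uy.
by apply: (pd_eq i oU Uy) => z Uz; rewrite powE.
Qed.

Lemma smooth_powR (r : R) : smooth_on U (fun z => f z `^ r).
Proof.
have sfi : smooth_on U (fun z => (f z)^-1) by apply: smoothV => // y Uy; rewrite gt_eqF ?f0.
suff H : smooth_on U (fun z => expR (r * ln (f z))).
  by apply: (smooth_eq oU _ H) => y Uy; rewrite powE.
elim=> [|k IH].
  split=> // y Uy.
  have cl : {for y, continuous (fun z => ln (f z))}.
    apply: continuous_comp; first by have [cf _] := sf 0%N; exact: cf.
    exact: continuous_ln (f0 Uy).
  apply: (@continuous_comp _ _ _ (fun z => ln (f z)) (fun t : R => expR (r * t))) => //.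
  apply: (@continuous_comp _ _ _ (fun t : R => r * t) expR); last exact: continuous_expR.
  exact: mulrl_continuous.
split=> [|i].
  by case: k IH => [|k] [].
split=> [y Uy|]; first by have [] := dpow r i Uy.
have C := CkM oU IH (smoothM oU (smooth_cst U r) (smoothM oU sfi (smooth_pd i sf)) k).
apply: (Ck_eq oU _ C) => y Uy; have [_ dv] := dpow r i Uy.
by apply: etrans _ (esym dv); rewrite powE // mulrCA mulrA.
Qed.

End Powers.

(** * Four-dimensional algebra *)

Definition o0 : 'I_4 := @Ordinal 4 0 isT.
Definition o1 : 'I_4 := @Ordinal 4 1 isT.
Definition o2 : 'I_4 := @Ordinal 4 2 isT.
Definition o3 : 'I_4 := @Ordinal 4 3 isT.

Lemma all4 (P : 'I_4 -> Prop) : P o0 -> P o1 -> P o2 -> P o3 -> forall i, P i.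
Proof.
move=> P0 P1 P2 P3 [[|[|[|[|i]]]] Hi] //.
- by rewrite (_ : Ordinal Hi = o0) //; apply/val_inj.
- by rewrite (_ : Ordinal Hi = o1) //; apply/val_inj.
- by rewrite (_ : Ordinal Hi = o2) //; apply/val_inj.
- by rewrite (_ : Ordinal Hi = o3) //; apply/val_inj.
Qed.

Inductive tri := T1 | T2 | T3.
Definition nx (m : tri) := match m with T1 => T2 | T2 => T3 | T3 => T1 end.

Section Algebra.
Context {R : realType}.
Implicit Types (u v w x z : 'I_4 -> R) (M N : 'M[R]_4).

Lemma sum4 (F : 'I_4 -> R) : \sum_i F i = F o0 + F o1 + F o2 + F o3.
Proof.
rewrite !big_ord_recl big_ord0 addr0 !addrA.
by congr (F _ + F _ + F _ + F _); apply/val_inj.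
Qed.

Definition B (m : tri) u v : R :=
  match m with
  | T1 => u o0 * v o1 - u o1 * v o0 + u o2 * v o3 - u o3 * v o2
  | T2 => u o0 * v o2 - u o2 * v o0 + u o3 * v o1 - u o1 * v o3
  | T3 => u o0 * v o3 - u o3 * v o0 + u o1 * v o2 - u o2 * v o1
  end.

Definition p (m : tri) M : R :=
  4^-1 * match m with
  | T1 => M o0 o1 - M o1 o0 + M o2 o3 - M o3 o2
  | T2 => M o0 o2 - M o2 o0 + M o3 o1 - M o1 o3
  | T3 => M o0 o3 - M o3 o0 + M o1 o2 - M o2 o1
  end.

Definition crs (f g : tri -> R) (m : tri) : R :=
  f (nx m) * g (nx (nx m)) - f (nx (nx m)) * g (nx m).

Definition act M u : 'I_4 -> R := fun a => \sum_b M a b * u b.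

Definition unit4 (a : 'I_4) : 'I_4 -> R := fun b => (a == b)%:R.

(* elements of the conformal Lie algebra co(4) *)
Definition conf_skew (th : R) M := forall a b, M a b + M b a = 2 * th * (a == b)%:R.

Lemma conf_skewE th M : conf_skew th M ->
  [/\ M o0 o0 = th, M o1 o1 = th, M o2 o2 = th & M o3 o3 = th] /\
  [/\ M o1 o0 = - M o0 o1, M o2 o0 = - M o0 o2, M o3 o0 = - M o0 o3 &
   [/\ M o2 o1 = - M o1 o2, M o3 o1 = - M o1 o3 & M o3 o2 = - M o2 o3]].
Proof.
move=> H; have D a : M a a = th by have := H a a; rewrite eqxx /=; lra.
have S a b : a != b -> M a b = - M b a.
  by move=> ab; have := H a b; rewrite (negbTE ab) /=; lra.
by split; split; rewrite ?D //; try split; exact: S.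
Qed.

Lemma B_conf_skew th M m u v : conf_skew th M ->
  B m (act M u) v + B m u (act M v) =
  2 * th * B m u v - 2 * crs (p^~ M) (fun m => B m u v) m.
Proof.
move=> /conf_skewE[[h0 h1 h2 h3] [h4 h5 h6 [h7 h8 h9]]].
rewrite /act; case: m; rewrite /crs /= /p !sum4 h0 h1 h2 h3 h4 h5 h6 h7 h8 h9; by field.
Qed.

Lemma p_bracket th th' M N m : conf_skew th M -> conf_skew th' N ->
  p m (M *m N - N *m M) = - 2 * crs (p^~ M) (p^~ N) m.
Proof.
move=> /conf_skewE[[h0 h1 h2 h3] [h4 h5 h6 [h7 h8 h9]]].
move=> /conf_skewE[[k0 k1 k2 k3] [k4 k5 k6 [k7 k8 k9]]].
case: m; rewrite /crs /p !mxE !sum4 h0 h1 h2 h3 h4 h5 h6 h7 h8 h9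
  k0 k1 k2 k3 k4 k5 k6 k7 k8 k9 /=; by field.
Qed.

Lemma B_antisym m u v : B m u v = - B m v u.
Proof. by case: m; rewrite /B; ring. Qed.

Lemma antisym_ext (f g : 'I_4 -> 'I_4 -> R) :
  (forall a b, f a b = - f b a) -> (forall a b, g a b = - g b a) ->
  f o0 o1 = g o0 o1 -> f o0 o2 = g o0 o2 -> f o0 o3 = g o0 o3 ->
  f o1 o2 = g o1 o2 -> f o1 o3 = g o1 o3 -> f o2 o3 = g o2 o3 ->
  forall a b, f a b = g a b.
Proof.
move=> fa ga e01 e02 e03 e12 e13 e23.
have d a : f a a = g a a by have := fa a a; have := ga a a; lra.
have s a b : f a b = g a b -> f b a = g b a by move=> e; rewrite fa (ga b) e.
by apply: all4; apply: all4; rewrite ?d //; apply: s.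
Qed.

Ltac gen_entries C :=
  repeat match goal with H : context [C] |- _ => revert H end;
  repeat match goal with |- context [fun_of_matrix (C ?a ?b) ?c ?d] =>
    let x := fresh "c" in move: (fun_of_matrix (C a b) c d) => x end;
  repeat match goal with |- context [fun_of_matrix C ?c ?d] =>
    let x := fresh "c" in move: (fun_of_matrix C c d) => x end;
  intros.

Definition pair (m : tri) (al : 'I_4 -> 'I_4 -> R) : R := p m (\matrix_(a, b) al a b).

(** Algebraic structure of the curvature of a selfdual Einstein-Weyl space: *)
Lemma curvature_algebra (C : 'I_4 -> 'I_4 -> 'M[R]_4) (F : 'M[R]_4) (s : R) :
  (forall a b, C a b = - C b a) ->
  (forall a b, conf_skew (F a b) (C a b)) ->
  (forall a b c d, C a b c d + C b d c a + C d a c b = 0) ->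
  (forall b d, \sum_a C a b a d + \sum_a C a d a b = s * (b == d)%:R) ->
  (forall l m, l <> m ->
    pair l (fun a b => p m (C a b)) + pair m (fun a b => p l (C a b)) = 0) ->
  (forall l m, pair l (fun a b => p l (C a b)) = pair m (fun a b => p m (C a b))) ->
  forall m a b, p m (C a b) =
    pair T1 (fun a b => p T1 (C a b)) * B m (unit4 a) (unit4 b)
    - 2^-1 * crs (p^~ F) (fun m => B m (unit4 a) (unit4 b)) m.
Proof.
move=> Ca Cs bi ric q1 q2.
have Caa a b c d : C a b c d = - C b a c d by rewrite Ca mxE.
have C0 a c d : C a a c d = 0 by have := Caa a a c d; lra.
have S a b := conf_skewE (Cs a b).
have [[a00 a01 a02 a03] [a04 a05 a06 [a07 a08 a09]]] := S o0 o1.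
have [[b00 b01 b02 b03] [b04 b05 b06 [b07 b08 b09]]] := S o0 o2.
have [[c00 c01 c02 c03] [c04 c05 c06 [c07 c08 c09]]] := S o0 o3.
have [[d00 d01 d02 d03] [d04 d05 d06 [d07 d08 d09]]] := S o1 o2.
have [[e00 e01 e02 e03] [e04 e05 e06 [e07 e08 e09]]] := S o1 o3.
have [[f00 f01 f02 f03] [f04 f05 f06 [f07 f08 f09]]] := S o2 o3.
have Faa a b : F a b = - F b a.
  by have [[<- _ _ _] _] := S a b; have [[<- _ _ _] _] := S b a; rewrite Caa.
have rs := (C0, Caa o1 o0, Caa o2 o0, Caa o3 o0, Caa o2 o1, Caa o3 o1, Caa o3 o2,
  Faa o1 o0, Faa o2 o0, Faa o3 o0, Faa o2 o1, Faa o3 o1, Faa o3 o2).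
have rs1 := (a00,a01,a02,a03,a04,a05,a06,a07,a08,a09,
  b00,b01,b02,b03,b04,b05,b06,b07,b08,b09).
have rs2 := (c00,c01,c02,c03,c04,c05,c06,c07,c08,c09,
  d00,d01,d02,d03,d04,d05,d06,d07,d08,d09).
have rs3 := (e00,e01,e02,e03,e04,e05,e06,e07,e08,e09,
  f00,f01,f02,f03,f04,f05,f06,f07,f08,f09).
have B0 c : C o0 o1 c o2 + C o1 o2 c o0 - C o0 o2 c o1 = 0.
  by rewrite -(bi o0 o1 c o2) (Caa o2 o0).
have B1' c : C o0 o1 c o3 + C o1 o3 c o0 - C o0 o3 c o1 = 0.
  by rewrite -(bi o0 o1 c o3) (Caa o3 o0).
have B2' c : C o0 o2 c o3 + C o2 o3 c o0 - C o0 o3 c o2 = 0.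
  by rewrite -(bi o0 o2 c o3) (Caa o3 o0).
have B3' c : C o1 o2 c o3 + C o2 o3 c o1 - C o1 o3 c o2 = 0.
  by rewrite -(bi o1 o2 c o3) (Caa o3 o1).
have := (B0 o0, B0 o1, B0 o2, B0 o3).
have := (B1' o0, B1' o1, B1' o2, B1' o3).
have := (B2' o0, B2' o1, B2' o2, B2' o3).
have := (B3' o0, B3' o1, B3' o2, B3' o3).
have := (ric o0 o0, ric o1 o1, ric o2 o2, ric o3 o3).
have := (ric o0 o1, ric o0 o2, ric o0 o3, ric o1 o2, ric o1 o3, ric o2 o3).
have q12 := q1 T1 T2 ltac:(discriminate).
have q13 := q1 T1 T3 ltac:(discriminate).
have q23 := q1 T2 T3 ltac:(discriminate).
have q4 := q2 T1 T2; have q5 := q2 T1 T3.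
move: q12 q13 q23 q4 q5.
rewrite /pair /p !mxE /= !sum4 /= !rs !rs1 !rs2 !rs3.
move=> q12 q13 q23 q4 q5 [[[[[r01 r02] r03] r12] r13] r23] [[[r0 r1] r2] r3].
move=> [[[x0 x1] x2] x3] [[[y0 y1] y2] y3] [[[z0 z1] z2] z3] [[[w0 w1] w2] w3].
clear S B0 B1' B2' B3' bi ric q1 q2.
move=> m; apply: antisym_ext => [a b|a b||||||].
- by case: m; rewrite /p !(Caa a b); ring.
- by rewrite /crs !(B_antisym _ (unit4 a)); ring.
all: case: m; rewrite /pair /p /crs /B /unit4 ?mxE /= ?rs ?rs1 ?rs2 ?rs3.
all: clear - q12 q13 q23 q4 q5 r01 r02 r03 r12 r13 r23 r0 r1 r2 r3
  x0 x1 x2 x3 y0 y1 y2 y3 z0 z1 z2 z3 w0 w1 w2 w3.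
all: gen_entries C; gen_entries F.
all: lra.
Qed.

End Algebra.

Section Algebra2.
Context {R : realType}.
Implicit Types (u v w x z : 'I_4 -> R) (M N : 'M[R]_4).

Definition cyc (f : 'I_4 -> 'I_4 -> 'I_4 -> R) a b c := f a b c + f b c a + f c a b.

Definition Bu m a b : R := B m (unit4 a) (unit4 b).

Lemma twistor_algebra z (N : tri -> 'I_4 -> R) :
  (forall m a b c, cyc (fun a b c => z c * Bu m a b +
     crs (N^~ c) (fun m => Bu m a b) m) a b c = 0) ->
  forall m c, 2 * N m c = - B m (unit4 c) z.
Proof.
move=> H.
have := (H T1 o0 o1 o2, H T1 o0 o1 o3, H T1 o0 o2 o3, H T1 o1 o2 o3).
have := (H T2 o0 o1 o2, H T2 o0 o1 o3, H T2 o0 o2 o3, H T2 o1 o2 o3).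
have := (H T3 o0 o1 o2, H T3 o0 o1 o3, H T3 o0 o2 o3, H T3 o1 o2 o3).
rewrite /cyc /Bu /crs /B /unit4 /= => -[[[a0 a1] a2] a3] [[[b0 b1] b2] b3] [[[c0 c1] c2] c3].
by case; apply: all4; rewrite /B /unit4 /=; lra.
Qed.

Lemma source_algebra (s : R) x (G : 'I_4 -> 'I_4 -> R) m a b c :
  (forall a b, G a b = - G b a) -> (forall m, pair m G = 0) ->
  cyc (fun c a b => - 2 * crs (fun m => s * Bu m c a) (fun m => B m (unit4 b) x) m
     + G c a * B m (unit4 b) x) c a b =
  cyc (fun a b c => (4 * s * x c + \sum_d x d * G d c) * Bu m a b) a b c.
Proof.
move=> Ga H.
have G0 a' : G a' a' = 0 by have := Ga a' a'; lra.
have := (H T1, H T2, H T3); rewrite /pair /p !mxE.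
rewrite (Ga o1 o0) (Ga o2 o0) (Ga o3 o0) (Ga o2 o1) (Ga o3 o1) (Ga o3 o2).
move=> [[h1 h2] h3].
have e1 : G o2 o3 = - G o0 o1 by lra.
have e2 : G o1 o3 = G o0 o2 by lra.
have e3 : G o1 o2 = - G o0 o3 by lra.
have rs := (G0, Ga o1 o0, Ga o2 o0, Ga o3 o0, Ga o2 o1, Ga o3 o1, Ga o3 o2, e1, e2, e3).
move: a b c; apply: all4; apply: all4; apply: all4; case: m.
all: rewrite /cyc /Bu /crs /B /unit4 /= ?sum4 ?rs.
all: by ring.
Qed.

Lemma integrability_algebra (s : R) (Z : 'I_4 -> 'I_4 -> R) M (f : tri -> R) :
  (forall m, f m = p m M) ->
  (forall m a b, B m (unit4 b) (Z a) - B m (unit4 a) (Z b) =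
     - 2 * crs (fun m => s * Bu m a b - 2^-1 * crs f (fun m => Bu m a b) m) f m
     - (M a b - M b a) * f m) ->
  forall m, f m = 0.
Proof.
move=> fE H.
have P m m' : f m * f m' = p m M * f m' by rewrite -fE.
have := (H T1 o0 o1, H T1 o0 o2, H T1 o0 o3, H T1 o1 o2, H T1 o1 o3, H T1 o2 o3).
have := (H T2 o0 o1, H T2 o0 o2, H T2 o0 o3, H T2 o1 o2, H T2 o1 o3, H T2 o2 o3).
have := (H T3 o0 o1, H T3 o0 o2, H T3 o0 o3, H T3 o1 o2, H T3 o1 o3, H T3 o2 o3).
have := (P T1 T1, P T1 T2, P T1 T3, P T2 T1, P T2 T2, P T2 T3, P T3 T1, P T3 T2, P T3 T3).
rewrite /p /Bu /crs /B /unit4 /=.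
move=> -[[[[[[[[p11 p12] p13] p21] p22] p23] p31] p32] p33].
move=> -[[[[[a1 a2] a3] a4] a5] a6] [[[[[b1 b2] b3] b4] b5] b6] [[[[[c1 c2] c3] c4] c5] c6].
clear H P fE.
have q12 : f T1 * f T2 = 0 by lra.
have q13 : f T1 * f T3 = 0 by lra.
have q23 : f T2 * f T3 = 0 by lra.
have q1 : f T1 * f T1 = f T2 * f T2 by lra.
have q2 : f T1 * f T1 = f T3 * f T3 by lra.
have z0 : f T1 = 0.
  apply/eqP; rewrite -[_ == 0]orbb -mulf_eq0; apply/eqP.
  move/eqP: q12; rewrite mulf_eq0 => /orP[|] /eqP e; first by rewrite e mul0r.
  by rewrite q1 e mul0r.
rewrite z0 mul0r in q1 q2.
have z1 : f T2 = 0 by apply/eqP; rewrite -[_ == 0]orbb -mulf_eq0 -q1.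
have z2 : f T3 = 0 by apply/eqP; rewrite -[_ == 0]orbb -mulf_eq0 -q2.
by case.
Qed.

(** infinitesimal form of the fact that [n / |n|] is parallel for the gauge
    changed connection *)
Lemma kahler_algebra (k : tri -> R) (t : R) d z e :
  t != 0 -> k T1 ^+ 2 + k T2 ^+ 2 + k T3 ^+ 2 = 1 ->
  (forall a, - t * d a = k T1 * B T1 (unit4 a) z + k T2 * B T2 (unit4 a) z
     + k T3 * B T3 (unit4 a) z) ->
  forall m, t * ((\sum_a d a * e a) * k m - crs (fun m => B m e d) k m) + B m e z = 0.
Proof.
move=> t0 k1 H.
have := (H o0, H o1, H o2, H o3); rewrite /B /unit4 /= => -[[[h0 h1] h2] h3].
have mul (a b c : R) : a = b -> c * a = c * b by move=> ->.
have E i : z i * (k T1 ^+ 2 + k T2 ^+ 2 + k T3 ^+ 2) = z i * 1 by rewrite k1.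
have z0 : z o0 = t * (k T1 * d o1 + k T2 * d o2 + k T3 * d o3).
  have := (E o0, mul _ _ (k T1) h1, mul _ _ (k T2) h2, mul _ _ (k T3) h3).
  by clear; move=> [[[]]]; lra.
have z1 : z o1 = t * (- k T1 * d o0 - k T2 * d o3 + k T3 * d o2).
  have := (E o1, mul _ _ (k T1) h0, mul _ _ (k T2) h3, mul _ _ (k T3) h2).
  by clear; move=> [[[]]]; lra.
have z2 : z o2 = t * (k T1 * d o3 - k T2 * d o0 - k T3 * d o1).
  have := (E o2, mul _ _ (k T1) h3, mul _ _ (k T2) h0, mul _ _ (k T3) h1).
  by clear; move=> [[[]]]; lra.
have z3 : z o3 = t * (- k T1 * d o2 + k T2 * d o1 - k T3 * d o0).
  have := (E o3, mul _ _ (k T1) h2, mul _ _ (k T2) h1, mul _ _ (k T3) h0).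
  by clear; move=> [[[]]]; lra.
by case; rewrite /crs /B /= sum4 z0 z1 z2 z3; ring.
Qed.

End Algebra2.

Local Opaque pd.

(** * Gauge calculus in an orthonormal frame *)

Ltac sm := repeat first
  [ assumption
  | match goal with
    | H : forall _, smooth_on _ _ |- _ => apply: H
    | H : forall _ _, smooth_on _ _ |- _ => apply: H
    | H : forall _ _ _, smooth_on _ _ |- _ => apply: H
    | H : smooth_mx _ _ |- _ => apply: H
    | H : forall _, smooth_mx _ _ |- _ => apply: H
    end
  | apply: smoothN | apply: smoothD | apply: smoothM | apply: smooth_cst | apply: smooth_pd
  | apply: smooth_sum; [assumption|move=> ? ?] ].

Ltac gen_pd := repeat match goal with |- context [pd ?i ?f ?y] =>
  let x := fresh "x" in generalize (pd i f y); intro x end.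

Ltac pdr oU Uy :=
  repeat first [ rewrite (pdB oU _ Uy); [|by sm|by sm]
    | rewrite (pdD _ Uy); [|by sm|by sm]
    | rewrite (pdN _ Uy); [|by sm]
    | rewrite (pdZ _ Uy); [|by sm]
    | rewrite (pdM _ Uy); [|by sm|by sm] ].

Section Gauge.
Context {R : realType}.
Variables (U : set 'cV[R]_4) (oU : open U).
Implicit Types (y : 'cV[R]_4) (f : tri -> 'cV[R]_4 -> R).

Definition nab (a : tri -> 'I_4 -> 'cV[R]_4 -> R) (w : 'I_4 -> 'cV[R]_4 -> R) (i : 'I_4)
    f (m : tri) y : R :=
  pd i (f m) y - 2 * crs (fun l => a l i y) (fun l => f l y) m + w i y * f m y.

Definition Om (a : tri -> 'I_4 -> 'cV[R]_4 -> R) m i j y : R :=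
  pd i (a m j) y - pd j (a m i) y - 2 * crs (fun l => a l i y) (fun l => a l j y) m.

Variables (a : tri -> 'I_4 -> 'cV[R]_4 -> R) (w : 'I_4 -> 'cV[R]_4 -> R).
Hypothesis sa : forall l i, smooth_on U (a l i).
Hypothesis sw : forall i, smooth_on U (w i).

Lemma smooth_nab f i m : (forall l, smooth_on U (f l)) ->
  smooth_on U (fun y => nab a w i f m y).
Proof. by move=> sf; rewrite /nab /crs; sm. Qed.

Lemma nab_sub f g i m y : (forall l, smooth_on U (f l)) -> (forall l, smooth_on U (g l)) ->
  U y -> nab a w i (fun l z => f l z - g l z) m y = nab a w i f m y - nab a w i g m y.
Proof.
move=> sf sg Uy; rewrite /nab (pdB oU i Uy (sf m) (sg m)) /crs.
by gen_pd; ring.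
Qed.

Lemma nab_nab f i j m y : (forall l, smooth_on U (f l)) -> U y ->
  nab a w i (nab a w j f) m y - nab a w j (nab a w i f) m y =
  - 2 * crs (fun l => Om a l i j y) (fun l => f l y) m
  + (pd i (w j) y - pd j (w i) y) * f m y.
Proof.
move=> sf Uy.
have E i' j' l : pd i' (nab a w j' f l) y =
    pd i' (pd j' (f l)) y - 2 * (pd i' (a (nx l) j') y * f (nx (nx l)) y
      + a (nx l) j' y * pd i' (f (nx (nx l))) y
      - (pd i' (a (nx (nx l)) j') y * f (nx l) y + a (nx (nx l)) j' y * pd i' (f (nx l)) y))
    + (pd i' (w j') y * f l y + w j' y * pd i' (f l) y).
  by rewrite -[nab _ _ _ _ _]/(fun y => nab a w j' f l y) /nab /crs; pdr oU Uy.
rewrite /nab -/(nab a w j f) -/(nab a w i f).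
rewrite !E (pd_pdC oU i Uy j (sf m)) /crs /Om /crs /nab /crs.
by case: m => /=; gen_pd; ring.
Qed.

Lemma bianchi i j k m y : U y ->
  nab a (fun _ _ => 0) k (fun l => Om a l i j) m y
  + nab a (fun _ _ => 0) i (fun l => Om a l j k) m y
  + nab a (fun _ _ => 0) j (fun l => Om a l k i) m y = 0.
Proof.
move=> Uy.
have E i' j' k' l : pd k' (Om a l i' j') y =
    pd k' (pd i' (a l j')) y - pd k' (pd j' (a l i')) y
    - 2 * (pd k' (a (nx l) i') y * a (nx (nx l)) j' y
      + a (nx l) i' y * pd k' (a (nx (nx l)) j') y
      - (pd k' (a (nx (nx l)) i') y * a (nx l) j' y
      + a (nx (nx l)) i' y * pd k' (a (nx l) j') y)).
  by rewrite -[Om _ _ _ _]/(fun y => Om a l i' j' y) /Om /crs; pdr oU Uy.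
rewrite /nab !E /crs /Om /crs.
rewrite (pd_pdC oU k Uy i (sa m j)) (pd_pdC oU k Uy j (sa m i)) (pd_pdC oU i Uy j (sa m k)).
by case: m => /=; gen_pd; ring.
Qed.

Lemma nab_nab1 (y1 : tri -> 'I_4 -> 'cV[R]_4 -> R) i j k m y :
  (forall l i, smooth_on U (y1 l i)) -> U y ->
  let Y i j l z := nab a w i (fun l => y1 l j) l z - nab a w j (fun l => y1 l i) l z in
  let C i j k := - 2 * crs (fun l => Om a l i j y) (fun l => y1 l k y) m
    + (pd i (w j) y - pd j (w i) y) * y1 m k y in
  nab a w k (Y i j) m y + nab a w i (Y j k) m y + nab a w j (Y k i) m y
  = C k i j + C i j k + C j k i.
Proof.
move=> sy Uy Y C.
have S i' j' l : smooth_on U (nab a w i' (fun l => y1 l j') l).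
  by apply: smooth_nab.
have L i' j' k' : nab a w k' (Y i' j') m y =
    nab a w k' (nab a w i' (fun l => y1 l j')) m y - nab a w k' (nab a w j' (fun l => y1 l i')) m y.
  exact: nab_sub.
have := nab_nab k i m (fun l => sy l j) Uy; have := nab_nab i j m (fun l => sy l k) Uy.
have := nab_nab j k m (fun l => sy l i) Uy.
rewrite !L /C => <- <- <-; by ring.
Qed.

End Gauge.

Section Frame.
Context {R : realType}.
Variables (U : set 'cV[R]_4) (oU : open U).
Implicit Types (y : 'cV[R]_4) (v : 'I_4 -> 'cV[R]_4 -> R).
Variables (E : 'cV[R]_4 -> 'M[R]_4) (A : 'I_4 -> 'cV[R]_4 -> 'M[R]_4)
  (th : 'I_4 -> 'cV[R]_4 -> R).
Hypotheses (sE : smooth_mx U E) (sA : forall i, smooth_mx U (A i)).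

Definition fr (j a : 'I_4) y : R := E y a j.

Definition cov (i : 'I_4) v (a : 'I_4) y : R := pd i (v a) y + act (A i y) (v^~ y) a.

Definition ga (l : tri) (i : 'I_4) y : R := p l (A i y).

Hypothesis tors : forall y, U y -> forall i j a, cov i (fr j) a y = cov j (fr i) a y.
Hypothesis metr : forall y, U y -> forall i, conf_skew (th i y) (A i y).

Lemma smooth_B (u v : 'I_4 -> 'cV[R]_4 -> R) m :
  (forall a, smooth_on U (u a)) -> (forall a, smooth_on U (v a)) ->
  smooth_on U (fun y => B m (u^~ y) (v^~ y)).
Proof. by move=> su sv; rewrite /B; case: m; sm. Qed.

Lemma smooth_p (M : 'cV[R]_4 -> 'M[R]_4) m : smooth_mx U M ->
  smooth_on U (fun y => p m (M y)).
Proof. by move=> sM; rewrite /p; case: m; sm. Qed.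

Lemma pd_p (M : 'cV[R]_4 -> 'M[R]_4) i m y : U y -> smooth_mx U M ->
  pd i (fun y => p m (M y)) y = p m (\matrix_(a, b) pd i (fun y => M y a b) y).
Proof.
move=> Uy sM; rewrite /p; case: m; pdr oU Uy.
all: by rewrite !mxE.
Qed.

Lemma pd_B (u v : 'I_4 -> 'cV[R]_4 -> R) i m y : U y ->
  (forall a, smooth_on U (u a)) -> (forall a, smooth_on U (v a)) ->
  pd i (fun y => B m (u^~ y) (v^~ y)) y =
  B m (fun a => pd i (u a) y) (v^~ y) + B m (u^~ y) (fun a => pd i (v a) y).
Proof. by move=> Uy su sv; rewrite /B; case: m; pdr oU Uy; gen_pd; ring. Qed.

Lemma B_linear m (u u' v : 'I_4 -> R) : B m (fun a => u a + u' a) v = B m u v + B m u' v.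
Proof. by rewrite /B; case: m; ring. Qed.

Lemma B_linearr m (u v v' : 'I_4 -> R) : B m u (fun a => v a + v' a) = B m u v + B m u v'.
Proof. by rewrite /B; case: m; ring. Qed.

Lemma nab_B w i j v m y : U y -> (forall a, smooth_on U (v a)) ->
  nab ga w i (fun l y => B l ((fr j)^~ y) (v^~ y)) m y =
  B m ((cov i (fr j))^~ y) (v^~ y) + B m ((fr j)^~ y) ((cov i v)^~ y)
  + (w i y - 2 * th i y) * B m ((fr j)^~ y) (v^~ y).
Proof.
move=> Uy sv.
have sf b : smooth_on U (fr j b) by exact: sE.
rewrite /nab pd_B // /cov B_linear B_linearr.
have := B_conf_skew m ((fr j)^~ y) (v^~ y) (metr Uy i).
rewrite /ga /crs; set X := act _ _; set Y := act _ (v^~ y).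
rewrite -[B m (fun a => X a) _]/(B m X _) -[B m _ (fun a => Y a)]/(B m _ Y).
by move=> H; lra.
Qed.

Lemma nab_BB w i j k m y : U y ->
  nab ga w k (fun l y => B l ((fr i)^~ y) ((fr j)^~ y)) m y
  + nab ga w i (fun l y => B l ((fr j)^~ y) ((fr k)^~ y)) m y
  + nab ga w j (fun l y => B l ((fr k)^~ y) ((fr i)^~ y)) m y =
  (w k y - 2 * th k y) * B m ((fr i)^~ y) ((fr j)^~ y)
  + (w i y - 2 * th i y) * B m ((fr j)^~ y) ((fr k)^~ y)
  + (w j y - 2 * th j y) * B m ((fr k)^~ y) ((fr i)^~ y).
Proof.
move=> Uy; have sf l b : smooth_on U (fr l b) by exact: sE.
rewrite !nab_B //.
have T i' j' : (cov i' (fr j'))^~ y = (cov j' (fr i'))^~ y.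
  by apply/funext => b; exact: tors.
rewrite (T k i) (T k j) (T i j).
rewrite (B_antisym m ((fr i)^~ y) ((cov j (fr k))^~ y)).
rewrite (B_antisym m ((fr j)^~ y) ((cov i (fr k))^~ y)).
rewrite (B_antisym m ((fr k)^~ y) ((cov j (fr i))^~ y)).
by ring.
Qed.

End Frame.

Section Linear.
Context {R : realType}.
Implicit Types (u v w : 'I_4 -> R) (f g : ('I_4 -> R) -> R).

Definition lin f := forall (c : 'I_4 -> R) (w : 'I_4 -> 'I_4 -> R),
  f (fun b => \sum_i c i * w i b) = \sum_i c i * f (w i).

Definition dot (p u : 'I_4 -> R) := \sum_a p a * u a.

Lemma lin_D f g : lin f -> lin g -> lin (fun u => f u + g u).
Proof.
move=> Lf Lg c w; rewrite Lf Lg -big_split /=; apply: eq_bigr => i _.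
by rewrite mulrDr.
Qed.

Lemma lin_Ml f k : lin f -> lin (fun u => k * f u).
Proof.
move=> Lf c w; rewrite Lf mulr_sumr; apply: eq_bigr => i _; by rewrite mulrCA.
Qed.

Lemma lin_Mr f k : lin f -> lin (fun u => f u * k).
Proof.
move=> Lf c w; rewrite Lf mulr_suml; apply: eq_bigr => i _; by rewrite mulrA.
Qed.

Lemma lin_N f : lin f -> lin (fun u => - f u).
Proof.
move=> Lf c w; rewrite Lf -sumrN; apply: eq_bigr => i _; by rewrite mulrN.
Qed.

Lemma lin_Bl m v : lin (fun u => B m u v).
Proof. by move=> c w; rewrite /B; case: m; rewrite !sum4; ring. Qed.

Lemma lin_Br m v : lin (fun u => B m v u).
Proof. by move=> c w; rewrite /B; case: m; rewrite !sum4; ring. Qed.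

Lemma lin_dot v : lin (fun u => dot v u).
Proof. by move=> c w; rewrite /dot !sum4; ring. Qed.

Lemma lin_comp f (Z : 'I_4 -> 'I_4 -> R) : lin f ->
  lin (fun u => f (fun b => \sum_a u a * Z a b)).
Proof.
move=> Lf c w; rewrite !Lf.
under [RHS]eq_bigr do rewrite Lf.
by rewrite !sum4; ring.
Qed.

Lemma dot_unit v a : dot v (unit4 a) = v a.
Proof. by rewrite /dot (bigD1 a) //= /unit4 eqxx mulr1 big1 ?addr0 // => b ba; rewrite eq_sym (negbTE ba) mulr0. Qed.

Lemma sum_unit (Z : 'I_4 -> R) a : \sum_b unit4 a b * Z b = Z a.
Proof. by under eq_bigr do rewrite mulrC; exact: (dot_unit Z a). Qed.

Variables (E Ei : 'M[R]_4) (EEi : E *m Ei = 1%:M).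

Lemma unit_basis a : unit4 a = (fun b => \sum_i Ei i a * E b i).
Proof.
apply/funext => b; have /matrixP /(_ b a) := EEi.
by rewrite !mxE /unit4 eq_sym => <-; apply: eq_bigr => i _; rewrite mulrC.
Qed.

Lemma lin_ext f : lin f -> (forall i, f (fun b => E b i) = 0) -> forall a, f (unit4 a) = 0.
Proof.
move=> Lf f0 a; rewrite unit_basis Lf big1 // => i _; by rewrite f0 mulr0.
Qed.

Lemma bilin_ext (f : ('I_4 -> R) -> ('I_4 -> R) -> R) :
  (forall v, lin (fun u => f u v)) -> (forall u, lin (fun v => f u v)) ->
  (forall i j, f (fun b => E b i) (fun b => E b j) = 0) ->
  forall a b, f (unit4 a) (unit4 b) = 0.
Proof.
move=> L1 L2 f0 a b.
apply: (lin_ext (f := fun u => f u (unit4 b))) => // i.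
by apply: (lin_ext (f := fun v => f (fun b => E b i) v)) => // j.
Qed.

Lemma trilin_ext (f : ('I_4 -> R) -> ('I_4 -> R) -> ('I_4 -> R) -> R) :
  (forall v w, lin (fun u => f u v w)) -> (forall u w, lin (fun v => f u v w)) ->
  (forall u v, lin (fun w => f u v w)) ->
  (forall i j k, f (fun b => E b i) (fun b => E b j) (fun b => E b k) = 0) ->
  forall a b c, f (unit4 a) (unit4 b) (unit4 c) = 0.
Proof.
move=> L1 L2 L3 f0 a b c.
apply: (lin_ext (f := fun u => f u (unit4 b) (unit4 c))) => // i.
by apply: (bilin_ext (f := fun v w => f (fun b => E b i) v w)).
Qed.

(* components in the frame of a covector *)
Definition hat (P : 'I_4 -> R) : 'I_4 -> R := fun a => \sum_i P i * Ei i a.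

Lemma dot_hat P i : dot (hat P) (fun b => E b i) = P i.
Proof.
have /matrixP H := mulmx1C EEi.
rewrite /dot /hat; under eq_bigr do rewrite mulr_suml.
rewrite exchange_big /= (bigD1 i) //= [X in _ + X]big1 ?addr0 => [|j ji].
  under eq_bigr do rewrite -mulrA.
  by rewrite -mulr_sumr; have := H i i; rewrite !mxE eqxx => ->; rewrite mulr1.
under eq_bigr do rewrite -mulrA.
by rewrite -mulr_sumr; have := H j i; rewrite !mxE (negbTE ji) => ->; rewrite mulr0.
Qed.

End Linear.

Ltac linear_tac := repeat first
  [ apply: lin_D | apply: lin_N | apply: lin_Bl | apply: lin_Br | apply: lin_dot
  | apply: lin_comp
  | apply: lin_Ml | apply: lin_Mr ].

Section NabRules.
Context {R : realType}.
Variables (U : set 'cV[R]_4) (oU : open U).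
Implicit Types (y : 'cV[R]_4) (f g : tri -> 'cV[R]_4 -> R).
Variables (a : tri -> 'I_4 -> 'cV[R]_4 -> R).

Lemma nab_eq w f g i m y : U y -> (forall l z, U z -> f l z = g l z) ->
  nab a w i f m y = nab a w i g m y.
Proof.
move=> Uy fg; rewrite /nab /crs !(fg _ y Uy).
by rewrite (pd_eq i oU Uy (fg m)).
Qed.

Lemma nab_weight w w' f i m y : w i y = w' i y -> nab a w i f m y = nab a w' i f m y.
Proof. by rewrite /nab => ->. Qed.

Lemma nab_scale w w' s f i m y : U y -> smooth_on U s -> (forall l, smooth_on U (f l)) ->
  nab a (fun i y => w i y + w' i y) i (fun l z => s z * f l z) m y =
  (pd i s y + w i y * s y) * f m y + s y * nab a w' i f m y.
Proof.
move=> Uy ss sf; rewrite /nab (pdM i Uy ss (sf m)) /crs.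
by gen_pd; ring.
Qed.

Lemma nab_crs w w' f g i m y : U y -> (forall l, smooth_on U (f l)) -> (forall l, smooth_on U (g l)) ->
  nab a (fun i y => w i y + w' i y) i (fun l z => crs (fun l => f l z) (fun l => g l z) l) m y =
  crs (fun l => nab a w i f l y) (fun l => g l y) m
  + crs (fun l => f l y) (fun l => nab a w' i g l y) m.
Proof.
move=> Uy sf sg.
have E l : pd i (fun z => crs (fun l => f l z) (fun l => g l z) l) y =
   pd i (f (nx l)) y * g (nx (nx l)) y + f (nx l) y * pd i (g (nx (nx l))) y
   - (pd i (f (nx (nx l))) y * g (nx l) y + f (nx (nx l)) y * pd i (g (nx l)) y).
  by rewrite /crs; pdr oU Uy.
rewrite {1}/nab E /crs /nab /crs.
by case: m => /=; gen_pd; ring.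
Qed.

Lemma nab_add w f g i m y : U y -> (forall l, smooth_on U (f l)) -> (forall l, smooth_on U (g l)) ->
  nab a w i (fun l z => f l z + g l z) m y = nab a w i f m y + nab a w i g m y.
Proof.
move=> Uy sf sg; rewrite /nab (pdD i Uy (sf m) (sg m)) /crs.
by gen_pd; ring.
Qed.

Lemma nab_const w c f i m y : U y -> (forall l, smooth_on U (f l)) ->
  nab a w i (fun l z => c * f l z) m y = c * nab a w i f m y.
Proof.
move=> Uy sf; rewrite /nab (pdZ i Uy c (sf m)) /crs.
by gen_pd; ring.
Qed.

End NabRules.

Section FrameMain.
Context {R : realType}.
Variables (U : set 'cV[R]_4) (oU : open U).
Implicit Types (y : 'cV[R]_4).
Variables (E Ei : 'cV[R]_4 -> 'M[R]_4) (A : 'I_4 -> 'cV[R]_4 -> 'M[R]_4)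
  (th : 'I_4 -> 'cV[R]_4 -> R).
Hypotheses (sE : smooth_mx U E) (sEi : smooth_mx U Ei)
  (sA : forall i, smooth_mx U (A i)) (sth : forall i, smooth_on U (th i)).
Hypothesis EEi : forall y, U y -> E y *m Ei y = 1%:M.
Hypothesis tors : forall y, U y -> forall i j a,
  cov A i (fr E j) a y = cov A j (fr E i) a y.
Hypothesis metr : forall y, U y -> forall i, conf_skew (th i y) (A i y).

Lemma lin_dotl v : lin (fun u : 'I_4 -> R => dot u v).
Proof. by move=> c w; rewrite /dot !sum4; ring. Qed.

Lemma lin_dot_act v M : lin (fun u : 'I_4 -> R => dot v (act M u)).
Proof. by move=> c w; rewrite /dot /act !sum4; ring. Qed.

Lemma sum_B_unit m u w : \sum_a B m (unit4 a) w * u a = B m u w :> R.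
Proof. by rewrite sum4 /B /unit4; case: m => /=; ring. Qed.

Local Notation e j y := (fun a => fr E j a y).
Local Notation b i j := (fun l y => B l (e i y) (e j y)).
Local Notation ga := (ga A).
Local Notation wt c := (fun i y => c * th i y).

Let sfr j a : smooth_on U (fr E j a). Proof. exact: sE. Qed.
Let sga l i : smooth_on U (ga l i). Proof. exact: smooth_p. Qed.
Let sb i j l : smooth_on U (b i j l). Proof. by apply: smooth_B. Qed.
Let swt (c : R) i : smooth_on U (wt c i). Proof. by sm. Qed.

Lemma nab_b0 i j k m y : U y ->
  nab ga (wt 2) k (b i j) m y + nab ga (wt 2) i (b j k) m y + nab ga (wt 2) j (b k i) m y = 0.
Proof. by move=> Uy; rewrite (nab_BB oU sE tors metr) //; ring. Qed.

Section Faraday.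
Variables (S : 'cV[R]_4 -> R) (F : 'cV[R]_4 -> 'M[R]_4).
Hypotheses (sS : smooth_on U S) (sF : smooth_mx U F).
Local Notation phi := (fun l y => p l (F y)).
Hypothesis hOm : forall y, U y -> forall m i j,
  Om ga m i j y = S y * b i j m y
    - 2^-1 * crs (fun l => phi l y) (fun l => b i j l y) m.
Hypothesis hF : forall y, U y -> forall i j,
  pd i (th j) y - pd j (th i) y = dot (e i y) (act (F y) (e j y)).

Let sphi l : smooth_on U (phi l). Proof. exact: smooth_p. Qed.

Let DS k y := pd k S y - 2 * th k y * S y.
Let Dphi l k y := nab ga (wt (-2)) k phi l y.
Let z a y := \sum_i DS i y * Ei y i a.

Let sz a : smooth_on U (z a).
Proof. by rewrite /z /DS; sm. Qed.

Let zE k y : U y -> dot (z^~ y) (e k y) = DS k y.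
Proof. by move=> Uy; exact: (dot_hat (EEi Uy) (DS^~ y) k). Qed.

Let scrs f g l : (forall l, smooth_on U (f l)) -> (forall l, smooth_on U (g l)) ->
  smooth_on U (fun y => crs (fun l => f l y) (fun l => g l y) l).
Proof. by move=> sf sg; rewrite /crs; sm. Qed.

Lemma faraday_bianchi i j k m y : U y ->
  cyc (fun i j k => DS k y * b i j m y
    + crs (fun l => - 2^-1 * Dphi l k y) (fun l => b i j l y) m) i j k = 0.
Proof.
move=> Uy; rewrite -(bianchi oU sga i j k m Uy).
have sOm i' j' l : smooth_on U (fun y => Om ga l i' j' y) by rewrite /Om /crs; sm.
have L i' j' k' : nab ga (fun _ _ => 0) k' (fun l => Om ga l i' j') m y =
   DS k' y * b i' j' m y + S y * nab ga (wt 2) k' (b i' j') m y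
   + - 2^-1 * (crs (fun l => Dphi l k' y) (fun l => b i' j' l y) m
      + crs (fun l => phi l y) (fun l => nab ga (wt 2) k' (b i' j') l y) m).
  rewrite (nab_eq oU _ _ _ _ Uy (g := fun l z => S z * b i' j' l z +
     - 2^-1 * crs (fun l => phi l z) (fun l => b i' j' l z) l)); last first.
    by move=> l x Ux; rewrite hOm // mulNr.
  rewrite (nab_add _ _ _ _ Uy); last 2 first.
  - by move=> l; sm.
  - by move=> l; apply: smoothM => //; [sm|apply: scrs].
  rewrite (nab_const _ _ _ _ _ Uy); last by move=> l; apply: scrs.
  have w0 : (fun=> (fun=> 0) : 'cV[R]_4 -> R) k' y = wt (-2) k' y + wt 2 k' y by rewrite /=; ring.
  congr (_ + _ * _).
    rewrite (nab_weight _ _ _ (w' := fun i y => wt (-2) i y + wt 2 i y)) //.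
    by rewrite (nab_scale _ _ _ _ _ Uy sS (sb i' j')) /DS; ring.
  rewrite (nab_weight _ _ _ (w' := fun i y => wt (-2) i y + wt 2 i y)) //.
  by rewrite (nab_crs oU _ _ _ _ _ Uy sphi (sb i' j')).
rewrite !L /cyc.
have N l := nab_b0 i j k l Uy.
have N' l : nab ga (wt 2) k (b i j) l y =
   - nab ga (wt 2) i (b j k) l y - nab ga (wt 2) j (b k i) l y.
  by rewrite -[RHS]add0r -(N l); ring.
rewrite /crs !N'; clear; ring.
Qed.

Lemma faraday_twistor k m y : U y -> Dphi m k y = B m (e k y) (z^~ y).
Proof.
move=> Uy.
pose N l a := - 2^-1 * hat (Ei y) (fun k => Dphi l k y) a.
have NE l k' : dot (N l) (e k' y) = - 2^-1 * Dphi l k' y.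
  rewrite -(dot_hat (EEi Uy) (fun k => Dphi l k y) k') /dot mulr_sumr.
  by apply: eq_bigr => a _; rewrite /N mulrA.
have T : forall m a, 2 * N m a = - B m (unit4 a) (z^~ y).
  apply: twistor_algebra => {}m.
  move=> a b' c; rewrite /cyc.
  have := @trilin_ext _ _ _ (EEi Uy) (fun u v w : 'I_4 -> R => dot (z^~ y) w * B m u v
     + crs (fun l => dot (N l) w) (fun l => B l u v) m
     + (dot (z^~ y) u * B m v w + crs (fun l => dot (N l) u) (fun l => B l v w) m)
     + (dot (z^~ y) v * B m w u + crs (fun l => dot (N l) v) (fun l => B l w u) m)).
  move=> /(_ _ _ _ _ a b' c); rewrite /crs /Bu !dot_unit; apply.
  1-3: by move=> u v; linear_tac.
  move=> i j k'; have := faraday_bianchi i j k' m Uy.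
  by rewrite /cyc /crs -!zE // -!NE.
have : 2 * dot (N m) (e k y) = - B m (e k y) (z^~ y).
  rewrite -sum_B_unit /dot mulr_sumr -sumrN; apply: eq_bigr => a _.
  by rewrite mulrA T mulNr.
by rewrite NE; lra.
Qed.

Lemma faraday_sd m y : U y -> phi m y = 0.
Proof.
move=> Uy; move: m.
have sz' := sz.
pose Zc i a := cov A i z a y - 4 * th i y * z a y.
pose Z a c := hat (Ei y) (fun i => Zc i c) a.
have Zu i c : \sum_a e i y a * Z a c = Zc i c.
  rewrite -(dot_hat (EEi Uy) (fun i => Zc i c) i) /dot.
  by apply: eq_bigr => a _; rewrite mulrC.
have I i j m : B m (e j y) (Zc i) - B m (e i y) (Zc j) =
   - 2 * crs (fun l => Om ga l i j y) (fun l => phi l y) m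
   - 2 * dot (e i y) (act (F y) (e j y)) * phi m y.
  have := nab_nab oU sga (swt (-2)) i j m sphi Uy.
  have W i' j' : nab ga (wt (-2)) i' (nab ga (wt (-2)) j' phi) m y =
      B m ((cov A i' (fr E j'))^~ y) (z^~ y) + B m (e j' y) (Zc i').
    rewrite (nab_eq oU _ _ _ _ Uy (g := fun l y => B l (e j' y) (z^~ y))); last first.
      by move=> l x Ux; exact: faraday_twistor.
    rewrite (nab_B oU sE metr) // -addrA; congr (_ + _).
    rewrite /Zc; case: m; rewrite /B; ring.
  rewrite !W (pdZ i Uy (-2) (sth j)) (pdZ j Uy (-2) (sth i)).
  have -> : (cov A i (fr E j))^~ y = (cov A j (fr E i))^~ y.
    by apply/funext => a; exact: tors.
  rewrite -hF // => H; rewrite -[LHS]addr0 -[X in _ + X](subrr (B m ((cov A j (fr E i))^~ y) (z^~ y))).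
  transitivity (- 2 * crs (fun l => Om ga l i j y) (phi^~ y) m +
      (- 2 * pd i (th j) y - - 2 * pd j (th i) y) * phi m y); last by gen_pd; ring.
  by rewrite -H; ring.
apply: (@integrability_algebra _ (S y) Z (F y)) => // m a c.
apply/eqP; rewrite -subr_eq0; apply/eqP.
pose f (u v : 'I_4 -> R) :=
  B m v (fun c => \sum_a u a * Z a c) + - B m u (fun c => \sum_a v a * Z a c)
  + (2 * crs (fun l => S y * B l u v + - (2^-1 * crs (fun l => phi l y) (fun m => B m u v) l))
      (fun l => phi l y) m
    + (dot u (act (F y) v) + - dot v (act (F y) u)) * phi m y).
have f0 : f (unit4 a) (unit4 c) = 0.
  apply: (bilin_ext (EEi Uy) (f := f)) => [v|u|i j]; rewrite /f /crs.
  - by linear_tac; [exact: lin_dotl|exact: lin_dot_act].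
  - by linear_tac; [exact: lin_dot_act|exact: lin_dotl].
  have Zf k : (fun c => \sum_a0 E y a0 k * Z a0 c) = Zc k by apply/funext => c'; exact: Zu.
  rewrite !Zf.
  have := I i j m; rewrite /crs !hOm // /crs.
  have hij := hF Uy i j; have hji := hF Uy j i.
  have D : 2 * dot (e i y) (act (F y) (e j y)) =
     dot (e i y) (act (F y) (e j y)) - dot (e j y) (act (F y) (e i y)).
    by rewrite -hij -hji; gen_pd; ring.
  by rewrite D /fr => H; lra.
have Zf k : (fun c => \sum_a0 unit4 k a0 * Z a0 c) = Z k.
  by apply/funext => c'; exact: sum_unit.
have dF a' c' : dot (unit4 a') (act (F y) (unit4 c')) = F y a' c'.
  rewrite [LHS](sum_unit (act (F y) (unit4 c'))) /act.
  by under eq_bigr do rewrite mulrC; exact: sum_unit.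
by move: f0; rewrite /f !Zf !dF /Bu => f0; rewrite -f0; ring.
Qed.

End Faraday.
Section Twistor.
Variables (S sg : 'cV[R]_4 -> R) (x t0 : 'I_4 -> 'cV[R]_4 -> R) (N G : 'cV[R]_4 -> 'M[R]_4).
Hypotheses (sS : smooth_on U S) (ssg : smooth_on U sg) (sx : forall a, smooth_on U (x a))
  (st0 : forall i, smooth_on U (t0 i)) (sN : smooth_mx U N).
Hypothesis hOm : forall y, U y -> forall m i j, Om ga m i j y = S y * b i j m y.
Hypothesis hN : forall y, U y -> forall i a,
  cov A i x a y = act (N y) (e i y) a + t0 i y * x a y.
Hypothesis skN : forall y, U y -> conf_skew (sg y) (N y).
Hypothesis hG : forall y, U y -> forall i j,
  2 * (pd i (th j) y - pd j (th i) y) - (pd i (t0 j) y - pd j (t0 i) y) =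
  dot (e i y) (act (G y) (e j y)).
Hypothesis aG : forall y, U y -> forall a b, G y a b = - G y b a.
Hypothesis pG : forall y, U y -> forall m, p m (G y) = 0.

Local Notation nn := (fun l y => p l (N y)).
Local Notation w := (fun i y => 2 * th i y - t0 i y).
Local Notation w0 := (fun i y => - t0 i y).
Let y1 l j y := B l (e j y) (x^~ y).

Let snn l : smooth_on U (nn l). Proof. exact: smooth_p. Qed.
Let sw i : smooth_on U (w i). Proof. by sm. Qed.
Let sy1 l j : smooth_on U (y1 l j). Proof. by apply: smooth_B. Qed.

Lemma B_skew_endo s M m (u v : 'I_4 -> R) : conf_skew s M ->
  B m v (act M u) - B m u (act M v) = - 2 * s * B m u v + 2 * crs (p^~ M) (fun l => B l u v) m.
Proof.
move=> /conf_skewE[[h0 h1 h2 h3] [h4 h5 h6 [h7 h8 h9]]].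
rewrite /act; case: m; rewrite /crs /= /p !sum4 h0 h1 h2 h3 h4 h5 h6 h7 h8 h9; by field.
Qed.

Let scrs f g l : (forall l, smooth_on U (f l)) -> (forall l, smooth_on U (g l)) ->
  smooth_on U (fun y => crs (fun l => f l y) (fun l => g l y) l).
Proof. by move=> sf sg'; rewrite /crs; sm. Qed.

Lemma dframe_form i j l y : U y ->
  nab ga w i (fun l => y1 l j) l y - nab ga w j (fun l => y1 l i) l y =
  - 2 * (sg y * b i j l y) + 2 * crs (fun l => nn l y) (fun l => b i j l y) l.
Proof.
move=> Uy.
have L i' j' : nab ga w i' (fun l => y1 l j') l y =
    B l ((cov A i' (fr E j'))^~ y) (x^~ y) + B l (e j' y) (act (N y) (e i' y)).
  rewrite /y1 (nab_B oU sE metr) //.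
  have -> : (cov A i' x)^~ y = (fun a => act (N y) (e i' y) a + t0 i' y * x a y).
    by apply/funext => a; exact: hN.
  by rewrite B_linearr; case: l; rewrite /B; ring.
rewrite !L.
have -> : (cov A i (fr E j))^~ y = (cov A j (fr E i))^~ y.
  by apply/funext => a; exact: tors.
by have := B_skew_endo l (e i y) (e j y) (skN Uy); lra.
Qed.

Let Dsg k y := pd k sg y - t0 k y * sg y.
Let Dn l k y := nab ga w0 k nn l y.

Lemma twistor_bianchi i j k m y : U y ->
  cyc (fun i j k => - 2 * Dsg k y * b i j m y
    + crs (fun l => 2 * Dn l k y) (fun l => b i j l y) m) i j k =
  cyc (fun k i j => - 2 * crs (fun l => S y * b k i l y) (fun l => y1 l j y) m
    + dot (e k y) (act (G y) (e i y)) * y1 m j y) k i j.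
Proof.
move=> Uy.
have D i' j' : pd i' (w j') y - pd j' (w i') y = dot (e i' y) (act (G y) (e j' y)).
  by rewrite -hG //=; pdr oU Uy; gen_pd; ring.
have := nab_nab1 oU sga sw i j k m sy1 Uy; rewrite /= !D.
set Y1 := nab _ _ k _ m y; set Y2 := nab _ _ i _ m y; set Y3 := nab _ _ j _ m y.
move=> H; transitivity (Y1 + Y2 + Y3); last first.
  by rewrite H /cyc /crs !hOm //; ring.
have L i' j' k' : nab ga w k' (fun l z => nab ga w i' (fun l => y1 l j') l z
      - nab ga w j' (fun l => y1 l i') l z) m y =
   - 2 * (Dsg k' y * b i' j' m y + sg y * nab ga (wt 2) k' (b i' j') m y)
   + 2 * (crs (fun l => Dn l k' y) (fun l => b i' j' l y) m
      + crs (fun l => nn l y) (fun l => nab ga (wt 2) k' (b i' j') l y) m).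
  rewrite (nab_eq oU _ _ _ _ Uy (g := fun l z => - 2 * (sg z * b i' j' l z) +
     2 * crs (fun l => nn l z) (fun l => b i' j' l z) l)); last first.
    by move=> l z Uz; exact: dframe_form.
  rewrite (nab_add _ _ _ _ Uy); last 2 first.
  - by move=> l; sm.
  - by move=> l; apply: smoothM => //; [sm|apply: scrs].
  rewrite (nab_const ga w (-2) k' m Uy (f := fun l z => sg z * b i' j' l z)); last by move=> l; sm.
  rewrite (nab_const ga w 2 k' m Uy (f := fun l z => crs (fun l => nn l z) (fun l => b i' j' l z) l));
    last by move=> l; apply: scrs.
  have ww : w k' y = w0 k' y + wt 2 k' y by rewrite /=; ring.
  congr (_ * _ + _ * _).
    rewrite (nab_weight _ _ _ (w' := fun i y => w0 i y + wt 2 i y)) //.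
    by rewrite (nab_scale _ _ _ _ _ Uy ssg (sb i' j')) /Dsg; ring.
  rewrite (nab_weight _ _ _ (w' := fun i y => w0 i y + wt 2 i y)) //.
  by rewrite (nab_crs oU _ _ _ _ _ Uy snn (sb i' j')).
rewrite /Y1 /Y2 /Y3 !L /cyc.
have N0 l := nab_b0 i j k l Uy.
have N' l : nab ga (wt 2) k (b i j) l y =
   - nab ga (wt 2) i (b j k) l y - nab ga (wt 2) j (b k i) l y.
  by rewrite -[RHS]add0r -(N0 l); ring.
rewrite /crs !N'; ring.
Qed.

Theorem twistor_equation y : U y -> exists zeta : 'I_4 -> R, forall m i,
  Dn m i y = B m (e i y) zeta.
Proof.
move=> Uy.
pose M l a := 2 * hat (Ei y) (fun k => Dn l k y) a.
have ME l k' : dot (M l) (e k' y) = 2 * Dn l k' y.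
  rewrite -(dot_hat (EEi Uy) (fun k => Dn l k y) k') /dot mulr_sumr.
  by apply: eq_bigr => a _; rewrite /M mulrA.
pose ds a := hat (Ei y) (Dsg^~ y) a.
have dsE k : dot ds (e k y) = Dsg k y by exact: (dot_hat (EEi Uy)).
pose z a := - 2 * ds a - (4 * S y * x a y + \sum_d x d y * G y d a).
have T : forall m a, 2 * M m a = - B m (unit4 a) z.
  apply: twistor_algebra => m a b' c.
  pose f (u v w : 'I_4 -> R) := (- 2 * dot ds w * B m u v
     + crs (fun l => dot (M l) w) (fun l => B l u v) m
     + (- 2 * dot ds u * B m v w + crs (fun l => dot (M l) u) (fun l => B l v w) m)
     + (- 2 * dot ds v * B m w u + crs (fun l => dot (M l) v) (fun l => B l w u) m))
    - (- 2 * crs (fun l => S y * B l w u) (fun l => B l v (x^~ y)) m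
        + dot w (act (G y) u) * B m v (x^~ y)
      + (- 2 * crs (fun l => S y * B l u v) (fun l => B l w (x^~ y)) m
        + dot u (act (G y) v) * B m w (x^~ y))
      + (- 2 * crs (fun l => S y * B l v w) (fun l => B l u (x^~ y)) m
        + dot v (act (G y) w) * B m u (x^~ y))).
  have f0 : f (unit4 a) (unit4 b') (unit4 c) = 0.
    apply: (trilin_ext (EEi Uy) (f := f)) => [v w|u w|u v|i j k]; rewrite /f /crs.
    1-3: by linear_tac; first [exact: lin_dotl | exact: lin_dot_act].
    have := twistor_bianchi i j k m Uy.
    by rewrite /cyc /crs /y1 !ME !dsE => H; lra.
  have dG a' c' : dot (unit4 a') (act (G y) (unit4 c')) = G y a' c'.
    rewrite [LHS](sum_unit (act (G y) (unit4 c'))) /act.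
    by under eq_bigr do rewrite mulrC; exact: sum_unit.
  have := source_algebra (S y) (x^~ y) m a b' c (aG Uy).
  have pG' l : pair l (fun a b => G y a b) = 0.
    rewrite -(pG Uy l) /pair; congr p; apply/matrixP => r s; by rewrite mxE.
  move=> /(_ pG').
  move: f0; rewrite /f /cyc /crs !dot_unit !dG /Bu /z => f0 f1; lra.
exists (fun a => - 4^-1 * z a) => m i.
have : 2 * dot (M m) (e i y) = - B m (e i y) z.
  rewrite -sum_B_unit /dot mulr_sumr -sumrN; apply: eq_bigr => a _.
  by rewrite mulrA T mulNr.
rewrite ME => H.
have -> : B m (e i y) (fun a => - 4^-1 * z a) = - 4^-1 * B m (e i y) z.
  by rewrite /B; case: m {H}; ring.
by lra.
Qed.

End Twistor.
End FrameMain.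

Section Star.
Context {R : realType}.
Implicit Types (T g al be : 'M[R]_4).

Lemma prod4 (F : 'I_4 -> R) : \prod_i F i = F o0 * F o1 * F o2 * F o3.
Proof.
rewrite !big_ord_recl big_ord0 mulr1 !mulrA.
by congr (F _ * F _ * F _ * F _); apply/val_inj.
Qed.

Lemma sum_delta (F : 'I_4 -> R) a : \sum_i F i * (i == a)%:R = F a.
Proof. by rewrite (bigD1 a) //= eqxx mulr1 big1 ?addr0 // => b /negbTE ->; rewrite mulr0. Qed.

Lemma det_levi_civita (u v w x : 'I_4 -> R) :
  \sum_i \sum_j \sum_k \sum_l u i * v j * w k * x l * levi_civita i j k l =
  \det (\matrix_(r < 4, s < 4) tnth [tuple u; v; w; x] r s).
Proof.
rewrite /determinant.
transitivity (\sum_(s : {perm 'I_4}) \sum_i \sum_j \sum_k \sum_l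
  ((-1) ^+ s * ((u i * (i == s o0)%:R) * (v j * (j == s o1)%:R) *
   (w k * (k == s o2)%:R) * (x l * (l == s o3)%:R)))).
  rewrite [RHS]exchange_big; apply: eq_bigr => i _.
  rewrite [RHS]exchange_big; apply: eq_bigr => j _.
  rewrite [RHS]exchange_big; apply: eq_bigr => k _.
  rewrite [RHS]exchange_big; apply: eq_bigr => l _.
  rewrite /levi_civita /determinant mulr_sumr; apply: eq_bigr => s _.
  rewrite prod4 !mxE !(tnth_nth i) /=.
  have comm4 (a b c d e e1 e2 e3 e4 : R) : a * b * c * d * (e * (e1 * e2 * e3 * e4)) =
    e * (a * e1 * (b * e2) * (c * e3) * (d * e4)) by ring.
  exact: comm4.
apply: eq_bigr => s _; rewrite prod4 !mxE !(tnth_nth u) /=.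
under eq_bigr => i _ do under eq_bigr => j _ do under eq_bigr => k _ do
  rewrite -!mulr_sumr sum_delta.
under eq_bigr => i _ do under eq_bigr => j _ do rewrite -!mulr_sumr -mulr_suml -mulr_sumr sum_delta.
under eq_bigr => i _ do rewrite -!mulr_sumr -!mulr_suml -mulr_sumr sum_delta.
by rewrite -!mulr_sumr -!mulr_suml sum_delta.
Qed.

Definition eps4 (be : 'M[R]_4) : 'M[R]_4 :=
  \matrix_(i, j) (2^-1 * \sum_k \sum_l be k l * levi_civita l k i j).

Lemma sum_pull4 (F : 'I_4 -> 'I_4 -> 'I_4 -> 'I_4 -> 'I_4 -> R) :
  \sum_a \sum_b \sum_c \sum_d \sum_e F a b c d e =
  \sum_e \sum_a \sum_b \sum_c \sum_d F a b c d e.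
Proof.
rewrite [RHS]exchange_big; apply: eq_bigr => a _.
rewrite [RHS]exchange_big; apply: eq_bigr => b _.
rewrite [RHS]exchange_big; apply: eq_bigr => c _.
by rewrite [RHS]exchange_big.
Qed.

Lemma sum_rev4 (F : 'I_4 -> 'I_4 -> 'I_4 -> 'I_4 -> R) :
  \sum_j \sum_i \sum_k \sum_l F l k i j = \sum_l \sum_k \sum_i \sum_j F l k i j.
Proof.
transitivity (\sum_l \sum_j \sum_i \sum_k F l k i j).
  rewrite [RHS]exchange_big; apply: eq_bigr => j _.
  rewrite [RHS]exchange_big; apply: eq_bigr => i _.
  by rewrite [RHS]exchange_big.
apply: eq_bigr => l _; transitivity (\sum_k \sum_j \sum_i F l k i j).
  rewrite [RHS]exchange_big; apply: eq_bigr => j _.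
  by rewrite [RHS]exchange_big.
by apply: eq_bigr => k _; rewrite exchange_big.
Qed.

Lemma eps4_congr T be : T^T *m eps4 (T *m be *m T^T) *m T = \det T *: eps4 be.
Proof.
apply/matrixP => r s.
transitivity (\sum_j \sum_i \sum_k \sum_l \sum_p \sum_q
     2^-1 * (be p q * (T l q * T k p * T i r * T j s * levi_civita l k i j))).
  rewrite !mxE.
  apply: eq_bigr => j _; rewrite !mxE mulr_suml; apply: eq_bigr => i _.
  rewrite !mxE !mulr_sumr mulr_suml; apply: eq_bigr => k _.
  rewrite !mulr_sumr mulr_suml; apply: eq_bigr => l _.
  rewrite !mxE !(mulr_suml, mulr_sumr).
  under eq_bigr => q _ do rewrite !mxE !(mulr_suml, mulr_sumr).
  rewrite exchange_big; apply: eq_bigr => p _; apply: eq_bigr => q _.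
  by rewrite ?mxE; move: (levi_civita l k i j) => e; ring.
rewrite sum_pull4 !mxE !mulr_sumr; apply: eq_bigr => p _.
rewrite sum_pull4 !mulr_sumr; apply: eq_bigr => q _.
rewrite sum_rev4.
transitivity (2^-1 * (be p q * \det (\matrix_(a < 4, b < 4)
   tnth [tuple (fun l => T l q); (fun l => T l p); (fun l => T l r); (fun l => T l s)] a b))).
  rewrite -det_levi_civita !mulr_sumr; apply: eq_bigr => l _.
  rewrite !mulr_sumr; apply: eq_bigr => k _.
  rewrite !mulr_sumr; apply: eq_bigr => i _.
  rewrite !mulr_sumr; apply: eq_bigr => j _.
  by [].
rewrite [_ * (2^-1 * _)]mulrCA; congr (_ * _); rewrite mulrCA; congr (_ * _).
rewrite /levi_civita -(det_tr T) mulrC -det_mulmx; congr (\det _).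
apply/matrixP => a b; rewrite !mxE.
under [RHS]eq_bigr do rewrite !mxE mulrC eq_sym.
rewrite sum_delta; move: a; apply: all4; by rewrite !(tnth_nth (fun=> 0)) !(tnth_nth o0).
Qed.

Lemma star2E g al : star2 g al = eps4 (invmx g *m al *m (invmx g)^T).
Proof. by []. Qed.

Lemma levi_tperm (i j k l i' j' k' l' r s : 'I_4) : r != s ->
  (forall t, tnth [tuple i'; j'; k'; l'] t = tnth [tuple i; j; k; l] (tperm r s t)) ->
  levi_civita i' j' k' l' = - levi_civita i j k l :> R.
Proof.
move=> rs e; rewrite /levi_civita -mulN1r.
have <- : \det (tperm_mx r s : 'M[R]_4) = -1 by rewrite det_perm odd_tperm rs.
rewrite -det_mulmx -xrowE; congr (\det _); apply/matrixP => a b.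
by rewrite !mxE e.
Qed.

Lemma levi_swap1 i j k l : levi_civita j i k l = - levi_civita i j k l :> R.
Proof.
apply: (levi_tperm (r := o0) (s := o1)) => //; apply: all4;
by rewrite ?tpermL ?tpermR ?tpermD // !(tnth_nth o0).
Qed.

Lemma levi_swap2 i j k l : levi_civita i k j l = - levi_civita i j k l :> R.
Proof.
apply: (levi_tperm (r := o1) (s := o2)) => //; apply: all4;
by rewrite ?tpermL ?tpermR ?tpermD // !(tnth_nth o0).
Qed.

Lemma levi_swap3 i j k l : levi_civita i j l k = - levi_civita i j k l :> R.
Proof.
apply: (levi_tperm (r := o2) (s := o3)) => //; apply: all4;
by rewrite ?tpermL ?tpermR ?tpermD // !(tnth_nth o0).
Qed.

Lemma levi_repeat (i j k : 'I_4) :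
  ((levi_civita i i j k = 0 :> R) * (levi_civita i j i k = 0 :> R) *
   (levi_civita i j k i = 0 :> R) * (levi_civita j i i k = 0 :> R) *
   (levi_civita j i k i = 0 :> R) * (levi_civita j k i i = 0 :> R))%type.
Proof.
have A (a b c d r s : 'I_4) : r != s -> tnth [tuple a; b; c; d] r = tnth [tuple a; b; c; d] s ->
    levi_civita a b c d = 0 :> R.
  move=> rs e; apply: (determinant_alternate rs) => t; by rewrite !mxE e.
by do !split;
  [apply: (A _ _ _ _ o0 o1)|apply: (A _ _ _ _ o0 o2)|apply: (A _ _ _ _ o0 o3)
  |apply: (A _ _ _ _ o1 o2)|apply: (A _ _ _ _ o1 o3)|apply: (A _ _ _ _ o2 o3)].
Qed.

Definition Kmat (f : tri -> R) : 'M[R]_4 :=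
  \matrix_(a, b) (f T1 * Bu T1 a b + f T2 * Bu T2 a b + f T3 * Bu T3 a b).

Lemma eps4E be :
  [/\ eps4 be o0 o1 = 2^-1 * (be o3 o2 - be o2 o3), eps4 be o2 o3 = 2^-1 * (be o1 o0 - be o0 o1)
    & eps4 be o0 o2 = 2^-1 * (be o1 o3 - be o3 o1)] /\
  [/\ eps4 be o1 o3 = 2^-1 * (be o0 o2 - be o2 o0), eps4 be o0 o3 = 2^-1 * (be o2 o1 - be o1 o2)
    & eps4 be o1 o2 = 2^-1 * (be o3 o0 - be o0 o3)].
Proof.
have l0123 : levi_civita o0 o1 o2 o3 = 1 :> R.
  transitivity (\det (1%:M : 'M[R]_4)); last exact: det1.
  rewrite /levi_civita; congr (\det _); apply/matrixP.
  by apply: all4; apply: all4; rewrite !mxE !(tnth_nth o0).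
have l0132 : levi_civita o0 o1 o3 o2 = -1 :> R.
  by rewrite (levi_swap3 _ _ o2 o3) l0123 ?opprK.
have l0213 : levi_civita o0 o2 o1 o3 = -1 :> R.
  by rewrite (levi_swap2 _ o1 o2) l0123 ?opprK.
have l0231 : levi_civita o0 o2 o3 o1 = 1 :> R.
  by rewrite (levi_swap3 _ _ o1 o3) (levi_swap2 _ o1 o2) l0123 ?opprK.
have l0312 : levi_civita o0 o3 o1 o2 = 1 :> R.
  by rewrite (levi_swap2 _ o1 o3) (levi_swap3 _ _ o2 o3) l0123 ?opprK.
have l0321 : levi_civita o0 o3 o2 o1 = -1 :> R.
  by rewrite (levi_swap2 _ o2 o3) (levi_swap3 _ _ o1 o3) (levi_swap2 _ o1 o2) l0123 ?opprK.
have l1023 : levi_civita o1 o0 o2 o3 = -1 :> R.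
  by rewrite (levi_swap1 o0 o1) l0123 ?opprK.
have l1032 : levi_civita o1 o0 o3 o2 = 1 :> R.
  by rewrite (levi_swap1 o0 o1) (levi_swap3 _ _ o2 o3) l0123 ?opprK.
have l1203 : levi_civita o1 o2 o0 o3 = 1 :> R.
  by rewrite (levi_swap2 _ o0 o2) (levi_swap1 o0 o1) l0123 ?opprK.
have l1230 : levi_civita o1 o2 o3 o0 = -1 :> R.
  by rewrite (levi_swap3 _ _ o0 o3) (levi_swap2 _ o0 o2) (levi_swap1 o0 o1) l0123 ?opprK.
have l1302 : levi_civita o1 o3 o0 o2 = -1 :> R.
  by rewrite (levi_swap2 _ o0 o3) (levi_swap1 o0 o1) (levi_swap3 _ _ o2 o3) l0123 ?opprK.
have l1320 : levi_civita o1 o3 o2 o0 = 1 :> R.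
  by rewrite (levi_swap2 _ o2 o3) (levi_swap3 _ _ o0 o3) (levi_swap2 _ o0 o2) (levi_swap1 o0 o1) l0123 ?opprK.
have l2013 : levi_civita o2 o0 o1 o3 = 1 :> R.
  by rewrite (levi_swap1 o0 o2) (levi_swap2 _ o1 o2) l0123 ?opprK.
have l2031 : levi_civita o2 o0 o3 o1 = -1 :> R.
  by rewrite (levi_swap1 o0 o2) (levi_swap3 _ _ o1 o3) (levi_swap2 _ o1 o2) l0123 ?opprK.
have l2103 : levi_civita o2 o1 o0 o3 = -1 :> R.
  by rewrite (levi_swap1 o1 o2) (levi_swap2 _ o0 o2) (levi_swap1 o0 o1) l0123 ?opprK.
have l2130 : levi_civita o2 o1 o3 o0 = 1 :> R.
  by rewrite (levi_swap1 o1 o2) (levi_swap3 _ _ o0 o3) (levi_swap2 _ o0 o2) (levi_swap1 o0 o1) l0123 ?opprK.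
have l2301 : levi_civita o2 o3 o0 o1 = 1 :> R.
  by rewrite (levi_swap2 _ o0 o3) (levi_swap1 o0 o2) (levi_swap3 _ _ o1 o3) (levi_swap2 _ o1 o2) l0123 ?opprK.
have l2310 : levi_civita o2 o3 o1 o0 = -1 :> R.
  by rewrite (levi_swap2 _ o1 o3) (levi_swap1 o1 o2) (levi_swap3 _ _ o0 o3) (levi_swap2 _ o0 o2) (levi_swap1 o0 o1) l0123 ?opprK.
have l3012 : levi_civita o3 o0 o1 o2 = -1 :> R.
  by rewrite (levi_swap1 o0 o3) (levi_swap2 _ o1 o3) (levi_swap3 _ _ o2 o3) l0123 ?opprK.
have l3021 : levi_civita o3 o0 o2 o1 = 1 :> R.
  by rewrite (levi_swap1 o0 o3) (levi_swap2 _ o2 o3) (levi_swap3 _ _ o1 o3) (levi_swap2 _ o1 o2) l0123 ?opprK.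
have l3102 : levi_civita o3 o1 o0 o2 = 1 :> R.
  by rewrite (levi_swap1 o1 o3) (levi_swap2 _ o0 o3) (levi_swap1 o0 o1) (levi_swap3 _ _ o2 o3) l0123 ?opprK.
have l3120 : levi_civita o3 o1 o2 o0 = -1 :> R.
  by rewrite (levi_swap1 o1 o3) (levi_swap2 _ o2 o3) (levi_swap3 _ _ o0 o3) (levi_swap2 _ o0 o2) (levi_swap1 o0 o1) l0123 ?opprK.
have l3201 : levi_civita o3 o2 o0 o1 = -1 :> R.
  by rewrite (levi_swap1 o2 o3) (levi_swap2 _ o0 o3) (levi_swap1 o0 o2) (levi_swap3 _ _ o1 o3) (levi_swap2 _ o1 o2) l0123 ?opprK.
have l3210 : levi_civita o3 o2 o1 o0 = 1 :> R.
  by rewrite (levi_swap1 o2 o3) (levi_swap2 _ o1 o3) (levi_swap1 o1 o2) (levi_swap3 _ _ o0 o3) (levi_swap2 _ o0 o2) (levi_swap1 o0 o1) l0123 ?opprK.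
split; split; rewrite !mxE !sum4 !levi_repeat.
all: rewrite ?(l0123, l0132, l0213, l0231, l0312, l0321, l1023, l1032, l1203, l1230, l1302, l1320, l2013, l2031, l2103, l2130, l2301, l2310, l3012, l3021, l3102, l3120, l3201, l3210).
all: by ring.
Qed.

Lemma eps4_antisym be a b : eps4 be a b = - eps4 be b a.
Proof.
rewrite !mxE -mulrN -sumrN; congr (_ * _); apply: eq_bigr => k _.
by rewrite -sumrN; apply: eq_bigr => l _; rewrite levi_swap3 mulrN.
Qed.

Lemma p_eps4 m be : p m (eps4 be) = - p m be.
Proof.
have [[e1 e2 e3] [e4 e5 e6]] := eps4E be.
rewrite /p; case: m; rewrite ?(eps4_antisym be o1 o0) ?(eps4_antisym be o2 o0)
  ?(eps4_antisym be o3 o0) ?(eps4_antisym be o2 o1) ?(eps4_antisym be o3 o1)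
  ?(eps4_antisym be o3 o2) ?(e1, e2, e3, e4, e5, e6); by field.
Qed.

Lemma asd_eps4 be : be^T = - be -> 2^-1 *: (be - eps4 be) = Kmat (p^~ be).
Proof.
move=> bT; have ba a b : be a b = - be b a by have /matrixP/(_ b a) := bT; rewrite !mxE.
have := eps4_antisym be; have := eps4E be; move: (eps4 be) => ep.
move=> [[e1 e2 e3] [e4 e5 e6]] ea; apply/matrixP; apply: antisym_ext => [a b|a b||||||].
- by rewrite !mxE (ba a b) (ea a b); ring.
- by rewrite !mxE /Bu !(B_antisym _ (unit4 a)); ring.
all: rewrite !mxE ?(e1, e2, e3, e4, e5, e6) /p /Bu /B /unit4 /=.
all: rewrite ?(ba o1 o0) ?(ba o2 o0) ?(ba o3 o0) ?(ba o2 o1) ?(ba o3 o1) ?(ba o3 o2).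
all: by field.
Qed.

End Star.

(** * Moving frames *)

Section MatrixDerivative.
Context {R : realType} {n : nat}.
Variables (U : set 'cV[R]_n) (oU : open U).
Implicit Types (y : 'cV[R]_n).

Definition dmx p q (i : 'I_n) (M : 'cV[R]_n -> 'M[R]_(p, q)) y : 'M[R]_(p, q) :=
  \matrix_(a, b) pd i (fun z => M z a b) y.

Lemma dmx_eq p q i (M N : 'cV[R]_n -> 'M[R]_(p, q)) y : U y ->
  (forall z, U z -> M z = N z) -> dmx i M y = dmx i N y.
Proof.
move=> Uy MN; apply/matrixP => a b; rewrite !mxE.
by apply: (pd_eq i oU Uy) => z Uz; rewrite MN.
Qed.

Lemma smooth_dmx p q i (M : 'cV[R]_n -> 'M[R]_(p, q)) : smooth_mx U M ->
  smooth_mx U (dmx i M).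
Proof.
move=> sM a b; apply: (smooth_eq oU (f := pd i (fun z => M z a b))) => [y _|].
  by rewrite mxE.
exact/smooth_pd/sM.
Qed.

Lemma smooth_mxD p q (M N : 'cV[R]_n -> 'M[R]_(p, q)) : smooth_mx U M -> smooth_mx U N ->
  smooth_mx U (fun y => M y + N y).
Proof.
move=> sM sN a b; apply: (smooth_eq oU (f := fun y => M y a b + N y a b)) => [y _|].
  by rewrite mxE.
exact: smoothD.
Qed.

Lemma smooth_mxN p q (M : 'cV[R]_n -> 'M[R]_(p, q)) : smooth_mx U M ->
  smooth_mx U (fun y => - M y).
Proof.
move=> sM a b; apply: (smooth_eq oU (f := fun y => - M y a b)) => [y _|].
  by rewrite mxE.
exact: smoothN.
Qed.

Lemma smooth_mxT p q (M : 'cV[R]_n -> 'M[R]_(p, q)) : smooth_mx U M ->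
  smooth_mx U (fun y => (M y)^T).
Proof.
by move=> sM a b; apply: (smooth_eq oU (f := fun y => M y b a)) => [y _|] //; rewrite mxE.
Qed.

Lemma dmxM p q r i (M : 'cV[R]_n -> 'M[R]_(p, q)) (N : 'cV[R]_n -> 'M[R]_(q, r)) y :
  U y -> smooth_mx U M -> smooth_mx U N ->
  dmx i (fun z => M z *m N z) y = dmx i M y *m N y + M y *m dmx i N y.
Proof.
move=> Uy sM sN; apply/matrixP => a b; rewrite !mxE -big_split /=.
rewrite (pd_eq i oU Uy (g := fun z => \sum_k M z a k * N z k b)); last first.
  by move=> z _; rewrite mxE.
rewrite (pd_sum oU i Uy); last by move=> k; apply: smoothM.
by apply: eq_bigr => k _; rewrite (pdM i Uy) // !mxE.
Qed.

Lemma dmxB p q i (M N : 'cV[R]_n -> 'M[R]_(p, q)) y :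
  U y -> smooth_mx U M -> smooth_mx U N ->
  dmx i (fun z => M z - N z) y = dmx i M y - dmx i N y.
Proof.
move=> Uy sM sN; apply/matrixP => a b; rewrite !mxE.
rewrite (pd_eq i oU Uy (g := fun z => M z a b - N z a b)); last first.
  by move=> z _; rewrite !mxE.
by rewrite (pdB oU i Uy).
Qed.

Lemma dmxT p q i (M : 'cV[R]_n -> 'M[R]_(p, q)) y :
  U y -> dmx i (fun z => (M z)^T) y = (dmx i M y)^T.
Proof.
move=> Uy; apply/matrixP => a b; rewrite !mxE.
by apply: (pd_eq i oU Uy) => z _; rewrite mxE.
Qed.

Lemma dmxC p q i j (M : 'cV[R]_n -> 'M[R]_(p, q)) y : U y -> smooth_mx U M ->
  dmx i (dmx j M) y = dmx j (dmx i M) y.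
Proof.
move=> Uy sM; apply/matrixP => a b.
rewrite [LHS]mxE.
rewrite [RHS]mxE.
have L k l : pd k (fun z => dmx l M z a b) y = pd k (pd l (fun z => M z a b)) y.
  by apply: (pd_eq k oU Uy) => z _; rewrite mxE.
exact: (etrans (L i j) (etrans (pd_pdC oU i Uy j (sM a b)) (esym (L j i)))).
Qed.

End MatrixDerivative.

Section Connection.
Context {R : realType} {n : nat}.
Variables (U : set 'cV[R]_n) (oU : open U).
Variables (g : 'cV[R]_n -> 'M[R]_n) (th : 'cV[R]_n -> 'rV[R]_n).
Hypotheses (sg : smooth_mx U g) (sth : smooth_mx U th)
  (gT : forall y, U y -> (g y)^T = g y) (gU : forall y, U y -> \det (g y) != 0).
Implicit Types (y : 'cV[R]_n).

(* the matrix of D along the i-th coordinate vector field *)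
Definition Gm (g : 'cV[R]_n -> 'M[R]_n) (th : 'cV[R]_n -> 'rV[R]_n) i y : 'M[R]_n :=
  \matrix_(k, j) Gamma g th y k i j.

Lemma gC y i j : U y -> g y i j = g y j i.
Proof. by move=> Uy; rewrite -{1}(gT Uy) mxE. Qed.

Lemma Gamma_symmetric y k i j : U y -> Gamma g th y k i j = Gamma g th y k j i.
Proof.
move=> Uy; rewrite /Gamma (gC i j Uy).
under eq_bigr => l _ do rewrite (pd_eq l oU Uy (fun z Uz => gC i j Uz))
  [X in X - _]addrC.
by rewrite -!addrA; congr (_ + _); rewrite [RHS]addrCA.
Qed.

Lemma Gm_metric y i : U y ->
  dmx i g y + (2 * th y 0 i) *: g y = (Gm g th i y)^T *m g y + g y *m Gm g th i y.
Proof.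
move=> Uy.
have [g' [g'T g'E]] : exists g' : 'cV[R]_n -> 'M[R]_n,
    (forall z, (g' z)^T = g' z) /\ (forall z, U z -> g' z = g z).
  exists (fun z => 2^-1 *: (g z + (g z)^T)); split=> z.
    by rewrite linearZ linearD /= trmxK addrC.
  move=> Uz; rewrite gT // -[X in X + X]scale1r -scalerDl scalerA.
  by rewrite (_ : 2^-1 * (1 + 1) = 1) ?scale1r //; field.
have gd k a b : pd k (fun z => g' z a b) y = pd k (fun z => g z a b) y.
  by apply: (pd_eq k oU Uy) => z Uz; rewrite g'E.
have g'U : g' y \in unitmx by rewrite unitmxE unitfE g'E ?gU.
have GE k a b : Gamma g' th y k a b = Gamma g th y k a b.
  rewrite /Gamma (g'E _ Uy).
  have cg (x p1 p2 p3 q1 q2 q3 : R) : p1 = q1 -> p2 = q2 -> p3 = q3 ->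
    x * (p1 + p2 - p3) = x * (q1 + q2 - q3) by move=> -> -> ->.
  have cg' (s1 s2 x1 x2 x3 : R) : s1 = s2 ->
    2^-1 * s1 + x1 + x2 - x3 = 2^-1 * s2 + x1 + x2 - x3 by move=> ->.
  by apply: cg'; apply: eq_bigr => l _; apply: cg; exact: gd.
have [_ H] := Gamma_unique th (Gamma g' th y) g'T g'U.
have [_ {}H] := H (fun _ _ _ => erefl).
apply/matrixP => j k; rewrite !mxE; have := H i j k.
rewrite gd g'E // -addrA -opprD => /eqP; rewrite subr_eq0 => /eqP ->.
by congr (_ + _); apply: eq_bigr => l _; rewrite !mxE GE // mulrC.
Qed.

Lemma smooth_Gamma k i j : smooth_on U (fun y => Gamma g th y k i j).
Proof.
have sI : smooth_mx U (fun y => invmx (g y)) by apply: smooth_invmx.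
rewrite /Gamma; repeat first
  [ exact: sg | exact: sth | exact: sI | apply: smooth_pd | apply: smooth_cst
  | apply: smoothN | apply: smoothD | apply: smoothM
  | apply: smooth_sum; [assumption|move=> ? ?] | assumption].
Qed.

Lemma smooth_Gm i : smooth_mx U (Gm g th i).
Proof.
move=> a b; apply: (smooth_eq oU (f := fun y => Gamma g th y a i b)) => [y _|].
  by rewrite mxE.
exact: smooth_Gamma.
Qed.

Definition Cm (g : 'cV[R]_n -> 'M[R]_n) (th : 'cV[R]_n -> 'rV[R]_n) i j y : 'M[R]_n :=
  \matrix_(k, l) curvature g th y i j k l.

Lemma CmE i j y : Cm g th i j y =
  dmx i (Gm g th j) y - dmx j (Gm g th i) y
  + (Gm g th i y *m Gm g th j y - Gm g th j y *m Gm g th i y).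
Proof.
apply/matrixP => k l; rewrite !mxE /curvature; congr (_ - _ + _).
- by congr (pd i _ y); apply/funext => z; rewrite mxE.
- by congr (pd j _ y); apply/funext => z; rewrite mxE.
by rewrite sumrB; congr (_ - _); apply: eq_bigr => m _; rewrite !mxE.
Qed.

Lemma curvature_antisym i j k l y :
  curvature g th y i j k l = - curvature g th y j i k l.
Proof.
rewrite /curvature opprD opprB -sumrN; congr (_ + _).
by apply: eq_bigr => m _; rewrite opprB.
Qed.

Lemma curvature_bianchi i j k l y : U y ->
  curvature g th y i j k l + curvature g th y j l k i + curvature g th y l i k j = 0.
Proof.
move=> Uy; rewrite /curvature !sumrB.
have D a k' b c : pd a (fun z => Gamma g th z k' b c) y = pd a (fun z => Gamma g th z k' c b) y.
  by apply: (pd_eq a oU Uy) => z Uz; exact: Gamma_symmetric.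
have S a b c : \sum_m Gamma g th y k a m * Gamma g th y m b c =
    \sum_m Gamma g th y k a m * Gamma g th y m c b.
  by apply: eq_bigr => m _; rewrite (Gamma_symmetric m b c Uy).
rewrite (D i k l j) (D j k i l) (D l k j i) (S i l j) (S j i l) (S l j i).
by gen_pd; ring.
Qed.

End Connection.

(* decides identities between sums of matrix products, the products being
   treated as unknown matrices *)
Ltac mx_abel :=
  rewrite ?(mulmxDl, mulmxDr, mulmxBl, mulmxBr, mulNmx, mulmxN, mulmxA);
  repeat match goal with |- context [@mulmx ?R ?m ?n ?p ?A ?B] =>
    let x := fresh "x" in move: (@mulmx _ m n p A B) => x end;
  apply/matrixP => ? ?; rewrite ?mxE; ring.

Lemma sym_congr (R : comNzRingType) n (X a : 'M[R]_n) :
  X^T *m (a + a^T) *m X = X^T *m (a *m X) + (a *m X)^T *m X.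
Proof. by rewrite mulmxDr mulmxDl trmx_mul !mulmxA. Qed.

Lemma gauge_square (R : comNzRingType) n (F F' X G G' D D' : 'M[R]_n) :
  F *m X = X *m G - D -> F' *m X = X *m G' - D' ->
  F *m F' *m X = X *m G *m G' - D *m G' - F *m D'.
Proof.
by move=> h h'; rewrite -mulmxA h' mulmxBr mulmxA h mulmxBl.
Qed.

Lemma gauge_curvature (R : realType) n (F F' X G G' D D' a b r s dd dd' : 'M[R]_n) :
  F *m X = X *m G - D -> F' *m X = X *m G' - D' ->
  a *m X = D *m G' + X *m r - dd - F' *m D ->
  b *m X = D' *m G + X *m s - dd' - F *m D' -> dd = dd' ->
  (a - b + (F *m F' - F' *m F)) *m X = X *m (r - s + (G *m G' - G' *m G)).
Proof.
move=> h h' ha hb e; rewrite mulmxDl !mulmxBl ha hb -e.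
by rewrite (gauge_square h h') (gauge_square h' h); mx_abel.
Qed.

Section FrameChart.
Context {R : realType}.
Variables (U : set 'cV[R]_4) (oU : open U).
Variables (g E : 'cV[R]_4 -> 'M[R]_4).
Hypotheses (sE : smooth_mx U E)
  (EtE : forall y, U y -> (E y)^T *m E y = g y) (dE : forall y, U y -> \det (E y) = 1).
Implicit Types (y : 'cV[R]_4).

Definition Ei (E : 'cV[R]_4 -> 'M[R]_4) y := invmx (E y).

Lemma frame_gT y : U y -> (g y)^T = g y.
Proof. by move=> Uy; rewrite -EtE // trmx_mul trmxK. Qed.

Lemma frame_sg : smooth_mx U g.
Proof.
move=> a b; apply: (smooth_eq oU (f := fun y => ((E y)^T *m E y) a b)) => [y Uy|].
  by rewrite EtE.
by apply: (smooth_mulmx oU (A := fun y => (E y)^T)) => //; exact: smooth_mxT.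
Qed.

Lemma frame_detg y : U y -> \det (g y) = 1.
Proof. by move=> Uy; rewrite -EtE // det_mulmx det_tr dE // mulr1. Qed.

Lemma frame_gU y : U y -> \det (g y) != 0.
Proof. by move=> Uy; rewrite frame_detg // oner_neq0. Qed.

Lemma frame_unit y : U y -> E y \in unitmx.
Proof. by move=> Uy; rewrite unitmxE dE // unitr1. Qed.

Lemma EEi y : U y -> E y *m Ei E y = 1%:M.
Proof. by move=> Uy; rewrite mulmxV ?frame_unit. Qed.

Lemma EiE y : U y -> Ei E y *m E y = 1%:M.
Proof. by move=> Uy; rewrite mulVmx ?frame_unit. Qed.

Lemma frame_invg y : U y -> invmx (g y) = Ei E y *m (Ei E y)^T.
Proof.
move=> Uy; have gu : g y \in unitmx by rewrite unitmxE unitfE frame_gU.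
apply: (can_inj (mulmxK gu)); rewrite mulVmx // -EtE // -mulmxA (mulmxA (Ei E y)^T).
by rewrite -trmx_mul EEi // trmx1 mul1mx EiE.
Qed.

Lemma smooth_Ei : smooth_mx U (Ei E).
Proof. by apply: smooth_invmx => // y Uy; rewrite dE // oner_neq0. Qed.

Section Conn.
Variables (th : 'cV[R]_4 -> 'rV[R]_4).
Hypothesis (sth : smooth_mx U th).

Definition Fc (g : 'cV[R]_4 -> 'M[R]_4) (E : 'cV[R]_4 -> 'M[R]_4) (th : 'cV[R]_4 -> 'rV[R]_4) i y
  : 'M[R]_4 := (E y *m Gm g th i y - dmx i E y) *m Ei E y.

Definition thf (th : 'cV[R]_4 -> 'rV[R]_4) (i : 'I_4) y := th y 0 i.

Local Notation G := (Gm g th).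
Local Notation A := (Fc g E th).

Let sG i : smooth_mx U (G i).
Proof. by apply: smooth_Gm => //; [exact: frame_sg|exact: frame_gU]. Qed.

Lemma Fc_E i y : U y -> A i y *m E y = E y *m G i y - dmx i E y.
Proof. by move=> Uy; rewrite /Fc -mulmxA EiE // mulmx1. Qed.

Lemma smooth_Fc i : smooth_mx U (A i).
Proof.
apply: smooth_mulmx => //; last exact: smooth_Ei.
apply: smooth_mxD => //; first exact: smooth_mulmx.
by apply: smooth_mxN => //; apply: smooth_dmx.
Qed.

Local Opaque Fc.

Lemma smooth_thf i : smooth_on U (thf th i). Proof. exact: sth. Qed.

Lemma cov_frame i j a y : U y -> cov A i (fr E j) a y = (E y *m G i y) a j.
Proof.
move=> Uy; have /matrixP /(_ a j) := Fc_E i Uy.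
rewrite [X in _ = X -> _]mxE [X in _ = _ + X -> _]mxE mxE => H.
by rewrite /cov /act -[X in _ + X]/(\sum_k A i y a k * E y k j) H [dmx _ _ _ _ _]mxE addrC subrK.
Qed.

Lemma Fc_torsion y i j a : U y -> cov A i (fr E j) a y = cov A j (fr E i) a y.
Proof.
move=> Uy; rewrite !cov_frame // !mxE; apply: eq_bigr => k _; rewrite !mxE.
by congr (_ * _); apply: (Gamma_symmetric oU th frame_gT).
Qed.

Lemma Fc_metric y i : U y -> conf_skew (thf th i y) (A i y).
Proof.
move=> Uy.
have M := Gm_metric oU th frame_gT frame_gU i Uy.
have D : dmx i g y = (dmx i E y)^T *m E y + (E y)^T *m dmx i E y.
  rewrite (dmx_eq oU i Uy (N := fun z => (E z)^T *m E z)); last first.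
    by move=> z Uz; rewrite EtE.
  by rewrite (dmxM oU i Uy (smooth_mxT oU sE) sE) (dmxT oU i E Uy).
have K : (E y)^T *m (A i y + (A i y)^T) *m E y = (2 * th y 0 i) *: ((E y)^T *m E y).
  have e1 : (E y)^T *m (A i y + (A i y)^T) *m E y =
      (E y)^T *m (A i y *m E y) + (A i y *m E y)^T *m E y.
    exact: sym_congr.
  have M' : (2 * th y 0 i) *: g y = (G i y)^T *m g y + g y *m G i y - dmx i g y.
    by rewrite -M [dmx i g y + _]addrC addrK.
  have T : (E y *m G i y - dmx i E y)^T = (G i y)^T *m (E y)^T - (dmx i E y)^T.
    by rewrite linearB /= trmx_mul.
  rewrite e1 Fc_E // T EtE // M' D -EtE //.
  move: (G i y) (dmx i E y) (E y) => G0 D0 E0; by mx_abel.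
have {}K : A i y + (A i y)^T = (2 * th y 0 i)%:M.
  have Tu : (E y)^T \in unitmx by rewrite unitmx_tr frame_unit.
  apply: (can_inj (mulmxK (frame_unit Uy))); apply: (can_inj (mulKmx Tu)).
  by rewrite mulmxA K mul_scalar_mx -scalemxAr.
move=> a b; have /matrixP /(_ a b) := K.
by rewrite !mxE /thf => ->; rewrite mulr_natr.
Qed.

Lemma Fc_curvature i j y : U y ->
  dmx i (A j) y - dmx j (A i) y + (A i y *m A j y - A j y *m A i y)
  = E y *m Cm g th i j y *m Ei E y.
Proof.
move=> Uy; apply: (can_inj (mulmxK (frame_unit Uy))).
rewrite -[RHS]mulmxA EiE // mulmx1 CmE.
have L i' j' : dmx i' (A j') y *m E y = dmx i' E y *m G j' y + E y *m dmx i' (G j') y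
    - dmx i' (dmx j' E) y - A j' y *m dmx i' E y.
  have := dmxM oU i' Uy (smooth_Fc j') sE.
  rewrite (dmx_eq oU i' Uy (N := fun z => E z *m G j' z - dmx j' E z)); last first.
    by move=> z Uz; rewrite Fc_E.
  rewrite (dmxB oU i' Uy (smooth_mulmx oU sE (sG j')) (smooth_dmx oU j' sE)).
  by rewrite (dmxM oU i' Uy sE (sG j')) => ->; rewrite addrK.
exact: (gauge_curvature (Fc_E i Uy) (Fc_E j Uy) (L i j) (L j i) (dmxC oU i j Uy sE)).
Qed.

Lemma Om_Fc m i j y : U y -> Om (ga A) m i j y = p m (E y *m Cm g th i j y *m Ei E y).
Proof.
move=> Uy; rewrite -Fc_curvature // /Om /ga.
have P1 : pd i (fun y => p m (A j y)) y = p m (dmx i (A j) y).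
  exact: (pd_p oU i m Uy (smooth_Fc j)).
have P2 : pd j (fun y => p m (A i y)) y = p m (dmx j (A i) y).
  exact: (pd_p oU j m Uy (smooth_Fc i)).
have P3 := p_bracket m (Fc_metric i Uy) (Fc_metric j Uy).
have cg (x x' z z' : R) : x = x' -> z = z' -> x - z - 2 * crs (fun l => p l (A i y)) (fun l => p l (A j y)) m
    = x' - z' - 2 * crs (fun l => p l (A i y)) (fun l => p l (A j y)) m by move=> -> ->.
have fin (x z c k : R) : k = - 2 * c -> x - z - 2 * c = x - z + k by move=> ->; ring.
apply: (etrans (cg _ _ _ _ P1 P2)); apply: (etrans (fin _ _ _ _ P3)).
move: (dmx i (A j) y) (dmx j (A i) y) (A i y *m A j y - A j y *m A i y) => M N K.
by rewrite /p !mxE; case: m {P1 P2 P3 cg fin}; ring.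
Qed.

End Conn.
End FrameChart.

(** * The curvature of the bundle of antiselfdual forms *)

Section PLinear.
Context {R : realType}.
Implicit Types (M N X Y : 'M[R]_4).

Lemma pD m M N : p m (M + N) = p m M + p m N.
Proof. by rewrite /p !mxE; case: m; ring. Qed.
Lemma pZ m c M : p m (c *: M) = c * p m M.
Proof. by rewrite /p !mxE; case: m; ring. Qed.
Lemma pN m M : p m (- M) = - p m M.
Proof. by rewrite /p !mxE; case: m; ring. Qed.
Lemma p0 m : p m (0 : 'M[R]_4) = 0.
Proof. by rewrite /p !mxE; case: m; ring. Qed.
Lemma p_scalar m (c : R) : p m (c%:M : 'M[R]_4) = 0.
Proof. by rewrite /p !mxE; case: m; rewrite /= ; ring. Qed.
Lemma p_sum m (I : Type) (r : seq I) (F : I -> 'M[R]_4) :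
  p m (\sum_(i <- r) F i) = \sum_(i <- r) p m (F i).
Proof. by elim: r => [|i r IH]; rewrite ?big_nil ?p0 // !big_cons pD IH. Qed.

Lemma p_outer m (u v : 'I_4 -> R) : p m (\matrix_(a, b) (u a * v b)) = 4^-1 * B m u v.
Proof. by rewrite /p !mxE /B; case: m. Qed.

Lemma p_congr_sum m X Y M :
  p m (X *m M *m Y) = \sum_k \sum_l M k l * p m (X *m delta_mx k l *m Y).
Proof.
rewrite {1}[M]matrix_sum_delta mulmx_sumr mulmx_suml p_sum; apply: eq_bigr => k _.
rewrite mulmx_sumr mulmx_suml p_sum; apply: eq_bigr => l _.
by rewrite -scalemxAr -scalemxAl pZ.
Qed.

Variable X : 'M[R]_4.

(* component along the l-th antiselfdual form, of a 2-form given by its components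
   in a basis whose vectors are the columns of the inverse of X *)
Definition qf (l : tri) (P : 'I_4 -> 'I_4 -> R) : R := p l (X^T *m (\matrix_(i, j) P i j) *m X).

Definition Q0 (P : tri -> 'I_4 -> 'I_4 -> R) :=
  (forall l m, l <> m -> qf l (P m) + qf m (P l) = 0) /\
  (forall l m, qf l (P l) = qf m (P m)).

Lemma qfD l P P' : qf l (fun i j => P i j + P' i j) = qf l P + qf l P'.
Proof.
rewrite /qf -pD -mulmxDl -mulmxDr; congr (p _ (_ *m _ *m _)).
by apply/matrixP => i j; rewrite !mxE.
Qed.

Lemma qfZ l c P : qf l (fun i j => c * P i j) = c * qf l P.
Proof.
rewrite /qf -pZ scalemxAl scalemxAr; congr (p _ (_ *m _ *m _)).
by apply/matrixP => i j; rewrite !mxE.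
Qed.

Lemma qf_eq l P P' : (forall i j, P i j = P' i j) -> qf l P = qf l P'.
Proof. by move=> e; rewrite /qf; congr (p _ (_ *m _ *m _)); apply/matrixP => i j; rewrite !mxE. Qed.

Lemma Q0_lin c P P' : Q0 P -> Q0 P' -> Q0 (fun m i j => P m i j + c * P' m i j).
Proof.
move=> [a1 a2] [b1 b2]; split=> l m.
  by move=> lm; rewrite !qfD !qfZ -[RHS](a1 l m lm) -[RHS]addr0 -(mulr0 c) -(b1 l m lm); ring.
by rewrite !qfD !qfZ (a2 l m) (b2 l m).
Qed.

Lemma Q0_eq P P' : (forall m i j, P m i j = P' m i j) -> Q0 P -> Q0 P'.
Proof.
move=> e [a1 a2]; have E l m : qf l (P m) = qf l (P' m) by apply: qf_eq.
by split=> l m; rewrite -!E; [exact: a1|exact: a2].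
Qed.

Variable E : 'M[R]_4.
Hypothesis EX : E *m X = 1%:M.
Local Notation e j := (fun a => E a j).

Lemma congr_entry P a b : (X^T *m (\matrix_(i, j) P i j) *m X) a b =
  \sum_i \sum_j X i a * X j b * P i j.
Proof.
rewrite !mxE exchange_big /=; apply: eq_bigr => j _.
rewrite !mxE mulr_suml; apply: eq_bigr => i _; by rewrite !mxE; ring.
Qed.

Lemma qf_bilin l (f : ('I_4 -> R) -> ('I_4 -> R) -> R) :
  (forall v, lin (fun u => f u v)) -> (forall u, lin (fun v => f u v)) ->
  qf l (fun i j => f (e i) (e j)) = pair l (fun a b => f (unit4 a) (unit4 b)).
Proof.
move=> L1 L2; rewrite /qf /pair; congr (p _ _); apply/matrixP => a b.
rewrite congr_entry !mxE !(unit_basis EX) L1; apply: eq_bigr => i _.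
by rewrite L2 mulr_sumr; apply: eq_bigr => j _; rewrite mulrA.
Qed.

Lemma Q0_derivative (pi : 'I_4 -> 'I_4 -> R) :
  Q0 (fun m i j => B m (e i) (pi j) - B m (e j) (pi i)).
Proof.
pose Z a c := hat X (fun i => pi i c) a.
have Zu i : pi i = (fun c => \sum_a e i a * Z a c).
  apply/funext => c; rewrite -(dot_hat EX (fun i => pi i c) i) /dot.
  by apply: eq_bigr => a _; rewrite mulrC.
have q l m : qf l (fun i j => B m (e i) (pi j) - B m (e j) (pi i)) =
    pair l (fun a b => B m (unit4 a) (Z b) - B m (unit4 b) (Z a)).
  rewrite (qf_eq _ (P' := fun i j => B m (e i) (fun c => \sum_a e j a * Z a c)
     + - B m (e j) (fun c => \sum_a e i a * Z a c))); last first.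
    by move=> i j; rewrite -!Zu.
  rewrite (qf_bilin l (f := fun u v => B m u (fun c => \sum_a v a * Z a c)
     + - B m v (fun c => \sum_a u a * Z a c))); last 2 first.
  - by move=> v; linear_tac.
  - by move=> u; linear_tac.
  rewrite /pair; congr (p _ _); apply/matrixP => a b; rewrite !mxE.
  have U k : (fun c => \sum_a0 unit4 k a0 * Z a0 c) = Z k by apply/funext => c; exact: sum_unit.
  by rewrite !U.
split=> l m; rewrite !q /pair /p !mxE /B /unit4; case: l; case: m => //= *; ring.
Qed.

Lemma Q0_square t :
  Q0 (fun m i j => crs (fun l => B l (e i) t) (fun l => B l (e j) t) m).
Proof.
have q l m : qf l (fun i j => crs (fun l => B l (e i) t) (fun l => B l (e j) t) m) =
    pair l (fun a b => crs (fun l => B l (unit4 a) t) (fun l => B l (unit4 b) t) m).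
  apply: (qf_bilin l (f := fun u v => crs (fun l => B l u t) (fun l => B l v t) m)).
  - by move=> v; rewrite /crs; linear_tac.
  - by move=> v; rewrite /crs; linear_tac.
split=> l m; rewrite !q /pair /p !mxE /crs /B /unit4; case: l; case: m => //= *; ring.
Qed.

End PLinear.

Section OmShift.
Context {R : realType}.
Variables (U : set 'cV[R]_4) (oU : open U).
Variables (a a' be : tri -> 'I_4 -> 'cV[R]_4 -> R).
Hypotheses (sa : forall l i, smooth_on U (a l i)) (sbe : forall l i, smooth_on U (be l i)).
Hypothesis aE : forall y, U y -> forall l i, a' l i y = a l i y + be l i y.

Lemma Om_shift m i j y : U y -> Om a' m i j y = Om a m i j y
  + (nab a (fun _ _ => 0) i (fun l => be l j) m y - nab a (fun _ _ => 0) j (fun l => be l i) m y)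
  - 2 * crs (fun l => be l i y) (fun l => be l j y) m.
Proof.
move=> Uy.
have D i' j' : pd i' (a' m j') y = pd i' (a m j') y + pd i' (be m j') y.
  by rewrite -(pdD i' Uy) //; apply: (pd_eq i' oU Uy) => z Uz; exact: aE.
rewrite /Om /nab /crs !D !aE //.
by case: m D => /= _; gen_pd; ring.
Qed.
End OmShift.

Section SelfdualWeyl.
Context {R : realType}.
Variables (U : set 'cV[R]_4) (oU : open U).
Variables (g E : 'cV[R]_4 -> 'M[R]_4) (th : 'cV[R]_4 -> 'rV[R]_4).
Hypotheses (sE : smooth_mx U E) (sth : smooth_mx U th)
  (EtE : forall y, U y -> (E y)^T *m E y = g y) (dE : forall y, U y -> \det (E y) = 1).
Implicit Types (y : 'cV[R]_4).
Local Notation A := (Fc g E th).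
Local Notation A0 := (Fc g E (fun=> 0)).
Local Notation X := (Ei E).
Local Notation e j y := (fun a => E y a j).

Lemma frame_star y al : U y ->
  (X y)^T *m star2 (g y) al *m X y = eps4 ((X y)^T *m al *m X y).
Proof.
move=> Uy; rewrite star2E (frame_invg EtE dE Uy) trmx_mul trmxK.
have dX : \det (X y) = 1 by rewrite /Ei det_inv dE // invr1.
rewrite -[RHS]scale1r -dX -eps4_congr; congr (_ *m eps4 _ *m _).
by rewrite !mulmxA.
Qed.

Lemma selfdual_p y al l : U y -> selfdual_form (g y) al ->
  p l ((X y)^T *m al *m X y) = 0.
Proof.
move=> Uy sd; have := frame_star al Uy; rewrite sd => H.
have := p_eps4 l ((X y)^T *m al *m X y); rewrite -H => K.
by move: (p l _) K => c K; lra.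
Qed.

Lemma frame_gX y : U y -> g y *m X y = (E y)^T.
Proof. by move=> Uy; rewrite -EtE // -mulmxA (EEi dE Uy) mulmx1. Qed.

Lemma frame_XtE y : U y -> (X y)^T *m g y = E y.
Proof. by move=> Uy; rewrite -EtE // mulmxA -trmx_mul (EEi dE Uy) trmx1 mul1mx. Qed.

(* row vectors contracted with the frame *)
Let rowX (v : 'rV[R]_4) y : 'I_4 -> R := fun a => (v *m X y) 0 a.

Lemma rowX_g i y : U y -> rowX (row i (g y)) y = e i y.
Proof.
move=> Uy; apply/funext => a; rewrite /rowX -row_mul frame_gX //.
by rewrite !mxE.
Qed.

Lemma outer_congr (v w : 'rV[R]_4) y :
  (X y)^T *m (v^T *m w) *m X y = \matrix_(a, b) (rowX v y a * rowX w y b).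
Proof.
have tE (M : 'rV[R]_4) a : M^T a 0 = M 0 a by rewrite mxE.
rewrite mulmxA -trmx_mul -mulmxA; apply/matrixP => a b.
by rewrite [LHS]mxE big_ord1 [RHS]mxE tE.
Qed.

Let s0 : smooth_mx U (fun=> 0 : 'rV[R]_4).
Proof. by move=> a b; apply: (smooth_eq oU _ (smooth_cst U 0)) => y _; rewrite mxE. Qed.

Lemma weyl_Q0 y : U y ->
  (forall k l, selfdual_form (g y) (\matrix_(i, j) weyl_tensor g y i j k l)) ->
  Q0 (X y) (fun m i j => Om (ga A0) m i j y).
Proof.
move=> Uy sd.
pose W i j : 'M[R]_4 := \matrix_(k, l) weyl_tensor g y i j k l.
have [S SE] : exists S, schouten g y = S by exists (schouten g y).
have WE i j : W i j = g y *m Cm g (fun=> 0) i j y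
    - ((row i (g y))^T *m row j S - (row j (g y))^T *m row i S
       + (row i S)^T *m row j (g y) - (row j S)^T *m row i (g y)).
  apply/matrixP => k l; rewrite !mxE !big_ord1 !mxE /weyl_tensor SE.
  rewrite !(gC (frame_gT EtE) _ k Uy); congr (_ - _); last by ring.
  by apply: eq_bigr => t _; rewrite mxE.
have qW l m : qf (X y) l (fun i j => p m ((X y)^T *m W i j *m X y)) = 0.
  rewrite (qf_eq _ _ (P' := fun i j => \sum_k \sum_l W i j k l
     * p m ((X y)^T *m delta_mx k l *m X y))); last by move=> i j; exact: p_congr_sum.
  rewrite /qf.
  have -> : \matrix_(i, j) (\sum_k \sum_l W i j k l * p m ((X y)^T *m delta_mx k l *m X y))
      = \sum_k \sum_l p m ((X y)^T *m delta_mx k l *m X y) *: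
         (\matrix_(i, j) weyl_tensor g y i j k l).
    apply/matrixP => i j; rewrite mxE summxE; apply: eq_bigr => k _.
    by rewrite summxE; apply: eq_bigr => t _; rewrite !mxE mulrC.
  rewrite mulmx_sumr mulmx_suml p_sum big1 // => k _.
  rewrite mulmx_sumr mulmx_suml p_sum big1 // => t _.
  by rewrite -scalemxAr -scalemxAl pZ (selfdual_p l Uy (sd k t)) mulr0.
have OmW m i j : Om (ga A0) m i j y = p m ((X y)^T *m W i j *m X y)
    + 2^-1 * (B m (e i y) (rowX (row j S) y) - B m (e j y) (rowX (row i S) y)).
  rewrite (Om_Fc oU sE EtE dE s0) // WE mulmxBr mulmxBl mulmxA frame_XtE //.
  rewrite !(mulmxBr, mulmxDr, mulmxBl, mulmxDl, mulNmx, mulmxN) !outer_congr !rowX_g //.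
  rewrite !(pD, pN) !p_outer (B_antisym m (rowX (row i S) y)) (B_antisym m (rowX (row j S) y)).
  by move: (p m _) (B m _ _) (B m _ _) => c c1 c2; field.
have H1 : Q0 (X y) (fun m i j => p m ((X y)^T *m W i j *m X y)).
  by split=> l m *; rewrite !qW ?addr0.
have H2 := Q0_derivative (EEi dE Uy) (fun j => rowX (row j S) y).
by apply: (Q0_eq _ (Q0_lin 2^-1 H1 H2)) => m i j; rewrite OmW.
Qed.

Let t a y := \sum_i th y 0 i * X y i a.

Let st a : smooth_on U (t a).
Proof.
have sX := smooth_Ei oU sE dE.
apply: smooth_sum => // i _; by apply: smoothM.
Qed.

Lemma Fc_shift i y : U y -> A i y = A0 i y + (th y 0 i)%:M
  + \matrix_(a, b) (e i y a * t b y) - \matrix_(a, b) (t a y * e i y b).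
Proof.
Local Transparent Fc.
move=> Uy; rewrite /Fc.
have tb b : t b y = (th y *m X y) 0 b by rewrite mxE.
have GE : Gm g th i y = Gm g (fun=> 0) i y + (th y 0 i)%:M
    + (delta_mx i 0 : 'cV_4) *m th y - (invmx (g y) *m (th y)^T) *m row i (g y).
  apply/matrixP => k j; rewrite !mxE !big_ord1 !mxE /Gamma.
  rewrite [\sum_l invmx (g y) k l * (0 : 'rV[R]_4) 0 l]big1; last first.
    by move=> l _; rewrite mxE mulr0.
  have -> : \sum_l invmx (g y) k l * (th y)^T l 0 = \sum_l invmx (g y) k l * th y 0 l.
    by apply: eq_bigr => l _; rewrite mxE.
  have -> : th y 0 i *+ (k == j) = th y 0 i * (k == j)%:R by rewrite mulr_natr.
  rewrite !mxE eqxx andbT.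
  have fin (s1 s2 a b c d e : R) : s1 + a * c + b * d - e * s2 =
      s1 + 0 * c + 0 * d - e * 0 + a * c + d * b - s2 * e by ring.
  exact: fin.
rewrite GE (frame_invg EtE dE Uy).
have XE := EEi dE Uy.
have O1 : E y *m ((delta_mx i 0 : 'cV_4) *m th y) *m X y = \matrix_(a, b) (e i y a * t b y).
  rewrite mulmxA -mulmxA -colE; apply/matrixP => a b.
  by rewrite [LHS]mxE big_ord1 [RHS]mxE tb; congr (_ * _); rewrite mxE.
have O2 : E y *m (X y *m (X y)^T *m (th y)^T *m row i (g y)) *m X y
    = \matrix_(a, b) (t a y * e i y b).
  rewrite !mulmxA XE mul1mx -trmx_mul -mulmxA; apply/matrixP => a b.
  rewrite [LHS]mxE big_ord1 [RHS]mxE tb; congr (_ * _); first by rewrite mxE.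
  exact: (congr1 (fun f => f b) (rowX_g i Uy)).
have O3 : E y *m (th y 0 i)%:M *m X y = (th y 0 i)%:M.
  by rewrite mul_mx_scalar -scalemxAl XE scale_scalar_mx mulr1.
rewrite -O1 -O2 -[in RHS]O3.
move: (Gm g (fun=> 0) i y) (th y 0 i)%:M (_ *m th y) (_ *m row i (g y)) (dmx i E y).
move=> G0 c M1 M2 D; by mx_abel.
Qed.
Local Opaque Fc.

Lemma ga_shift m i y : U y -> ga A m i y = ga A0 m i y + 2^-1 * B m (e i y) (t^~ y).
Proof.
move=> Uy; rewrite /ga Fc_shift // !pD pN p_scalar !p_outer (B_antisym m (t^~ y)).
by move: (p m _) (B m _ _) => c1 c2; field.
Qed.

Lemma einstein_weyl_Q0 y : U y ->
  (forall y, U y -> forall k l, selfdual_form (g y) (\matrix_(i, j) weyl_tensor g y i j k l)) ->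
  Q0 (X y) (fun m i j => Om (ga A) m i j y).
Proof.
move=> Uy sd.
have sf j a : smooth_on U (fr E j a) by exact: sE.
have sA0 := smooth_Fc oU sE EtE dE s0.
have sga l i : smooth_on U (ga A0 l i) by apply: smooth_p.
have sbB l j : smooth_on U (fun z => B l ((fr E j)^~ z) (t^~ z)) by apply: smooth_B.
have sb l j : smooth_on U (fun z => 2^-1 * B l ((fr E j)^~ z) (t^~ z)).
  by apply: smoothM => //; exact: smooth_cst.
have metr z : U z -> forall i, conf_skew (thf (fun=> 0) i z) (A0 i z).
  by move=> Uz i; apply: (Fc_metric oU sE EtE dE).
have tors := Fc_torsion oU EtE dE (fun=> 0).
have N i j m : nab (ga A0) (fun _ _ => 0) i
      (fun l z => 2^-1 * B l ((fr E j)^~ z) (t^~ z)) m y =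
    2^-1 * (B m ((cov A0 i (fr E j))^~ y) (t^~ y) + B m (e j y) ((cov A0 i t)^~ y)).
  rewrite (nab_const _ _ _ _ _ Uy); last by move=> l; exact: sbB.
  rewrite (nab_B oU sE metr) // /thf mxE; congr (_ * _).
  by rewrite mulr0 subr0 mul0r addr0.
have Q1 := Q0_derivative (EEi dE Uy) (fun i => (cov A0 i t)^~ y).
have Q2 := Q0_square (EEi dE Uy) (t^~ y).
apply: (Q0_eq _ (Q0_lin (- 2^-1) (Q0_lin (- 2^-1) (weyl_Q0 Uy (sd y Uy)) Q1) Q2)) => m i j.
rewrite (Om_shift oU sga sb (fun z Uz l i => ga_shift l i Uz)) //.
rewrite !N.
have -> : (cov A0 i (fr E j))^~ y = (cov A0 j (fr E i))^~ y.
  by apply/funext => a; exact: tors.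
rewrite /crs /fr.
have fin (o c q r a b c' d : R) : o + - 2^-1 * (q - r) + - 2^-1 * (a * b - c' * d) =
    o + (2^-1 * (c + r) - 2^-1 * (c + q))
    - 2 * (2^-1 * a * (2^-1 * b) - 2^-1 * c' * (2^-1 * d)) by field.
exact: fin.
Qed.

End SelfdualWeyl.

Section Bracket.
Context {R : realType}.
Implicit Types (M N : 'M[R]_4).

Lemma conf_skew_mx (th : R) M : conf_skew th M <-> M + M^T = (2 * th)%:M.
Proof.
split=> [H|H a b].
  by apply/matrixP => a b; rewrite !mxE H mulr_natr.
by have /matrixP /(_ a b) := H; rewrite !mxE mulr_natr.
Qed.

Lemma conf_skew_bracket (s t : R) M N : conf_skew s M -> conf_skew t N ->
  conf_skew 0 (M *m N - N *m M).
Proof.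
move=> /conf_skew_mx hM /conf_skew_mx hN; apply/conf_skew_mx.
have MT : M^T = (2 * s)%:M - M by rewrite -hM addrC addKr.
have NT : N^T = (2 * t)%:M - N by rewrite -hN addrC addKr.
rewrite linearB /= !trmx_mul MT NT !mulmxBl !mulmxBr !mul_scalar_mx !mul_mx_scalar.
move: (M *m N) (N *m M) => MN NM.
by apply/matrixP => a b; rewrite !mxE; case: (a == b); rewrite /=; ring.
Qed.

End Bracket.

Section EinsteinWeyl.
Context {R : realType}.
Variables (U : set 'cV[R]_4) (oU : open U).
Variables (g E : 'cV[R]_4 -> 'M[R]_4) (th : 'cV[R]_4 -> 'rV[R]_4).
Hypotheses (sE : smooth_mx U E) (sth : smooth_mx U th)
  (EtE : forall y, U y -> (E y)^T *m E y = g y) (dE : forall y, U y -> \det (E y) = 1).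
Implicit Types (y : 'cV[R]_4).
Local Notation A := (Fc g E th).
Local Notation X := (Ei E).
Local Notation e j y := (fun a => fr E j a y).
Hypothesis sdW : forall y, U y ->
  forall k l, selfdual_form (g y) (\matrix_(i, j) weyl_tensor g y i j k l).
Hypothesis ric : forall y, U y -> sym_tracefree_ricci g th y = 0.

Let Rm i j y := E y *m Cm g th i j y *m X y.
Definition Fh (th : 'cV[R]_4 -> 'rV[R]_4) y := (X y)^T *m faraday th y *m X y.
Let C a b y : 'M[R]_4 := \sum_i \sum_j (X y i a * X y j b) *: Rm i j y.

Let sA i : smooth_mx U (A i). Proof. exact: (smooth_Fc oU sE EtE dE sth). Qed.
Let sX : smooth_mx U X. Proof. exact: (smooth_Ei oU sE dE). Qed.
Let sga l i : smooth_on U (ga A l i). Proof. exact: smooth_p. Qed.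
Let metr y : U y -> forall i, conf_skew (thf th i y) (A i y).
Proof. by move=> Uy i; exact: (Fc_metric oU sE EtE dE). Qed.

Lemma Rm_skew i j y : U y -> conf_skew (faraday th y i j) (Rm i j y).
Proof.
move=> Uy; rewrite /Rm -(Fc_curvature oU sE EtE dE sth) // => a b.
have br := conf_skew_bracket (metr Uy i) (metr Uy j) a b.
have D i' j' : dmx i' (A j') y a b + dmx i' (A j') y b a
    = 2 * pd i' (thf th j') y * (a == b)%:R.
  rewrite !mxE -(pdD i' Uy) //; try exact: sA.
  rewrite -[RHS]mulrA [pd _ _ _ * _]mulrC mulrA -(pdZ i' Uy); last exact: sth.
  apply: (pd_eq i' oU Uy) => z Uz.
  by rewrite (Fc_metric oU sE EtE dE th j' Uz a b) mulrAC.
have := D i j; have := D j i; move: br; rewrite [faraday _ _ _ _]mxE.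
rewrite -[pd i (fun z => th z 0 j) y]/(pd i (thf th j) y).
rewrite -[pd j (fun z => th z 0 i) y]/(pd j (thf th i) y).
have mxD (M N K : 'M[R]_4) c d : (M - N + K) c d = M c d - N c d + K c d by rewrite !mxE.
rewrite !mxD; move: (dmx i _ _) (dmx j _ _) (_ - _) (pd i _ _) (pd j _ _) => M N K p1 p2.
by move: (_%:R) => q; rewrite mulr0 mul0r => h1 h2 h3; lra.
Qed.

Lemma C_entry a b y c d : C a b y c d = \sum_i \sum_j X y i a * X y j b * Rm i j y c d.
Proof.
by rewrite summxE; apply: eq_bigr => i _; rewrite summxE; apply: eq_bigr => j _; rewrite mxE.
Qed.

Lemma Rm_antisym i j y c d : Rm i j y c d = - Rm j i y c d.
Proof.
have -> : Rm i j y = - Rm j i y; last by rewrite mxE.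
rewrite /Rm -mulNmx -mulmxN; congr (_ *m _ *m _); apply/matrixP => k l.
by rewrite !mxE curvature_antisym.
Qed.

Lemma C_antisym a b y : C a b y = - C b a y.
Proof.
apply/matrixP => c d; rewrite [RHS]mxE !C_entry -sumrN exchange_big.
apply: eq_bigr => j _; rewrite -sumrN; apply: eq_bigr => i _.
by rewrite Rm_antisym; move: (Rm _ _ _ _ _) => q; ring.
Qed.

Lemma C_skew a b y : U y -> conf_skew (Fh th y a b) (C a b y).
Proof.
move=> Uy c d; rewrite !C_entry -big_split /=.
have -> : Fh th y a b = \sum_i \sum_j X y i a * X y j b * faraday th y i j.
  rewrite /Fh -congr_entry; congr ((_ *m _ *m _) a b); apply/matrixP => i j.
  by rewrite [RHS]mxE.
rewrite mulr_sumr mulr_suml; apply: eq_bigr => i _.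
rewrite -big_split mulr_sumr mulr_suml; apply: eq_bigr => j _ /=.
rewrite -mulrDr (Rm_skew i j Uy c d).
by move: (faraday _ _ _ _) (_%:R) => q r; ring.
Qed.

Lemma sum_rot (F : 'I_4 -> 'I_4 -> 'I_4 -> R) :
  \sum_i \sum_j \sum_k F j k i = \sum_i \sum_j \sum_k F i j k.
Proof.
rewrite exchange_big /=; apply: eq_bigr => j _.
by rewrite exchange_big.
Qed.

Lemma C_bianchi a b c d y : U y ->
  C a b y c d + C b d y c a + C d a y c b = 0.
Proof.
move=> Uy.
pose T i j l := (E y *m Cm g th i j y) c l.
have T0 i j l : T i j l + T j l i + T l i j = 0.
  rewrite /T !mxE -!big_split big1 // => k _ /=.
  rewrite !mxE -!mulrDr.
  by rewrite (curvature_bianchi oU th (frame_gT EtE)) ?mulr0.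
have CT a' b' d' : C a' b' y c d' = \sum_i \sum_j \sum_l X y i a' * X y j b' * X y l d' * T i j l.
  rewrite C_entry; apply: eq_bigr => i _; apply: eq_bigr => j _.
  rewrite /Rm [in LHS]mxE mulr_sumr; apply: eq_bigr => l _.
  by rewrite -/(T i j l); move: (T i j l) => q; ring.
rewrite !CT.
rewrite -[in X in _ + X + _](sum_rot (fun i j l => X y i b * X y j d * X y l a * T i j l)).
rewrite -[in X in _ + X](sum_rot (fun i j l => X y i d * X y j a * X y l b * T i j l)).
rewrite -[in X in _ + X](sum_rot (fun i j l => X y j d * X y l a * X y i b * T j l i)).
rewrite -!big_split big1 // => i _; rewrite -!big_split big1 // => j _.
rewrite -!big_split big1 // => l _ /=.
have H : T l i j = - T i j l - T j l i by rewrite -[RHS]addr0 -(T0 i j l); ring.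
by rewrite H; ring.
Qed.

Lemma C_ricci b d y : U y ->
  \sum_a C a b y a d = ((X y)^T *m ricci g th y *m X y) b d.
Proof.
move=> Uy.
transitivity (\sum_i \sum_j X y j b * (Cm g th i j y *m X y) i d).
  transitivity (\sum_i \sum_j X y j b * \sum_a X y i a * Rm i j y a d).
    under eq_bigr do rewrite C_entry.
    rewrite exchange_big; apply: eq_bigr => i _ /=.
    rewrite exchange_big; apply: eq_bigr => j _ /=.
    by rewrite mulr_sumr; apply: eq_bigr => a _; ring.
  apply: eq_bigr => i _; apply: eq_bigr => j _; congr (_ * _).
  have -> : \sum_a X y i a * Rm i j y a d = (X y *m Rm i j y) i d by rewrite mxE.
  by rewrite /Rm !mulmxA (EiE dE Uy) mul1mx.
have -> : ricci g th y = \matrix_(j, l) \sum_i Cm g th i j y i l.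
  by apply/matrixP => j l; rewrite !mxE; apply: eq_bigr => i _; rewrite mxE.
rewrite congr_entry exchange_big; apply: eq_bigr => j _.
under eq_bigr do rewrite mxE mulr_sumr.
rewrite exchange_big; apply: eq_bigr => l _.
rewrite mulr_sumr; apply: eq_bigr => i _; by ring.
Qed.

Lemma C_einstein b d y : U y ->
  \sum_a C a b y a d + \sum_a C a d y a b = 2^-1 * scal g th y * (b == d)%:R.
Proof.
move=> Uy; rewrite !C_ricci //.
have Rs : 2^-1 *: (ricci g th y + (ricci g th y)^T) = (scal g th y / 4) *: g y.
  by apply/eqP; rewrite -subr_eq0; apply/eqP; exact: ric.
have -> : ((X y)^T *m ricci g th y *m X y) d b = ((X y)^T *m (ricci g th y)^T *m X y) b d.
  have -> : (X y)^T *m (ricci g th y)^T *m X y = ((X y)^T *m ricci g th y *m X y)^T.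
    by rewrite !trmx_mul trmxK mulmxA.
  by rewrite [RHS]mxE.
have mxD (M N : 'M[R]_4) a c : M a c + N a c = (M + N) a c by rewrite mxE.
rewrite mxD -mulmxDl -mulmxDr.
have -> : ricci g th y + (ricci g th y)^T = (2^-1 * scal g th y) *: g y.
  transitivity (2 *: (2^-1 *: (ricci g th y + (ricci g th y)^T))).
    by rewrite scalerA mulfV ?pnatr_eq0 // scale1r.
  by rewrite Rs scalerA; congr (_ *: _); field.
rewrite -scalemxAr -scalemxAl (frame_XtE EtE dE Uy) (EEi dE Uy) scalemx1.
by rewrite mxE mulr_natr.
Qed.

Let OM m y := \matrix_(i, j) Om (ga A) m i j y.

Lemma p_C m a b y : U y -> p m (C a b y) = ((X y)^T *m OM m y *m X y) a b.
Proof.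
move=> Uy; rewrite congr_entry p_sum; apply: eq_bigr => i _.
rewrite p_sum; apply: eq_bigr => j _; rewrite pZ.
by rewrite (Om_Fc oU sE EtE dE sth).
Qed.

Let S y := p T1 ((X y)^T *m OM T1 y *m X y).

Let sOM m : smooth_mx U (OM m).
Proof.
move=> i j; apply: (smooth_eq oU (f := fun y => Om (ga A) m i j y)) => [y _|].
  by rewrite mxE.
by rewrite /Om /crs; sm.
Qed.

Let sXT : smooth_mx U (fun y => (X y)^T). Proof. exact: smooth_mxT. Qed.

Lemma smooth_S : smooth_on U S.
Proof. by apply: smooth_p => //; do 2!apply: smooth_mulmx => //. Qed.

Lemma smooth_faraday : smooth_mx U (faraday th).
Proof.
move=> i j; apply: (smooth_eq oU (f := fun y => pd i (thf th j) y - pd j (thf th i) y)).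
  by move=> y _; rewrite mxE.
by apply: smoothD => //; [|apply: smoothN => //]; apply: smooth_pd; exact: sth.
Qed.

Lemma smooth_Fh : smooth_mx U (Fh th).
Proof. do 2!apply: smooth_mulmx => //; exact: smooth_faraday. Qed.

Lemma B_expand m (u v : 'I_4 -> R) : B m u v = \sum_a \sum_b u a * v b * Bu m a b.
Proof. by rewrite !sum4 /Bu /B /unit4; case: m => /=; ring. Qed.

Lemma asd_curvature m i j y : U y -> Om (ga A) m i j y = S y * B m (e i y) (e j y)
  - 2^-1 * crs (fun l => p l (Fh th y)) (fun l => B l (e i y) (e j y)) m.
Proof.
move=> Uy.
have [q1 q2] := einstein_weyl_Q0 oU sE sth EtE dE Uy sdW.
have pq l m' : pair l (fun a b => p m' (C a b y)) = qf (X y) l (fun i j => Om (ga A) m' i j y).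
  rewrite /pair /qf; congr (p _ _); apply/matrixP => a b.
  by rewrite mxE p_C.
have K a b : ((X y)^T *m OM m y *m X y) a b = S y * Bu m a b
    - 2^-1 * crs (fun l => p l (Fh th y)) (fun l => Bu l a b) m.
  rewrite -p_C // (@curvature_algebra _ (fun a b => C a b y) (Fh th y) (2^-1 * scal g th y)).
  - by rewrite pq.
  - by move=> a' b'; exact: C_antisym.
  - by move=> a' b'; exact: C_skew.
  - by move=> *; exact: C_bianchi.
  - by move=> *; exact: C_einstein.
  - by move=> l m' lm; rewrite !pq; exact: q1.
  - by move=> l m'; rewrite !pq; exact: q2.
have -> : Om (ga A) m i j y = ((E y)^T *m ((X y)^T *m OM m y *m X y) *m E y) i j.
  rewrite !mulmxA -trmx_mul (EiE dE Uy) trmx1 mul1mx -mulmxA (EiE dE Uy) mulmx1.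
  by rewrite mxE.
have -> : (X y)^T *m OM m y *m X y = \matrix_(a, b) (S y * Bu m a b
    - 2^-1 * crs (fun l => p l (Fh th y)) (fun l => Bu l a b) m).
  by apply/matrixP => a b; rewrite K mxE.
rewrite congr_entry /crs !B_expand !mulr_sumr -!sumrB !mulr_sumr -sumrB; apply: eq_bigr => a _.
rewrite !mulr_sumr -!sumrB !mulr_sumr -sumrB; apply: eq_bigr => b _.
by rewrite /fr; move: (Bu _ _ _) (Bu _ _ _) (Bu _ _ _) => c1 c2 c3; ring.
Qed.

Lemma faraday_frame i j y : U y ->
  pd i (thf th j) y - pd j (thf th i) y = dot (e i y) (act (Fh th y) (e j y)).
Proof.
move=> Uy.
have -> : pd i (thf th j) y - pd j (thf th i) y = faraday th y i j by rewrite mxE.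
have -> : faraday th y = (E y)^T *m (Fh th y *m E y).
  by rewrite /Fh !mulmxA -trmx_mul (EiE dE Uy) trmx1 mul1mx -mulmxA (EiE dE Uy) mulmx1.
by rewrite mxE /dot /act; apply: eq_bigr => a _; rewrite !mxE.
Qed.

Theorem selfdual_faraday_ew m y : U y -> p m (Fh th y) = 0.
Proof.
have tors y' : U y' -> forall i j a, cov A i (fr E j) a y' = cov A j (fr E i) a y'.
  by move=> Uy' i j a; exact: (Fc_torsion oU EtE dE).
have sthf i : smooth_on U (thf th i) by exact: sth.
have EX y' : U y' -> E y' *m X y' = 1%:M by exact: EEi.
apply: (faraday_sd oU sE sX sA sthf EX tors metr smooth_S smooth_Fh).
- by move=> y' Uy' m' i j; exact: asd_curvature.
- by move=> y' Uy' i j; exact: faraday_frame.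
Qed.

Theorem asd_curvature_scalar m i j y : U y -> Om (ga A) m i j y = S y * B m (e i y) (e j y).
Proof.
move=> Uy; rewrite asd_curvature // /crs !selfdual_faraday_ew //.
by rewrite !mul0r subr0 mulr0 subr0.
Qed.

End EinsteinWeyl.

Section KmatAlgebra.
Context {R : realType}.
Implicit Types (k : tri -> R) (M : 'M[R]_4).

Lemma KmatT k : (Kmat k)^T = - Kmat k.
Proof.
apply/matrixP => a b; rewrite !mxE /Bu !(B_antisym _ (unit4 b)).
by move: (B _ _ _) (B _ _ _) (B _ _ _) => *; ring.
Qed.

Lemma Kmat_sqr k : Kmat k *m Kmat k = - (k T1 ^+ 2 + k T2 ^+ 2 + k T3 ^+ 2)%:M.
Proof.
by apply/matrixP; apply: all4; apply: all4; rewrite !mxE sum4 !mxE /Bu /B /unit4 /=; ring.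
Qed.

Lemma Kmat_bracket s M k : conf_skew s M ->
  M *m Kmat k - Kmat k *m M = Kmat (fun m => - 2 * crs (p^~ M) k m).
Proof.
move=> /conf_skewE[[h0 h1 h2 h3] [h4 h5 h6 [h7 h8 h9]]].
apply/matrixP; apply: all4; apply: all4; rewrite !mxE !sum4 !mxE /Bu /B /unit4 /crs /p /=.
all: rewrite ?(h0, h1, h2, h3, h4, h5, h6, h7, h8, h9); by field.
Qed.

Lemma Kmat_inj0 k : Kmat k = 0 -> forall m, k m = 0.
Proof.
move=> /matrixP H; have := (H o0 o1, H o0 o2, H o0 o3).
by rewrite !mxE /Bu /B /unit4 /= => -[[h1 h2] h3]; case; lra.
Qed.

End KmatAlgebra.

Section LocalTheorem.
Context {R : realType}.
Variables (U : set 'cV[R]_4) (oU : open U).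
Variables (g E : 'cV[R]_4 -> 'M[R]_4) (th th0 : 'cV[R]_4 -> 'rV[R]_4) (xi : 'cV[R]_4 -> 'cV[R]_4).
Hypotheses (sE : smooth_mx U E) (sth : smooth_mx U th) (sth0 : smooth_mx U th0)
  (sxi : smooth_mx U xi)
  (EtE : forall y, U y -> (E y)^T *m E y = g y) (dE : forall y, U y -> \det (E y) = 1).
Implicit Types (y : 'cV[R]_4).
Local Notation A := (Fc g E th).
Local Notation X := (Ei E).
Local Notation e j y := (fun a => fr E j a y).

Let V y := cov_vector (-1) th0 g th xi y.
Let N y := E y *m V y *m X y.
Local Notation nn := (fun m y => p m (N y)).

(* the metric dual of V is pure trace plus skew as soon as it is skew for th0 *)
Lemma cov_vector_trace y : U y ->
  let V0 := cov_vector (-1) th0 g th0 xi y in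
  g y *m V0 + V0^T *m g y = 0 ->
  g y *m V y + (V y)^T *m g y = (2 * ((th y - th0 y) *m xi y) 0 0) *: g y.
Proof.
move=> Uy V0 H0.
pose ga := th y - th0 y; pose al := g y *m xi y.
have gu : g y \in unitmx by rewrite unitmxE unitfE (frame_gU EtE dE).
have ent (M1 : 'M[R]_4) (a c d : 'cV[R]_4) (b : 'rV[R]_4) (s : R) k i :
    (M1 + (a *m b + s *: 1%:M - c *m d^T)) k i =
    M1 k i + (a k 0 * b 0 i + s * (k == i)%:R - c k 0 * d i 0).
  by rewrite !mxE !big_ord1 mxE.
have VE : V y = V0 + (xi y *m ga + (ga *m xi y) 0 0 *: 1%:M
    - (invmx (g y) *m ga^T) *m al^T).
  apply/matrixP => k i; rewrite ent.
  pose C j := 2^-1 * (\sum_l invmx (g y) k l *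
    (pd i (fun z => g z j l) y + pd j (fun z => g z i l) y - pd l (fun z => g z i j) y)).
  pose u (t : 'cV[R]_4 -> 'rV[R]_4) := \sum_l invmx (g y) k l * t y 0 l.
  have S (t : 'cV[R]_4 -> 'rV[R]_4) : \sum_j Gamma g t y k i j * xi y j 0 =
     \sum_j C j * xi y j 0 + t y 0 i * xi y k 0 + (\sum_j t y 0 j * xi y j 0) * (k == i)%:R
     - (\sum_j g y i j * xi y j 0) * u t.
    have d1 : xi y k 0 = \sum_j (k == j)%:R * xi y j 0.
      by rewrite (bigD1 k) //= eqxx mul1r big1 ?addr0 // => j /negbTE jk; rewrite eq_sym jk mul0r.
    rewrite [in RHS]d1 mulr_sumr !mulr_suml -!big_split -sumrB; apply: eq_bigr => j _ /=.
    by rewrite /Gamma -/(C j) -/(u t); move: (C j) (u t) => c w; ring.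
  have -> : (invmx (g y) *m ga^T) k 0 = u th - u th0.
    by rewrite [LHS]mxE /u -sumrB; apply: eq_bigr => l _; rewrite [ga^T _ _]mxE !mxE mulrBr.
  have -> : al i 0 = \sum_j g y i j * xi y j 0 by rewrite [LHS]mxE.
  have -> : (ga *m xi y) 0 0 = \sum_j th y 0 j * xi y j 0 - \sum_j th0 y 0 j * xi y j 0.
    by rewrite [LHS]mxE -sumrB; apply: eq_bigr => l _; rewrite !mxE mulrBl.
  have -> : ga 0 i = th y 0 i - th0 y 0 i by rewrite !mxE.
  have VkE (t : 'cV[R]_4 -> 'rV[R]_4) : cov_vector (-1) th0 g t xi y k i =
      pd i (fun z => xi z k 0) y + -1 * th0 y 0 i * xi y k 0 +
      \sum_j Gamma g t y k i j * xi y j 0 by rewrite [LHS]mxE.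
  rewrite /V /V0 !VkE !S.
  move: (\sum_j C j * _) (u th) (u th0) (\sum_j g y i j * _) => c u1 u2 a.
  move: (\sum_j _) (\sum_j _) (pd _ _ _) => s1 s2 q.
  by ring.
have E1 : g y *m V y = g y *m V0 + (al *m ga + (ga *m xi y) 0 0 *: g y - ga^T *m al^T).
  have gen (h h' M1 : 'M[R]_4) (a a' b' : 'cV[R]_4) (b : 'rV[R]_4) (s : R) : h *m h' = 1%:M ->
      h *m (M1 + (a *m b + s *: 1%:M - (h' *m a') *m b'^T)) =
      h *m M1 + (h *m a *m b + s *: h - a' *m b'^T).
    by move=> hh; rewrite mulmxDr mulmxBr mulmxDr -scalemxAr mulmx1 !mulmxA hh mul1mx.
  by rewrite VE (gen _ _ _ _ _ _ _ _ (mulmxV gu)).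
have gT := frame_gT EtE Uy.
have E2 : (V y)^T *m g y = (g y *m V y)^T by rewrite trmx_mul gT.
have E3 : V0^T *m g y = (g y *m V0)^T by rewrite trmx_mul gT.
rewrite E3 in H0; rewrite E2 E1.
have gen (F h : 'M[R]_4) (a : 'cV[R]_4) (b : 'rV[R]_4) (s : R) : F + F^T = 0 -> h^T = h ->
    F + (a *m b + s *: h - b^T *m a^T) + (F + (a *m b + s *: h - b^T *m a^T))^T = (2 * s) *: h.
  move=> HF hT; rewrite -trmx_mul; move: (a *m b) => K.
  apply/matrixP => i j; move/matrixP/(_ i j): HF; move/matrixP/(_ j i): hT; rewrite !mxE => -> HF.
  by rewrite -(addr0 (2 * s * _)) -HF; ring.
exact: gen.
Qed.

Hypothesis V0skew : forall y, U y ->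
  let V0 := cov_vector (-1) th0 g th0 xi y in g y *m V0 + V0^T *m g y = 0.

Let sg y := ((th y - th0 y) *m xi y) 0 0.

Lemma N_skew y : U y -> conf_skew (sg y) (N y).
Proof.
move=> Uy; apply/conf_skew_mx.
have H := cov_vector_trace Uy (V0skew Uy).
have -> : N y + (N y)^T = (X y)^T *m (g y *m V y + (V y)^T *m g y) *m X y.
  rewrite mulmxDr mulmxDl !mulmxA (frame_XtE EtE dE Uy) /N; congr (_ + _).
  by rewrite !trmx_mul -!mulmxA (frame_gX EtE dE Uy) !mulmxA.
rewrite H -scalemxAr -scalemxAl (frame_XtE EtE dE Uy) (EEi dE Uy) scalemx1.
by [].
Qed.

Lemma asd_endo_frame y : U y -> asd_endo (g y) (V y) = X y *m Kmat (nn^~ y) *m E y.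
Proof.
move=> Uy; rewrite /asd_endo /endo_of_form.
set al := skew_part _.
have gT := frame_gT EtE Uy.
have EX := EEi dE Uy; have XE := EiE dE Uy.
have bE : (X y)^T *m al *m X y = 2^-1 *: ((N y)^T - N y).
  rewrite /al /skew_part /form_of_endo -scalemxAr -scalemxAl; congr (_ *: _).
  rewrite trmx_mul trmxK gT mulmxBr mulmxBl !mulmxA (frame_XtE EtE dE Uy) /N; congr (_ - _).
  by rewrite !trmx_mul -!mulmxA (frame_gX EtE dE Uy) !mulmxA.
have pT m : p m ((X y)^T *m al *m X y) = - p m (N y).
  by rewrite bE /p !mxE; case: m; field.
have F : (X y)^T *m asd_form (g y) al *m X y = - Kmat (nn^~ y).
  rewrite /asd_form -scalemxAr -scalemxAl mulmxBr mulmxBl.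
  rewrite (frame_star EtE dE al Uy) asd_eps4; last first.
    by rewrite bE linearZ linearB /= trmxK -scalerN opprB.
  apply/matrixP => a b; rewrite !mxE !pT.
  by move: (Bu _ _ _) (Bu _ _ _) (Bu _ _ _) => *; ring.
have F' : (asd_form (g y) al)^T = (E y)^T *m Kmat (nn^~ y) *m E y.
  have -> : asd_form (g y) al = (E y)^T *m ((X y)^T *m asd_form (g y) al *m X y) *m E y.
    by rewrite !mulmxA -trmx_mul XE trmx1 mul1mx -mulmxA XE mulmx1.
  by rewrite F !trmx_mul trmxK linearN /= KmatT opprK mulmxA.
rewrite F' (frame_invg EtE dE Uy) !mulmxA -[X y *m _ *m _]mulmxA -trmx_mul EX trmx1 mulmx1.
by [].
Qed.

Let sX : smooth_mx U X. Proof. exact: (smooth_Ei oU sE dE). Qed.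
Let gsm : smooth_mx U g. Proof. exact: (frame_sg oU sE EtE). Qed.

Lemma smooth_V : smooth_mx U V.
Proof.
move=> k i; apply: (smooth_eq oU (f := fun y => pd i (fun z => xi z k 0) y
   + -1 * th0 y 0 i * xi y k 0 + \sum_j Gamma g th y k i j * xi y j 0)).
  by move=> y _; rewrite mxE.
have sG := smooth_Gamma oU gsm sth (frame_gU EtE dE).
repeat first [ exact: sG | exact: sth0 | exact: sxi | apply: smooth_pd | apply: smooth_cst
  | apply: smoothN | apply: smoothD | apply: smoothM
  | apply: smooth_sum; [assumption|move=> ? ?] | assumption].
Qed.

Lemma smooth_N : smooth_mx U N.
Proof. by do 2!apply: smooth_mulmx => //; exact: smooth_V. Qed.

Hypothesis sdW : forall y, U y ->
  forall k l, selfdual_form (g y) (\matrix_(i, j) weyl_tensor g y i j k l).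
Hypothesis ric : forall y, U y -> sym_tracefree_ricci g th y = 0.
Hypothesis sdF0 : forall y, U y -> selfdual_form (g y) (faraday th0 y).

Let x (a : 'I_4) y := \sum_k E y a k * xi y k 0.

Theorem twistor_frame y : U y -> exists zeta : 'I_4 -> R, forall m i,
  pd i (nn m) y - 2 * crs (fun l => ga A l i y) (nn^~ y) m - th0 y 0 i * nn m y
  = B m (e i y) zeta.
Proof.
move=> Uy.
have sA i := smooth_Fc oU sE EtE dE sth i.
have sthf i : smooth_on U (thf th i) by exact: sth.
have sthf0 i : smooth_on U (thf th0 i) by exact: sth0.
have EX y' : U y' -> E y' *m X y' = 1%:M by exact: EEi.
have tors y' : U y' -> forall i j a, cov A i (fr E j) a y' = cov A j (fr E i) a y'.
  by move=> Uy' i j a; exact: (Fc_torsion oU EtE dE).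
have metr y' : U y' -> forall i, conf_skew (thf th i y') (A i y').
  by move=> Uy' i; exact: (Fc_metric oU sE EtE dE).
have sx a : smooth_on U (x a) by rewrite /x; sm.
have ssg : smooth_on U sg.
  apply: (smooth_eq oU (f := fun y => \sum_i (th y 0 i - th0 y 0 i) * xi y i 0)).
    by move=> y' _; rewrite /sg !mxE; apply: eq_bigr => i _; rewrite !mxE.
  by sm.
have hN y' : U y' -> forall i a,
    cov A i x a y' = act (N y') (e i y') a + thf th0 i y' * x a y'.
  move=> Uy' i a.
  have xE : (fun z => x a z) = (fun z => (E z *m xi z) a 0).
    by apply/funext => z; rewrite mxE.
  have -> : cov A i x a y' = (dmx i (fun z => E z *m xi z) y' + A i y' *m (E y' *m xi y')) a 0.
    rewrite [RHS]mxE [X in _ = X + _]mxE -xE /cov; congr (_ + _).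
    rewrite [RHS]mxE /act; apply: eq_bigr => b _; congr (_ * _).
    by rewrite [RHS]mxE.
  have -> : act (N y') (e i y') a = (E y' *m V y') a i.
    by rewrite -[E y' *m V y']mulmx1 -(EiE dE Uy') mulmxA [RHS]mxE.
  have -> : thf th0 i y' * x a y' = (th0 y' 0 i *: (E y' *m xi y')) a 0 by rewrite !mxE.
  rewrite (dmxM oU i Uy' sE sxi) mulmxA (Fc_E g dE th i Uy').
  have VE : col i (V y') = dmx i xi y' - th0 y' 0 i *: xi y' + Gm g th i y' *m xi y'.
    apply/matrixP => k c; rewrite ord1 !mxE mulN1r mulNr; congr (_ + _).
    by apply: eq_bigr => j _; rewrite !mxE.
  have -> : (E y' *m V y') a i = (E y' *m col i (V y')) a 0.
    by rewrite colE mulmxA -colE [RHS]mxE.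
  have mxD (M1 M2 : 'cV[R]_4) : M1 a 0 + M2 a 0 = (M1 + M2) a 0 by rewrite mxE.
  rewrite mxD VE mulmxBl !mulmxDr mulmxN -scalemxAr !mulmxA.
  apply: (congr1 (fun M : 'cV[R]_4 => M a 0)).
  move: (dmx i E y' *m _) (E y' *m dmx i xi y') (E y' *m xi y') (_ *m _ *m xi y') => M1 M2 M3 M4.
  by apply/matrixP => b c; rewrite !mxE; ring.
pose S y := p T1 ((X y)^T *m (\matrix_(i, j) Om (ga A) T1 i j y) *m X y).
have hOm y' : U y' -> forall m i j, Om (ga A) m i j y' = S y' * B m (e i y') (e j y').
  by move=> Uy' m i j; rewrite (asd_curvature_scalar oU sE sth EtE dE sdW ric).
pose G y := 2 *: Fh E th y - Fh E th0 y.
have hG y' : U y' -> forall i j,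
  2 * (pd i (thf th j) y' - pd j (thf th i) y') - (pd i (thf th0 j) y' - pd j (thf th0 i) y') =
  dot (e i y') (act (G y') (e j y')).
  move=> Uy' i j; rewrite !(faraday_frame _ dE) //.
  rewrite /dot /act mulr_sumr -sumrB; apply: eq_bigr => a _.
  have GE b : G y' a b = 2 * Fh E th y' a b - Fh E th0 y' a b.
    by rewrite /G [LHS]mxE [X in X + _]mxE [X in _ + X]mxE.
  rewrite !mulr_sumr -sumrB; apply: eq_bigr => b _; rewrite GE.
  by move: (Fh _ _ _ _ _) (Fh _ _ _ _ _) => *; ring.
have aF t y' : (Fh E t y')^T = - Fh E t y'.
  rewrite /Fh !trmx_mul trmxK mulmxA -mulNmx -mulmxN; congr (_ *m _ *m _).
  by apply/matrixP => i j; rewrite !mxE opprB.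
have aG y' : U y' -> forall a b, G y' a b = - G y' b a.
  have gen (F F' : 'M[R]_4) : F^T = - F -> F'^T = - F' ->
      forall a b, (2 *: F - F') a b = - (2 *: F - F') b a.
    by move=> h1 h2 a b; move/matrixP/(_ b a): h1; move/matrixP/(_ b a): h2; rewrite !mxE => -> ->; ring.
  by move=> Uy' a b; exact: gen.
have pG y' : U y' -> forall m, p m (G y') = 0.
  move=> Uy' m; rewrite /G pD pN pZ (selfdual_faraday_ew oU sE sth EtE dE sdW ric) //.
  by rewrite (selfdual_p EtE dE m Uy' (sdF0 Uy')) mulr0 subr0.
have [zeta Hz] := twistor_equation oU sE sA sthf EX tors metr ssg sx sthf0 smooth_N
  hOm hN (fun y' Uy' => N_skew Uy') hG aG pG Uy.
by exists zeta => m i; rewrite -Hz /nab /thf; ring.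
Qed.

End LocalTheorem.

Lemma p_Kmat (R : realType) (k : tri -> R) m : p m (Kmat k) = k m.
Proof. by rewrite /p; case: m; rewrite !mxE /Bu /B /unit4 /=; field. Qed.

Section ParallelJ.
Context {R : realType}.
Variables (U : set 'cV[R]_4) (oU : open U).
Variables (g E : 'cV[R]_4 -> 'M[R]_4) (th th0 : 'cV[R]_4 -> 'rV[R]_4) (xi : 'cV[R]_4 -> 'cV[R]_4).
Hypotheses (sE : smooth_mx U E) (sth : smooth_mx U th) (sth0 : smooth_mx U th0)
  (sxi : smooth_mx U xi)
  (EtE : forall y, U y -> (E y)^T *m E y = g y) (dE : forall y, U y -> \det (E y) = 1).
Hypothesis V0skew : forall y, U y ->
  let V0 := cov_vector (-1) th0 g th0 xi y in g y *m V0 + V0^T *m g y = 0.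
Hypothesis sdW : forall y, U y ->
  forall k l, selfdual_form (g y) (\matrix_(i, j) weyl_tensor g y i j k l).
Hypothesis ric : forall y, U y -> sym_tracefree_ricci g th y = 0.
Hypothesis sdF0 : forall y, U y -> selfdual_form (g y) (faraday th0 y).
Variables (tau : 'cV[R]_4 -> R) (J : 'cV[R]_4 -> 'M[R]_4).
Hypotheses (stau : smooth_on U tau) (tau0 : forall y, U y -> tau y != 0) (sJ : smooth_mx U J)
  (JJ : forall y, U y -> J y *m J y = - 1%:M)
  (tJ : forall y, U y -> asd_endo (g y) (cov_vector (-1) th0 g th xi y) = tau y *: J y).

Local Notation X := (Ei E).
Local Notation e j y := (fun a => fr E j a y).

Definition kahler_form_th y := th y - (tau y)^-1 *: dens_deriv (-1) th0 tau y.
Local Notation th' := kahler_form_th.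
Let N y := E y *m cov_vector (-1) th0 g th xi y *m X y.
Let k m y := (tau y)^-1 * p m (N y).

Let sk m : smooth_on U (k m).
Proof.
have sN := smooth_N oU sE sth sth0 sxi EtE dE.
have sti : smooth_on U (fun y => (tau y)^-1) by apply: (smoothV oU).
by apply: (smoothM oU sti); apply: (smooth_p oU m); exact: (smooth_N oU sE sth sth0 sxi EtE dE).
Qed.

Lemma J_frame y : U y -> E y *m J y = Kmat (k^~ y) *m E y.
Proof.
move=> Uy; have := asd_endo_frame th th0 xi EtE dE Uy; rewrite tJ // => H.
have -> : J y = (tau y)^-1 *: (X y *m Kmat (fun m => p m (N y)) *m E y).
  by rewrite -H scalerA mulVf ?scale1r ?tau0.
rewrite -scalemxAr !mulmxA (EEi dE Uy) mul1mx scalemxAl; congr (_ *m _).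
apply/matrixP => a b; rewrite !mxE /k.
by move: (p _ _) (p _ _) (p _ _) (Bu _ _ _) (Bu _ _ _) (Bu _ _ _) => *; ring.
Qed.

Lemma k_unit y : U y -> k T1 y ^+ 2 + k T2 y ^+ 2 + k T3 y ^+ 2 = 1.
Proof.
move=> Uy; have H := J_frame Uy.
have : E y *m (J y *m J y) = Kmat (k^~ y) *m Kmat (k^~ y) *m E y.
  by rewrite mulmxA H -mulmxA H mulmxA.
rewrite JJ // Kmat_sqr mulmxN mulNmx mulmx1 => /oppr_inj.
rewrite mul_scalar_mx => H2.
have : E y *m X y = (k T1 y ^+ 2 + k T2 y ^+ 2 + k T3 y ^+ 2) *: (E y *m X y).
  by rewrite scalemxAl -H2.
rewrite (EEi dE Uy) scalemx1 => /matrixP/(_ o0 o0); rewrite mxE [RHS]mxE eqxx !mulr1n => <-.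
by [].
Qed.

Lemma J_orthogonal y : U y -> (J y)^T *m g y *m J y = g y.
Proof.
move=> Uy; rewrite -(EtE Uy) !mulmxA -trmx_mul -mulmxA (J_frame Uy).
rewrite trmx_mul KmatT mulmxN mulNmx mulmxA -[_ *m _ *m Kmat _]mulmxA Kmat_sqr k_unit //.
by rewrite mulmxN mulmx1 mulNmx opprK.
Qed.

Let smooth_th' : smooth_mx U th'.
Proof.
move=> a i; rewrite ord1.
apply: (smooth_eq oU (f := fun y => th y 0 i -
   (tau y)^-1 * (pd i tau y + -1 * tau y * th0 y 0 i))).
  by move=> y _; rewrite !mxE.
have sti : smooth_on U (fun y => (tau y)^-1) by apply: (smoothV oU).
by sm.
Qed.

Theorem k_parallel y m i : U y ->
  pd i (k m) y = 2 * crs (fun l => ga (Fc g E th') l i y) (k^~ y) m.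
Proof.
move=> Uy.
have [z Hz] := twistor_frame oU sE sth sth0 sxi EtE dE V0skew sdW ric sdF0 Uy.
pose dl i := th' y 0 i - th y 0 i.
pose d a := \sum_i dl i * X y i a.
have t0 := tau0 Uy.
have dlE j : tau y * dl j = - (pd j tau y - tau y * th0 y 0 j).
  rewrite /dl !mxE; move: (pd j tau y) (th0 y 0 j) (th y 0 j) => a b c.
  by field.
have eq1 l j : tau y * (pd j (k l) y - 2 * crs (fun q => ga (Fc g E th) q j y) (k^~ y) l)
    - tau y * dl j * k l y = B l (e j y) z.
  rewrite -Hz dlE.
  have -> : pd j (fun y0 => p l (E y0 *m cov_vector (-1) th0 g th xi y0 *m Ei E y0)) y =
     pd j tau y * k l y + tau y * pd j (k l) y.
    rewrite -(pdM j Uy stau (sk l)) ; apply: (pd_eq j oU Uy) => w Uw.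
    by rewrite /k mulrA mulfV ?mul1r ?tau0.
  have pk q : p q (E y *m cov_vector (-1) th0 g th xi y *m Ei E y) = tau y * k q y.
    by rewrite /k mulrA mulfV ?mul1r.
  rewrite /crs !pk.
  move: (pd j (k l) y) (pd j tau y) (th0 y 0 j) (tau y) (k^~ y) => a1 a2 a3 a4 a5.
  move: (ga _ _ _ _) (ga _ _ _ _) => *; ring.
have kk j : k T1 y * pd j (k T1) y + k T2 y * pd j (k T2) y + k T3 y * pd j (k T3) y = 0.
  have : pd j (fun z => k T1 z * k T1 z + k T2 z * k T2 z + k T3 z * k T3 z) y = 0.
    rewrite -(pd_cst (1 : R) y j); apply: (pd_eq j oU Uy) => w Uw.
    by rewrite -(k_unit Uw) !expr2.
  have sq l : smooth_on U (fun z => k l z * k l z) by apply: (smoothM oU).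
  have dq l : pd j (fun z => k l z * k l z) y = pd j (k l) y * k l y + k l y * pd j (k l) y.
    exact: (pdM j Uy (sk l) (sk l)).
  have d1 := pdD j Uy (smoothD oU (sq T1) (sq T2)) (sq T3); have d2 := pdD j Uy (sq T1) (sq T2).
  move=> h; have := etrans (esym d1) h; rewrite d2 !dq.
  by move: (pd j (k T1) y) (pd j (k T2) y) (pd j (k T3) y) => a1 a2 a3 {}h; lra.
have eq2 j : - tau y * dl j = k T1 y * B T1 (e j y) z + k T2 y * B T2 (e j y) z
    + k T3 y * B T3 (e j y) z.
  have := kk j; rewrite -!eq1 /crs /=.
  have := k_unit Uy.
  move: (k T1 y) (k T2 y) (k T3 y) (pd j (k T1) y) (pd j (k T2) y) (pd j (k T3) y).
  move: (ga _ _ _ _) (ga _ _ _ _) (ga _ _ _ _) (tau y) (dl j).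
  move=> g1 g2 g3 t D k1 k2 k3 d1 d2 d3 h1 h2.
  have -> : - t * D = - t * D * (k1 ^+ 2 + k2 ^+ 2 + k3 ^+ 2)
     + t * (k1 * d1 + k2 * d2 + k3 * d3) by rewrite h1 h2; ring.
  by ring.
have dE' j : dot d (e j y) = dl j.
  exact: (dot_hat (EEi dE Uy)).
have eq3 a : - tau y * d a = k T1 y * B T1 (unit4 a) z + k T2 y * B T2 (unit4 a) z
    + k T3 y * B T3 (unit4 a) z.
  have da : d a = dot d (unit4 a).
    rewrite /dot (bigD1 a) //= /unit4 eqxx mulr1 big1 ?addr0 // => b /negbTE ba.
    by rewrite eq_sym ba mulr0.
  apply/eqP; rewrite da -subr_eq0; apply/eqP.
  have := @lin_ext _ _ _ (EEi dE Uy) (fun u => - tau y * dot d u - (k T1 y * B T1 u z + k T2 y * B T2 u z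
    + k T3 y * B T3 u z)); apply; first by linear_tac.
  by move=> j; rewrite dE' eq2 subrr.
have := @kahler_algebra R (fun q => k q y) (tau y) d z (e i y) t0 (k_unit Uy) eq3 m.
rewrite -eq1 -/(dot d (e i y)) dE' => H.
have ga' l : ga (Fc g E th') l i y = ga (Fc g E th) l i y + 2^-1 * B l (e i y) d.
  rewrite (ga_shift th' EtE dE l i Uy) (ga_shift th EtE dE l i Uy).
  rewrite -addrA -mulrDr -B_linearr; congr (_ + _ * B l _ _).
  apply/funext => a; rewrite /d -big_split; apply: eq_bigr => j _ /=.
  by rewrite /dl; move: (th' y 0 j) (th y 0 j) (X y j a) => *; ring.
have -> : crs (fun l => ga (Fc g E th') l i y) (k^~ y) m =
    crs (fun l => ga (Fc g E th) l i y) (k^~ y) m + 2^-1 * crs (fun l => B l (e i y) d) (k^~ y) m.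
  by rewrite /crs !ga'; move: (ga _ _ _ _) (ga _ _ _ _) (B _ _ _) (B _ _ _) => *; ring.
have fin (t q D c1 c2 kk' : R) : t != 0 -> t * (D * kk' - c2) + (t * (q - 2 * c1) - t * D * kk') = 0 ->
    q = 2 * (c1 + 2^-1 * c2).
  move=> tn h; apply: (mulfI tn); apply/eqP; rewrite -subr_eq0 -[X in _ == X]h; apply/eqP;
  by field.
exact: fin t0 H.
Qed.

Theorem J_parallel y i l m : U y -> cov_endo g th' J y i l m = 0.
Proof.
move=> Uy; pose K z := Kmat (k^~ z).
have sK : smooth_mx U K.
  move=> a b; apply: (smooth_eq oU (f := fun z =>
    k T1 z * Bu T1 a b + k T2 z * Bu T2 a b + k T3 z * Bu T3 a b)).
    by move=> z _; rewrite mxE.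
  by sm.
have dK : dmx i K y = Kmat (fun m => pd i (k m) y).
  apply/matrixP => a b; rewrite mxE [RHS]mxE.
  have sc l' : smooth_on U (fun z => k l' z * Bu l' a b) by sm.
  have dc l' : pd i (fun z => k l' z * Bu l' a b) y = pd i (k l') y * Bu l' a b.
    have h := pdM i Uy (sk l') (smooth_cst U (Bu l' a b)).
    by rewrite pd_cst mulr0 addr0 in h.
  have d1 := pdD i Uy (smoothD oU (sc T1) (sc T2)) (sc T3); have d2 := pdD i Uy (sc T1) (sc T2).
  rewrite -!dc -d2; apply: etrans _ d1; apply: (pd_eq i oU Uy) => z _.
  by rewrite mxE.
have H1 : dmx i E y *m J y + E y *m dmx i J y = dmx i K y *m E y + K y *m dmx i E y.
  rewrite -!(dmxM oU i Uy) //; apply: (dmx_eq oU i Uy) => z Uz.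
  exact: J_frame.
have A'E := Fc_E g dE th' i Uy.
have skA := Fc_metric oU sE EtE dE th' i Uy.
have H2 : dmx i K y + Fc g E th' i y *m K y - K y *m Fc g E th' i y = 0.
  rewrite -addrA (Kmat_bracket _ skA) dK.
  apply/matrixP => a b; rewrite !mxE !(k_parallel _ _ Uy).
  by move: (crs _ _ _) (crs _ _ _) (crs _ _ _) => *; ring.
have H3 : E y *m (dmx i J y + Gm g th' i y *m J y - J y *m Gm g th' i y) = 0.
  have e1 : E y *m Gm g th' i y = Fc g E th' i y *m E y + dmx i E y by rewrite A'E subrK.
  have gen (E1 dE1 J1 dJ K1 dK1 G1 A1 : 'M[R]_4) : E1 *m J1 = K1 *m E1 ->
      E1 *m G1 = A1 *m E1 + dE1 -> dE1 *m J1 + E1 *m dJ = dK1 *m E1 + K1 *m dE1 ->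
      E1 *m (dJ + G1 *m J1 - J1 *m G1) = (dK1 + A1 *m K1 - K1 *m A1) *m E1.
    move=> h1 h2 h3; rewrite mulmxBr mulmxDr !mulmxA h1 h2 -[K1 *m E1 *m G1]mulmxA h2.
    have -> : E1 *m dJ = dK1 *m E1 + K1 *m dE1 - dE1 *m J1 by rewrite -h3 addrC addKr.
    rewrite mulmxDl -[A1 *m E1 *m J1]mulmxA h1; mx_abel.
  rewrite (gen _ _ _ _ _ _ _ _ (J_frame Uy) e1 H1).
  by rewrite H2 mul0mx.
have : dmx i J y + Gm g th' i y *m J y - J y *m Gm g th' i y = 0.
  by rewrite -[LHS]mul1mx -(EiE dE Uy) -mulmxA H3 mulmx0.
have ent (M1 M2 M3 M4 M5 : 'M[R]_4) : (M1 + M2 *m M3 - M4 *m M5) l m =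
    M1 l m + \sum_j M2 l j * M3 j m - \sum_j M4 l j * M5 j m by rewrite !mxE.
move=> /matrixP/(_ l m); rewrite ent [RHS]mxE => <-.
rewrite /cov_endo; congr (_ + _ - _); first by rewrite [RHS]mxE.
  by apply: eq_bigr => j _; rewrite [Gm _ _ _ _ _ _]mxE.
by apply: eq_bigr => j _; rewrite [Gm _ _ _ _ _ _]mxE.
Qed.

End ParallelJ.

Section DirectionalDerivative.
Context {R : realType} {n : nat}.
Variables (U : set 'cV[R]_n) (oU : open U).
Implicit Types (y v w : 'cV[R]_n).

Definition dvx p q v (M : 'cV[R]_n -> 'M[R]_(p, q)) y : 'M[R]_(p, q) :=
  \sum_k v k 0 *: dmx k M y.

Lemma dvxM p q r v (M : 'cV[R]_n -> 'M[R]_(p, q)) (N : 'cV[R]_n -> 'M[R]_(q, r)) y :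
  U y -> smooth_mx U M -> smooth_mx U N ->
  dvx v (fun z => M z *m N z) y = dvx v M y *m N y + M y *m dvx v N y.
Proof.
move=> Uy sM sN; rewrite /dvx mulmx_suml mulmx_sumr -big_split; apply: eq_bigr => k _ /=.
by rewrite (dmxM oU k Uy) // scalerDr -scalemxAl -scalemxAr.
Qed.

Lemma dvxB p q v (M N : 'cV[R]_n -> 'M[R]_(p, q)) y :
  U y -> smooth_mx U M -> smooth_mx U N ->
  dvx v (fun z => M z - N z) y = dvx v M y - dvx v N y.
Proof.
move=> Uy sM sN; rewrite /dvx -sumrB; apply: eq_bigr => k _ /=.
by rewrite (dmxB oU k Uy) // scalerBr.
Qed.

Lemma dvxT p q v (M : 'cV[R]_n -> 'M[R]_(p, q)) y :
  U y -> dvx v (fun z => (M z)^T) y = (dvx v M y)^T.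
Proof.
move=> Uy; rewrite /dvx linear_sum; apply: eq_bigr => k _ /=.
by rewrite (dmxT oU k _ Uy) linearZ.
Qed.

Lemma dvx_eq p q v (M N : 'cV[R]_n -> 'M[R]_(p, q)) y : U y ->
  (forall z, U z -> M z = N z) -> dvx v M y = dvx v N y.
Proof.
by move=> Uy MN; apply: eq_bigr => k _; rewrite (dmx_eq oU k Uy MN).
Qed.

Lemma jac_mul m (f : 'cV[R]_n -> 'cV[R]_m) y v : jac f y *m v = dvx v f y.
Proof.
apply/matrixP => a b; rewrite ord1 mxE summxE; apply: eq_bigr => k _.
by rewrite !mxE mulrC.
Qed.

(* the linear combination of the connection matrices along a vector *)
Definition Gv (G : 'I_n -> 'M[R]_n) v : 'M[R]_n := \sum_k v k 0 *: G k.

Lemma Gv_sym (G : 'I_n -> 'M[R]_n) v w :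
  (forall i j k, G i k j = G j k i) -> Gv G v *m w = Gv G w *m v.
Proof.
move=> Gs; rewrite /Gv !mulmx_suml; apply/matrixP => k c; rewrite ord1 !summxE.
under eq_bigr do rewrite -scalemxAl mxE mxE mulr_sumr.
rewrite exchange_big /=; apply: eq_bigr => i _.
rewrite -scalemxAl mxE mxE mulr_sumr; apply: eq_bigr => j _.
by rewrite Gs; move: (G _ _ _) (v _ _) (w _ _) => *; ring.
Qed.

(** A torsion-free connection for which J is parallel expresses the Nijenhuis tensor of J
    through its torsion. *)
Lemma nijenhuis_parallel (J : 'cV[R]_n -> 'M[R]_n) (G : 'I_n -> 'M[R]_n) X Y y : U y ->
  smooth_mx U J -> smooth_mx U X -> smooth_mx U Y ->
  (forall i j k, G i k j = G j k i) -> J y *m J y = - 1%:M ->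
  (forall i, dmx i J y = J y *m G i - G i *m J y) -> nijenhuis J X Y y = 0.
Proof.
move=> Uy sJ sX sY Gs JJ dJ.
have dJv v : dvx v J y = J y *m Gv G v - Gv G v *m J y.
  rewrite /dvx /Gv mulmx_sumr mulmx_suml -sumrB; apply: eq_bigr => k _.
  by rewrite dJ scalerBr -scalemxAr -scalemxAl.
rewrite /nijenhuis /lie_bracket !jac_mul !(dvxM _ Uy sJ) // !dJv -!jac_mul.
have S v w := Gv_sym v w Gs.
have JJm (v : 'cV[R]_n) : J y *m (J y *m v) = - v by rewrite mulmxA JJ mulNmx mul1mx.
rewrite ?(mulmxBl, mulmxBr, mulmxDr, mulmxDl, mulNmx, mulmxN) -?mulmxA.
rewrite ?(mulmxBr, mulmxDr, mulmxN) -?mulmxA !JJm ?mulmxN.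
rewrite (S (J y *m X y) (J y *m Y y)) (S (J y *m X y) (Y y)) (S (J y *m Y y) (X y)) (S (Y y) (X y)).
repeat match goal with |- context [@mulmx ?R ?m ?n ?p ?A ?B] =>
    let x := fresh "x" in move: (@mulmx _ m n p A B) => x end.
by apply/matrixP => ? ?; rewrite ?mxE; ring.
Qed.

End DirectionalDerivative.

(** The Lie derivative along xi of the metric on the orthogonal complement of xi, from the
    Weyl connection. *)
Lemma lie_orthogonal_metric (F : comNzRingType) (n : nat) (g GG V jx Dg : 'M[F]_n) (x a Da : 'cV[F]_n)
    (t : 'rV[F]_n) (s : F) :
  g^T = g -> V = jx - x *m t + GG -> Dg = GG^T *m g + g *m GG - (2 * s) *: g ->
  a = g *m x -> Da = Dg *m x + g *m (jx *m x) -> V *m x = 0 -> a^T *m V = 0 ->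
  a^T *m x = 1%:M -> t *m x = s%:M ->
  Dg - (Da *m a^T + a *m Da^T) + jx^T *m (g - a *m a^T) + (g - a *m a^T) *m jx =
  g *m V + V^T *m g - (2 * s) *: (g - a *m a^T).
Proof.
move=> gT VE DgE aE DaE Vx aV ax tx.
have jE : jx = V + x *m t - GG by rewrite VE; apply/matrixP => i j; rewrite !mxE; ring.
have aT : a^T = x^T *m g by rewrite aE trmx_mul gT.
have jxx : jx *m x = s *: x - GG *m x.
  by rewrite jE mulmxBl mulmxDl Vx add0r -mulmxA tx mul_mx_scalar.
have DaE2 : Da = GG^T *m a - s *: a.
  rewrite DaE jxx DgE mulmxBr -scalemxAr mulmxBl mulmxDl -scalemxAl -!mulmxA -!aE.
  move: (GG^T *m a) (g *m (GG *m x)) => b c; apply/matrixP => i j; rewrite !mxE; ring.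
have jT : jx^T = V^T + t^T *m x^T - GG^T.
  by rewrite jE linearB linearD /= trmx_mul.
have jxa : jx^T *m a = t^T - GG^T *m a.
  rewrite jT mulmxBl mulmxDl -mulmxA.
  have -> : V^T *m a = 0 by rewrite -[LHS]trmxK trmx_mul trmxK aV trmx0.
  have -> : x^T *m a = 1%:M by rewrite -[LHS]trmxK trmx_mul trmxK ax trmx1.
  by rewrite mulmx1 add0r.
have jg : jx^T *m g = V^T *m g + t^T *m a^T - GG^T *m g.
  by rewrite jT mulmxBl mulmxDl -mulmxA -aT.
have gj : g *m jx = g *m V + a *m t - g *m GG.
  by rewrite jE mulmxBr mulmxDr mulmxA -aE.
have ajx : a^T *m jx = t - (GG^T *m a)^T.
  by rewrite -[LHS]trmxK trmx_mul trmxK jxa linearB /= trmxK.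
have DaT : Da^T = (GG^T *m a)^T - s *: a^T by rewrite DaE2 linearB linearZ.
rewrite mulmxBr mulmxBl mulmxA -[a *m a^T *m jx]mulmxA jxa ajx jg gj DgE DaT DaE2.
rewrite !mulmxBl !mulmxBr -scalemxAl -scalemxAr.
repeat match goal with |- context [@mulmx ?R ?m ?n ?p ?A ?B] =>
    let x := fresh "x" in move: (@mulmx _ m n p A B) => x end.
by apply/matrixP => i j; rewrite !mxE; ring.
Qed.

Section Submersion.
Context {R : realType} {n : nat}.
Variables (U : set 'cV[R]_n.+1) (oU : open U) (n0 : (0 < n)%N).
Variables (g : 'cV[R]_n.+1 -> 'M[R]_n.+1) (th : 'cV[R]_n.+1 -> 'rV[R]_n.+1)
  (xi : 'cV[R]_n.+1 -> 'cV[R]_n.+1).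
Hypotheses (sg : smooth_mx U g) (sth : smooth_mx U th) (sxi : smooth_mx U xi)
  (gT : forall y, U y -> (g y)^T = g y) (gU : forall y, U y -> \det (g y) != 0).
Hypothesis unit_xi : forall y, U y -> ((xi y)^T *m g y *m xi y) 0 0 = 1.
Let V y := cov_vector (-1) th g th xi y.
Hypotheses (Vxi : forall y, U y -> V y *m xi y = 0) (trV : forall y, U y -> \tr (V y) = 0).
Variables (W : set 'cV[R]_n) (oW : open W) (phi : 'cV[R]_n.+1 -> 'cV[R]_n)
  (h : 'cV[R]_n -> 'M[R]_n).
Hypotheses (sphi : smooth_mx U phi) (sh : smooth_mx W h) (UW : forall y, U y -> W (phi y)).
Hypothesis Pxi : forall y, U y -> jac phi y *m xi y = 0.
Hypothesis conf : forall y, U y -> exists2 mu : R, 0 < mu & forall v w : 'cV[R]_n.+1,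
  (v^T *m g y *m xi y) 0 0 = 0 -> (w^T *m g y *m xi y) 0 0 = 0 ->
  ((jac phi y *m v)^T *m h (phi y) *m (jac phi y *m w)) 0 0 = mu * (v^T *m g y *m w) 0 0.

Local Notation P := (jac phi).
Let al y := g y *m xi y.
Let q y := (P y)^T *m h (phi y) *m P y.
Let Q y := g y - al y *m (al y)^T.
Let mu y := n%:R^-1 * \tr (invmx (g y) *m q y).

Let g1 y : U y -> g y \in unitmx. Proof. by move=> Uy; rewrite unitmxE unitfE gU. Qed.

Lemma alT_xi y : U y -> (al y)^T *m xi y = 1%:M.
Proof.
by move=> Uy; apply/matrixP => i j; rewrite !ord1 trmx_mul gT // unit_xi // mxE eqxx.
Qed.

Lemma tr_invQ y : U y -> \tr (invmx (g y) *m Q y) = n%:R.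
Proof.
move=> Uy; rewrite /Q mulmxBr mulVmx ?g1 // linearB /= mxtrace1 [invmx _ *m (_ *m _)]mulmxA mxtrace_mulC.
have -> : invmx (g y) *m al y = xi y by rewrite /al mulKmx // g1.
rewrite (alT_xi Uy) mxtrace1.
by rewrite -[n.+1]addn1 natrD addrK.
Qed.

Lemma pullback_metric y : U y -> 0 < mu y /\ q y = mu y *: Q y.
Proof.
move=> Uy; have [m0 m0_gt0 Hm] := conf Uy.
pose Pi : 'M[R]_n.+1 := 1%:M - xi y *m (al y)^T.
have xg : (xi y)^T *m g y = (al y)^T by rewrite trmx_mul gT.
have PPi : P y *m Pi = P y by rewrite mulmxBr mulmx1 mulmxA Pxi // mul0mx subr0.
have aPi : (al y)^T *m Pi = 0.
  by rewrite mulmxBr mulmx1 mulmxA (alT_xi Uy) mul1mx subrr.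
have gPi : Pi^T *m g y *m Pi = Q y.
  have -> : Pi^T = 1%:M - al y *m (xi y)^T by rewrite /Pi linearB /= trmx1 trmx_mul trmxK.
  rewrite -mulmxA; have -> : g y *m Pi = Q y by rewrite /Pi /Q mulmxBr mulmx1 mulmxA.
  rewrite mulmxBl mul1mx -mulmxA; have -> : (xi y)^T *m Q y = 0.
    have xa : (xi y)^T *m al y = 1%:M by rewrite {1}/al mulmxA xg (alT_xi Uy).
    by rewrite /Q mulmxBr xg mulmxA xa mul1mx subrr.
  by rewrite mulmx0 subr0.
have orth (v : 'cV[R]_n.+1) : ((Pi *m v)^T *m g y *m xi y) 0 0 = 0.
  have -> : (Pi *m v)^T *m g y *m xi y = ((al y)^T *m (Pi *m v))^T.
    by rewrite [RHS]trmx_mul trmxK -mulmxA.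
  by rewrite mulmxA aPi mul0mx trmx0 mxE.
have ent (M : 'M[R]_n.+1) i j : ((delta_mx i 0 : 'cV[R]_n.+1)^T *m M *m delta_mx j (0 : 'I_1)) 0 0 = M i j.
  by rewrite trmx_delta -rowE -colE !mxE.
have qQ : q y = m0 *: Q y.
  apply/matrixP => i j; rewrite [RHS]mxE.
  have := Hm (Pi *m delta_mx i 0) (Pi *m delta_mx j 0) (orth _) (orth _).
  have -> (v w : 'cV[R]_n.+1) : (Pi *m v)^T *m g y *m (Pi *m w) = v^T *m Q y *m w.
    by rewrite -gPi trmx_mul !mulmxA.
  have -> (v w : 'cV[R]_n.+1) : (P y *m (Pi *m v))^T *m h (phi y) *m (P y *m (Pi *m w)) =
      v^T *m q y *m w.
    by rewrite !(mulmxA (P y) Pi) PPi /q trmx_mul !mulmxA.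
  by rewrite !ent.
have mE : mu y = m0.
  rewrite /mu qQ -scalemxAr linearZ /= tr_invQ // mulrCA mulVf ?mulr1 //.
  by rewrite pnatr_eq0 -lt0n.
by rewrite mE.
Qed.

Let sP : smooth_mx U P.
Proof.
move=> i j; apply: (smooth_eq oU (f := pd j (fun z => phi z i 0))) => [z _|]; first by rewrite mxE.
by apply: smooth_pd => //; exact: sphi.
Qed.

Let sH : smooth_mx U (fun z => h (phi z)).
Proof. by move=> i j; exact: (smooth_comp oU oW UW sphi (sh i j)). Qed.

(** The pull-back of the metric of the base is invariant along the fibres. *)
Lemma dvx_pullback y : U y -> dvx (xi y) q y = - ((jac xi y)^T *m q y) - q y *m jac xi y.
Proof.
move=> Uy.
have dP : dvx (xi y) P y = - (P y *m jac xi y).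
  apply/matrixP => a i; rewrite summxE [RHS]mxE.
  have -> : (P y *m jac xi y) a i = \sum_k pd k (fun z => phi z a 0) y * pd i (fun z => xi z k 0) y.
    by rewrite mxE; apply: eq_bigr => k _; rewrite !mxE.
  pose f k z := pd k (fun z => phi z a 0) z * xi z k 0.
  have sf k : smooth_on U (f k).
    by apply: (smoothM oU); [apply: smooth_pd => //; exact: sphi|exact: sxi].
  have : pd i (fun z => \sum_k f k z) y = 0.
    rewrite -[RHS](pd_cst (0 : R) y i); apply: (pd_eq i oU Uy) => z Uz.
    apply: (@etrans _ _ ((P z *m xi z) a 0)); last by rewrite Pxi // mxE.
    by rewrite [RHS]mxE; apply: eq_bigr => k _; rewrite mxE.
  rewrite (pd_sum oU i Uy _ sf) => H.
  apply/eqP; rewrite -addr_eq0; apply/eqP; rewrite -[RHS]H -big_split /=.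
  apply: eq_bigr => k _.
  have -> : pd i (f k) y = pd i (pd k (fun z => phi z a 0)) y * xi y k 0
      + pd k (fun z => phi z a 0) y * pd i (fun z => xi z k 0) y.
    apply: (pdM i Uy); last exact: sxi.
    by apply: smooth_pd => //; exact: sphi.
  congr (_ + _); rewrite mxE mulrC; congr (_ * _); rewrite mxE.
  rewrite (pd_pdC oU i Uy) ; last exact: sphi.
  by apply: (pd_eq k oU Uy) => z _; rewrite mxE.
have dH : dvx (xi y) (fun z => h (phi z)) y = 0.
  apply/matrixP => a b; rewrite summxE [RHS]mxE.
  have E k : dmx k (fun z => h (phi z)) y a b = \sum_c pd c (fun z => h z a b) (phi y) * P y c k.
    rewrite mxE; have [_ ->] := @chain_rule R _ _ U W (fun z => h z a b) phi y k oU oW Uy (UW Uy)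
      (sh a b 1%N) (fun j => sphi j 0 1%N).
    by apply: eq_bigr => c _; rewrite mxE.
  under eq_bigr do rewrite mxE E mulr_sumr.
  rewrite exchange_big big1 // => c _.
  have := Pxi Uy => /matrixP/(_ c 0); rewrite mxE [RHS]mxE => H.
  apply: (@etrans _ _ (pd c (fun z => h z a b) (phi y) * 0)); last by rewrite mulr0.
  rewrite -[in RHS]H mulr_sumr; apply: eq_bigr => k _.
  by move: (pd _ _ _) (P y c k) (xi y k 0) => *; ring.
have sPT : smooth_mx U (fun z => (P z)^T) by apply: smooth_mxT.
rewrite /q (dvxM oU _ Uy (smooth_mulmx oU sPT sH) sP) (dvxM oU _ Uy sPT sH) dH (dvxT oU _ _ Uy) dP.
rewrite mulmx0 addr0 linearN /= trmx_mul mulNmx mulNmx mulmxN !mulmxA.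
by [].
Qed.

Local Notation GG y := (Gv (Gm g th ^~ y) (xi y)).

Lemma cov_vector_jac y : U y -> V y = jac xi y - xi y *m th y + GG y.
Proof.
move=> Uy.
have ent (M1 M2 : 'M[R]_n.+1) (a : 'cV[R]_n.+1) (b : 'rV[R]_n.+1) k i :
   (M1 - a *m b + M2) k i = M1 k i - a k 0 * b 0 i + M2 k i by rewrite !mxE big_ord1.
apply/matrixP => k i; rewrite ent [LHS]mxE [jac _ _ _ _]mxE; congr (_ + _ + _).
  by rewrite mulN1r mulNr mulrC.
rewrite summxE; apply: eq_bigr => j _.
by rewrite mxE [Gm _ _ _ _ _ _]mxE mulrC (Gamma_symmetric oU th gT).
Qed.

Lemma dvx_metric y : U y ->
  dvx (xi y) g y = (GG y)^T *m g y + g y *m GG y - (2 * (th y *m xi y) 0 0) *: g y.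
Proof.
move=> Uy.
have -> : (2 * (th y *m xi y) 0 0) *: g y = \sum_k xi y k 0 *: ((2 * th y 0 k) *: g y).
  rewrite [X in 2 * X]mxE mulr_sumr scaler_suml; apply: eq_bigr => k _.
  by rewrite scalerA; congr (_ *: _); ring.
have -> : (GG y)^T *m g y + g y *m GG y = \sum_k xi y k 0 *: ((Gm g th k y)^T *m g y + g y *m Gm g th k y).
  rewrite /Gv linear_sum /= mulmx_suml mulmx_sumr -big_split; apply: eq_bigr => k _ /=.
  by rewrite linearZ /= -scalemxAl -scalemxAr scalerDr.
rewrite -sumrB; apply: eq_bigr => k _; rewrite -scalerBr; congr (_ *: _).
by rewrite -(Gm_metric oU th gT gU k Uy) addrK.
Qed.

(** The weight of xi makes its norm constant, so that D xi is orthogonal to xi. *)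
Lemma cov_vector_orthogonal y : U y -> (al y)^T *m V y = 0.
Proof.
move=> Uy; apply/matrixP => c i; rewrite ord1 [RHS]mxE.
pose s := th y 0 i.
have sal : smooth_mx U al by apply: smooth_mulmx.
have sxT : smooth_mx U (fun z => (xi z)^T) by apply: smooth_mxT.
have H : (dmx i xi y)^T *m al y + (xi y)^T *m dmx i al y = 0.
  rewrite -(dmxT oU i xi Uy) -(dmxM oU i Uy sxT sal); apply/matrixP => u v.
  rewrite !ord1 !mxE -[RHS](pd_cst (1 : R) y i); apply: (pd_eq i oU Uy) => z Uz.
  by rewrite /al mulmxA unit_xi.
rewrite (dmxM oU i Uy sg sxi) in H.
have dg : dmx i g y = (Gm g th i y)^T *m g y + g y *m Gm g th i y - (2 * s) *: g y.
  by rewrite -(Gm_metric oU th gT gU i Uy) addrK.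
have aT : (al y)^T = (xi y)^T *m g y by rewrite trmx_mul gT.
have xa : (xi y)^T *m al y = 1%:M by rewrite -[LHS]trmxK trmx_mul trmxK (alT_xi Uy) trmx1.
pose v := dmx i xi y - s *: xi y + Gm g th i y *m xi y.
have VE : col i (V y) = v.
  have ent (M1 a M2 : 'cV[R]_n.+1) (b : R) k j : (M1 - b *: a + M2) k j = M1 k j - b * a k j + M2 k j.
    by rewrite !mxE.
  apply/matrixP => k j; rewrite ord1 mxE [LHS]mxE ent; congr (_ + _ + _); first by rewrite mxE.
    by rewrite mulN1r mulNr.
  by rewrite [RHS]mxE; apply: eq_bigr => l _; rewrite [Gm g th i y k l]mxE.
have -> : ((al y)^T *m V y) 0 i = ((al y)^T *m v) 0 0.
  by rewrite -VE [RHS]mxE [LHS]mxE; apply: eq_bigr => k _; rewrite [col _ _ _ _]mxE.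
have gen (g0 Ga : 'M[R]_n.+1) (x dx : 'cV[R]_n.+1) (r : R) : g0^T = g0 -> (g0 *m x)^T *m x = 1%:M ->
    dx^T *m (g0 *m x) + x^T *m ((Ga^T *m g0 + g0 *m Ga - (2 * r) *: g0) *m x + g0 *m dx) = 0 ->
    ((g0 *m x)^T *m (dx - r *: x + Ga *m x)) 0 0 = 0.
  move=> g0T ax.
  have T11 (M : 'M[R]_1) : M^T = M by apply/matrixP => u w; rewrite !ord1 mxE.
  have e1 : dx^T *m (g0 *m x) = (g0 *m x)^T *m dx by rewrite -[RHS]T11 [RHS]trmx_mul trmxK.
  have e2 : x^T *m (Ga^T *m g0 *m x) = (g0 *m x)^T *m (Ga *m x).
    by rewrite -[RHS]T11 [RHS]trmx_mul trmxK trmx_mul !mulmxA.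
  have xg : x^T *m g0 = (g0 *m x)^T by rewrite trmx_mul g0T.
  have e3 : x^T *m (g0 *m Ga *m x) = (g0 *m x)^T *m (Ga *m x) by rewrite !mulmxA xg.
  have e4 : x^T *m (g0 *m dx) = (g0 *m x)^T *m dx by rewrite mulmxA xg.
  have e5 : x^T *m (g0 *m x) = 1%:M by rewrite mulmxA xg.
  rewrite ?(mulmxDl, mulmxBl, mulmxDr, mulmxBr, mulNmx, mulmxN) -scalemxAl -!scalemxAr e1 e2 e3 e4 e5 ax.
  move=> /matrixP/(_ 0 0).
  move: (_ *m dx) (_ *m (Ga *m x)) => M1 M2; rewrite !mxE eqxx !mulr1n !mulr1 => hz; lra.
by apply: gen; [exact: gT|exact: alT_xi|rewrite -dg].
Qed.

(** The fibres of a conformal submersion are generated by conformal transformations of the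
    orthogonal complement; the minimal Weyl derivative absorbs the conformal factor. *)
Theorem submersion_skew y : U y -> g y *m V y + (V y)^T *m g y = 0.
Proof.
move=> Uy.
have sq : smooth_mx U q.
  by apply: smooth_mulmx => //; apply: smooth_mulmx => //; exact: smooth_mxT.
have sal : smooth_mx U al by apply: smooth_mulmx.
have salT : smooth_mx U (fun z => (al z)^T) by apply: smooth_mxT.
have sA : smooth_mx U (fun z => al z *m (al z)^T) by apply: smooth_mulmx.
have sQ : smooth_mx U Q by apply: smooth_mxD => //; apply: smooth_mxN.
have sI : smooth_mx U (fun z => invmx (g z)) by apply: smooth_invmx.
have sqI : smooth_mx U (fun z => invmx (g z) *m q z) by apply: smooth_mulmx.
have smu : smooth_on U mu.
  have s1 : smooth_on U (fun z => \tr (invmx (g z) *m q z)).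
    by apply: (smooth_sum oU) => l _; exact: sqI.
  exact: (smoothM oU (smooth_cst U _) s1).
have smuM : smooth_mx U (fun z => (mu z)%:M : 'M[R]_n.+1).
  move=> i j; apply: (smooth_eq oU (f := fun z => mu z * (i == j)%:R)).
    by move=> z _; rewrite mxE mulr_natr.
  by apply: (smoothM oU) => //; exact: smooth_cst.
have [mu_gt0 qE] := pullback_metric Uy.
have mu0 : mu y != 0 by rewrite gt_eqF.
have [dm Dq] : exists dm, dvx (xi y) q y = dm *: Q y + mu y *: dvx (xi y) Q y.
  exists (\sum_k xi y k 0 * pd k mu y).
  rewrite (dvx_eq oU (N := fun z => (mu z)%:M *m Q z) (xi y) Uy); last first.
    by move=> z Uz; rewrite mul_scalar_mx; case: (pullback_metric Uz).
  rewrite (dvxM oU _ Uy smuM sQ) mul_scalar_mx; congr (_ + _).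
  rewrite -mul_scalar_mx; congr (_ *m _).
  apply/matrixP => i j; rewrite summxE [RHS]mxE -sumrMnl; apply: eq_bigr => k _.
  rewrite !mxE -mulr_natr -mulrA; congr (_ * _).
  have hh := pdM k Uy smu (smooth_cst U ((i == j)%:R : R)).
  rewrite pd_cst mulr0 addr0 in hh; rewrite -hh; apply: (pd_eq k oU Uy) => z _.
  by rewrite mxE mulr_natr.
have DQ : dvx (xi y) Q y = dvx (xi y) g y
    - (dvx (xi y) al y *m (al y)^T + al y *m (dvx (xi y) al y)^T).
  by rewrite (dvxB oU _ Uy sg sA) (dvxM oU _ Uy sal salT) (dvxT oU _ _ Uy).
have Dal : dvx (xi y) al y = dvx (xi y) g y *m xi y + g y *m (jac xi y *m xi y).
  by rewrite (dvxM oU _ Uy sg sxi) jac_mul.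
have tx : th y *m xi y = ((th y *m xi y) 0 0)%:M by apply/matrixP => i j; rewrite !ord1 [RHS]mxE eqxx.
have L := lie_orthogonal_metric (gT Uy) (cov_vector_jac Uy) (dvx_metric Uy) (erefl (al y)) Dal
  (Vxi Uy) (cov_vector_orthogonal Uy) (alT_xi Uy) tx.
rewrite -DQ -/(Q y) in L.
have := dvx_pullback Uy; rewrite Dq qE -scalemxAr -scalemxAl => L2.
set s := 2 * _ in L; pose S := g y *m V y + (V y)^T *m g y; rewrite -/S in L *.
have L3 : S = (s - dm / mu y) *: Q y.
  have e (D A1 A2 : 'M[R]_n.+1) (m d : R) : m != 0 -> d *: Q y + m *: D = - (m *: A1) - m *: A2 ->
      D + A1 + A2 = - (d / m) *: Q y.
    move=> m0 /matrixP hh; apply/matrixP => i j; have := hh i j; rewrite !mxE => h1.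
    by apply: (mulfI m0); rewrite mulrA mulrN mulrCA mulfV // mulr1; lra.
  have := e _ _ _ _ _ mu0 L2; rewrite L => h1.
  by rewrite -[LHS](subrK (s *: Q y)) h1 -scalerDl addrC.
have trS : \tr (invmx (g y) *m S) = 0.
  rewrite /S mulmxDr mulKmx ?g1 // linearD /= trV // add0r mulmxA mxtrace_mulC mulmxA mulmxV ?g1 //.
  by rewrite mul1mx mxtrace_tr trV.
move: trS; rewrite L3 -scalemxAr linearZ /= tr_invQ // => /eqP.
rewrite mulf_eq0 pnatr_eq0 -[n == 0]negbK -lt0n n0 orbF => /eqP ->.
by rewrite scale0r.
Qed.

End Submersion.

Lemma skew_cov_vector (R : realType) (n : nat) (U : set 'cV[R]_n) (g : 'cV[R]_n -> 'M[R]_n)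
    (th th0 : 'cV[R]_n -> 'rV[R]_n) (xi : 'cV[R]_n -> 'cV[R]_n) y i k :
  open U -> smooth_mx U g -> smooth_mx U xi -> (forall y, U y -> (g y)^T = g y) ->
  (forall y, U y -> \det (g y) != 0) -> U y ->
  let al k z := (g z *m xi z) k 0 in let ka z := 2 *: th z - th0 z in
  2 * skew_part (form_of_endo (g y) (cov_vector (-1) th0 g th xi y)) i k =
  pd i (al k) y - pd k (al i) y + (ka y 0 i * al k y - ka y 0 k * al i y).
Proof.
move=> oU sg sxi gT gU Uy al ka; pose V := cov_vector (-1) th0 g th xi y.
have gV a b : (g y *m V) a b = pd b (al a) y + ka y 0 b * al a y
    - \sum_m Gamma g th y m b a * al m y.
  have -> : (g y *m V) a b = (g y *m col b V) a 0.
    by rewrite [LHS]mxE [RHS]mxE; apply: eq_bigr => m _; rewrite [col _ _ _ _]mxE.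
  have VE : col b V = dmx b xi y - th0 y 0 b *: xi y + Gm g th b y *m xi y.
    apply/matrixP => m c; rewrite ord1 !mxE mulN1r mulNr; congr (_ + _).
    by apply: eq_bigr => j _; rewrite [Gm _ _ _ _ _ _]mxE.
  have dg : g y *m Gm g th b y = dmx b g y + (2 * th y 0 b) *: g y - (Gm g th b y)^T *m g y.
    by rewrite (Gm_metric oU th gT gU b Uy) addrC addKr.
  have -> : g y *m col b V = dmx b (fun z => g z *m xi z) y
      + (2 * th y 0 b - th0 y 0 b) *: (g y *m xi y) - (Gm g th b y)^T *m (g y *m xi y).
    rewrite VE (dmxM oU b Uy) // mulmxDr mulmxBr mulmxA dg mulmxBl mulmxDl -scalemxAl -scalemxAr -mulmxA.
    repeat match goal with |- context [@mulmx ?R ?m ?n ?p ?A ?B] =>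
      let x := fresh "x" in move: (@mulmx _ m n p A B) => x end.
    by apply/matrixP => ? ?; rewrite !mxE; gen_pd; ring.
  have ent (M1 M2 M3 : 'cV[R]_n) (s : R) : (M1 + s *: M2 - M3) a 0 = M1 a 0 + s * M2 a 0 - M3 a 0.
    by rewrite !mxE.
  rewrite ent; congr (_ + _ - _); first by rewrite [LHS]mxE.
    by rewrite /ka /al; congr (_ * _); rewrite !mxE.
  by rewrite [LHS]mxE; apply: eq_bigr => m _; rewrite [_^T _ _]mxE [Gm _ _ _ _ _ _]mxE.
have gVT : form_of_endo (g y) V = (g y *m V)^T by rewrite trmx_mul gT.
have ent (M : 'M[R]_n) : 2 * (skew_part M^T) i k = M k i - M i k.
  by rewrite /skew_part !mxE mulrA mulfV ?mul1r // pnatr_eq0.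
rewrite -/V gVT ent !gV.
under eq_bigr => m _ do rewrite (Gamma_symmetric oU th gT _ _ _ Uy).
by gen_pd; move: (ka y 0 i) (ka y 0 k) (al _ _) (al _ _) (\sum_m _) => *; ring.
Qed.

(** * Change of coordinates *)

Section ChartChange.
Context {R : realType} {n : nat}.
Variables (Ua Ub : set 'cV[R]_n) (oUa : open Ua) (oUb : open Ub) (phi : 'cV[R]_n -> 'cV[R]_n).
Hypotheses (sphi : smooth_mx Ua phi) (UaUb : forall y, Ua y -> Ub (phi y)).
Local Notation T := (jac phi).
Hypothesis dT : forall y, Ua y -> 0 < \det (T y).

Definition dens_scale (w : R) y : R := `|\det (T y)| `^ (w / n%:R).
Local Notation dl := dens_scale.
Definition log_det y : 'rV[R]_n := grad (fun z => ln `|\det (T z)|) y.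

Lemma dens_scale_gt0 w y : Ua y -> 0 < dl w y.
Proof. by move=> Uy; rewrite powR_gt0 // normr_gt0 gt_eqF ?dT. Qed.

Lemma dens_scaleD w w' y : Ua y -> dl w y * dl w' y = dl (w + w') y.
Proof.
move=> Uy; rewrite /dens_scale -powRD; first by rewrite mulrDl.
by apply/implyP => _; rewrite normr_eq0 gt_eqF ?dT.
Qed.

Lemma dens_scale0 y : dl 0 y = 1.
Proof. by rewrite /dens_scale mul0r powRr0. Qed.

Lemma dens_scaleN w y : Ua y -> dl (- w) y = (dl w y)^-1.
Proof.
move=> Uy; have w0 : dl w y != 0 by rewrite gt_eqF ?dens_scale_gt0.
by apply: (mulfI w0); rewrite dens_scaleD // subrr dens_scale0 mulfV.
Qed.

Lemma dens_scale_det y : (0 < n)%N -> Ua y -> dl n%:R y = \det (T y).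
Proof.
move=> n0 Uy; rewrite /dens_scale mulfV ?pnatr_eq0 -?lt0n // powRr1 //.
by rewrite gtr0_norm ?dT.
Qed.

Let sT : smooth_mx Ua T.
Proof.
move=> i j; apply: (smooth_eq oUa (f := pd j (fun z => phi z i 0))) => [z _|]; first by rewrite mxE.
by apply: smooth_pd => //; exact: sphi.
Qed.

Let sdet : smooth_on Ua (fun z => `|\det (T z)|).
Proof.
by apply: (smooth_eq oUa _ (smooth_det oUa sT)) => y Uy; rewrite gtr0_norm ?dT.
Qed.

Let dT' y : Ua y -> 0 < `|\det (T y)|. Proof. by move=> Uy; rewrite normr_gt0 gt_eqF ?dT. Qed.

Lemma smooth_dens_scale w : smooth_on Ua (dl w).
Proof. exact: smooth_powR. Qed.

Lemma pd_dens_scale w i y : Ua y -> pd i (dl w) y = w / n%:R * dl w y * log_det y 0 i.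
Proof. by move=> Uy; rewrite [log_det _ _ _]mxE; exact: (pd_powR oUa dT' sdet). Qed.

Lemma pd_comp (f : 'cV[R]_n -> R) i y : smooth_on Ub f -> Ua y ->
  pd i (fun z => f (phi z)) y = (grad f (phi y) *m T y) 0 i.
Proof.
move=> sf Uy.
have [_ ->] := chain_rule i oUa oUb Uy (UaUb Uy) (sf 1%N) (fun j => sphi j 0 1%N).
by rewrite mxE; apply: eq_bigr => j _; rewrite !mxE.
Qed.

(** The logarithmic derivative of a density transforms as a Weyl derivative. *)
Lemma log_derivative_change w sa sb y : smooth_on Ua sa -> smooth_on Ub sb ->
  (forall z, Ua z -> sb (phi z) = dl w z * sa z) -> Ua y -> sa y != 0 ->
  (sb (phi y))^-1 *: (grad sb (phi y) *m T y) = (sa y)^-1 *: grad sa y + (w / n%:R) *: log_det y.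
Proof.
move=> ssa ssb sE Uy sa0; apply/matrixP => c i; rewrite ord1 [LHS]mxE -pd_comp //.
rewrite (pd_eq i oUa Uy sE) (pdM i Uy (smooth_dens_scale w) ssa) pd_dens_scale // sE //.
have d0 : dl w y != 0 by rewrite gt_eqF ?dens_scale_gt0.
have ent (M1 M2 : 'rV[R]_n) (a b : R) : (a *: M1 + b *: M2) 0 i = a * M1 0 i + b * M2 0 i.
  by rewrite !mxE.
rewrite ent [grad _ _ _ _]mxE.
move: (log_det _ _ _) (pd i sa y) (w / _) => a b c1.
by field; rewrite sa0 d0.
Qed.

Section Forms.
Variables (ga gb : 'cV[R]_n -> 'M[R]_n) (tha tha0 thb thb0 : 'cV[R]_n -> 'rV[R]_n)
  (xia xib : 'cV[R]_n -> 'cV[R]_n).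
Hypotheses (sga : smooth_mx Ua ga) (sgb : smooth_mx Ub gb) (sxa : smooth_mx Ua xia)
  (sxb : smooth_mx Ub xib) (gaT : forall y, Ua y -> (ga y)^T = ga y)
  (gbT : forall y, Ub y -> (gb y)^T = gb y) (gaU : forall y, Ua y -> \det (ga y) != 0)
  (gbU : forall y, Ub y -> \det (gb y) != 0).
Hypothesis g_change : forall y, Ua y -> (T y)^T *m gb (phi y) *m T y = dl 2 y *: ga y.
Hypothesis th_change : forall y, Ua y -> tha y = thb (phi y) *m T y + n%:R^-1 *: log_det y.
Hypothesis th0_change : forall y, Ua y -> tha0 y = thb0 (phi y) *m T y + n%:R^-1 *: log_det y.
Hypothesis xi_change : forall y, Ua y -> xib (phi y) = dl (-1) y *: (T y *m xia y).

Lemma dual_change y : Ua y ->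
  (T y)^T *m (gb (phi y) *m xib (phi y)) = dl 1 y *: (ga y *m xia y).
Proof.
move=> Uy; rewrite xi_change // -!scalemxAr !mulmxA g_change // -scalemxAl scalerA.
by rewrite dens_scaleD // (_ : -1 + 2 = 1 :> R) //; ring.
Qed.

(** In terms of the dual 1-form alpha, of weight 1, the skew part of the derivative of xi is the
    exterior derivative of alpha for a Weyl derivative. *)
Lemma skew_form_change y : Ua y ->
  (T y)^T *m skew_part (form_of_endo (gb (phi y)) (cov_vector (-1) thb0 gb thb xib (phi y))) *m T y =
  dl 1 y *: skew_part (form_of_endo (ga y) (cov_vector (-1) tha0 ga tha xia y)).
Proof.
move=> Uy; set Bb := skew_part _; set Ba := skew_part _.
pose ala k z := (ga z *m xia z) k 0; pose alb k z := (gb z *m xib z) k 0.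
pose kaa z := 2 *: tha z - tha0 z; pose kab z := 2 *: thb z - thb0 z.
have sala k : smooth_on Ua (ala k) by exact: (smooth_mulmx oUa sga sxa).
have salb k : smooth_on Ub (alb k) by exact: (smooth_mulmx oUb sgb sxb).
have BaE i k : 2 * Ba i k = pd i (ala k) y - pd k (ala i) y
    + (kaa y 0 i * ala k y - kaa y 0 k * ala i y) :=
  skew_cov_vector tha tha0 i k oUa sga sxa gaT gaU Uy.
have BbE i k : 2 * Bb i k = pd i (alb k) (phi y) - pd k (alb i) (phi y)
    + (kab (phi y) 0 i * alb k (phi y) - kab (phi y) 0 k * alb i (phi y)) :=
  skew_cov_vector thb thb0 i k oUb sgb sxb gbT gbU (UaUb Uy).
have alE z : Ua z -> forall s, \sum_k alb k (phi z) * T z k s = dl 1 z * ala s z.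
  move=> Uz s; have := dual_change Uz => /matrixP/(_ s 0); rewrite [RHS]mxE => <-.
  by rewrite [RHS]mxE; apply: eq_bigr => k _; rewrite [_^T _ _]mxE mulrC.
have kaE s : \sum_i kab (phi y) 0 i * T y i s = kaa y 0 s - n%:R^-1 * log_det y 0 s.
  have -> : \sum_i kab (phi y) 0 i * T y i s = (kab (phi y) *m T y) 0 s by rewrite mxE.
  rewrite /kaa th_change // th0_change // /kab mulmxBl -scalemxAl.
  have ent (M1 M2 M3 : 'rV[R]_n) (a : R) : (2 *: M1 - M2) 0 s =
     (2 *: (M1 + a *: M3) - (M2 + a *: M3)) 0 s - a * M3 0 s by rewrite !mxE; ring.
  exact: ent.
pose X r s := \sum_k (grad (alb k) (phi y) *m T y) 0 r * T y k s.
have dal r s : dl 1 y * pd r (ala s) y + n%:R^-1 * dl 1 y * log_det y 0 r * ala s y =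
    X r s + \sum_k alb k (phi y) * pd r (fun z => T z k s) y.
  have sf k : smooth_on Ua (fun z => alb k (phi z)) by exact: (smooth_comp oUa oUb UaUb sphi (salb k)).
  have sTk k : smooth_on Ua (fun z => T z k s) by exact: sT.
  have e1 : pd r (fun z => \sum_k alb k (phi z) * T z k s) y =
      pd r (fun z => dl 1 z * ala s z) y.
    by apply: (pd_eq r oUa Uy) => z Uz; exact: alE.
  have e2 := pdM r Uy (smooth_dens_scale 1) (sala s).
  rewrite pd_dens_scale // mul1r in e2.
  have e3 := pd_sum oUa r Uy (index_enum _) (fun k => smoothM oUa (sf k) (sTk k)).
  rewrite addrC -e2 -e1 e3 /X -big_split; apply: eq_bigr => k _ /=.
  apply: etrans (pdM r Uy (sf k) (sTk k)) _.
  by rewrite (pd_comp _ (salb k) Uy).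
have symT k r s : pd r (fun z => T z k s) y = pd s (fun z => T z k r) y.
  have sk : smooth_on Ua (fun z => phi z k 0) by exact: sphi.
  have e t u : pd t (fun z => T z k u) y = pd t (pd u (fun z => phi z k 0)) y.
    by apply: (pd_eq t oUa Uy) => z _; rewrite mxE.
  by rewrite !e (pd_pdC oUa r Uy).
have XE r s : X r s = \sum_i \sum_k T y i r * T y k s * pd i (alb k) (phi y).
  rewrite exchange_big; apply: eq_bigr => k _ /=.
  rewrite mxE mulr_suml; apply: eq_bigr => i _; rewrite mxE.
  by move: (pd _ _ _) => ?; ring.
have bil r s (u v : 'I_n -> R) : \sum_i \sum_k T y i r * T y k s * (u i * v k) =
    (\sum_i u i * T y i r) * (\sum_k v k * T y k s).
  rewrite mulr_suml; apply: eq_bigr => i _; rewrite mulr_sumr; apply: eq_bigr => k _.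
  by ring.
apply/matrixP => r s; rewrite [RHS]mxE.
have two : (2 : R) != 0 by rewrite pnatr_eq0.
apply: (mulfI two); rewrite mulrCA BaE.
have -> : 2 * ((T y)^T *m Bb *m T y) r s = \sum_i \sum_k T y i r * T y k s * (2 * Bb i k).
  rewrite mxE exchange_big mulr_sumr; apply: eq_bigr => k _ /=.
  rewrite mxE mulr_suml mulr_sumr; apply: eq_bigr => i _.
  by rewrite [_^T _ _]mxE; ring.
have -> : \sum_i \sum_k T y i r * T y k s * (2 * Bb i k) =
   X r s - X s r + ((\sum_i kab (phi y) 0 i * T y i r) * (\sum_k alb k (phi y) * T y k s)
    - (\sum_i kab (phi y) 0 i * T y i s) * (\sum_k alb k (phi y) * T y k r)).
  rewrite -!bil !XE [\sum_i \sum_k T y i s * T y k r * pd _ _ _]exchange_big.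
  rewrite [\sum_i \sum_k T y i s * T y k r * (_ * _)]exchange_big.
  rewrite -!sumrB -!big_split; apply: eq_bigr => i _ /=.
  rewrite -!sumrB -!big_split; apply: eq_bigr => k _ /=.
  by rewrite BbE; gen_pd; move: (kab _ _ _) (kab _ _ _) (alb _ _) (alb _ _) => *; ring.
rewrite !alE // !kaE.
have d1 := dal r s; have d2 := dal s r.
have -> : X r s - X s r = dl 1 y * pd r (ala s) y + n%:R^-1 * dl 1 y * log_det y 0 r * ala s y
   - (dl 1 y * pd s (ala r) y + n%:R^-1 * dl 1 y * log_det y 0 s * ala r y).
  rewrite d1 d2; have -> : \sum_k alb k (phi y) * pd s (fun z => T z k r) y =
    \sum_k alb k (phi y) * pd r (fun z => T z k s) y by apply: eq_bigr => k _; rewrite symT.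
  by ring.
by gen_pd; move: (kaa y 0 r) (kaa y 0 s) (ala s y) (ala r y) (log_det _ _ _) (log_det _ _ _) => *; ring.
Qed.

End Forms.
End ChartChange.

Lemma asd_endo_change (R : realType) (d : R) (T ga gb Aa Ab : 'M[R]_4) :
  0 < d -> d ^+ 4 = \det T -> \det ga != 0 -> ga^T = ga ->
  T^T *m gb *m T = (d ^+ 2) *: ga ->
  T^T *m skew_part (form_of_endo gb Ab) *m T = d *: skew_part (form_of_endo ga Aa) ->
  asd_endo gb Ab *m T = d^-1 *: (T *m asd_endo ga Aa).
Proof.
move=> d0 dT ga0 gaT gT; rewrite /asd_endo.
set Bb := skew_part (form_of_endo gb Ab); set Ba := skew_part (form_of_endo ga Aa) => BT.
have dn0 : d != 0 by rewrite gt_eqF.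
have uT : T \in unitmx by rewrite unitmxE unitfE -dT expf_neq0.
have uTT : T^T \in unitmx by rewrite unitmx_tr.
have uga : ga \in unitmx by rewrite unitmxE unitfE.
pose K := d ^- 2 *: (T *m invmx ga *m T^T).
have gK : gb *m K = 1%:M.
  apply: (can_inj (mulKmx uTT)); rewrite mulmx1 /K -!scalemxAr !mulmxA gT.
  by rewrite -!scalemxAl mulmxV // mul1mx scalerA mulVf ?scale1r // expf_neq0.
have iK : invmx gb = K.
  have ugb : gb \in unitmx by case: (mulmx1_unit gK).
  by rewrite -[RHS]mul1mx -(mulVmx ugb) -mulmxA gK mulmx1.
have iga : (invmx ga)^T = invmx ga by rewrite trmx_inv gaT.
have sT : T^T *m star2 gb Bb *m T = d *: star2 ga Ba.
  have -> : star2 gb Bb = d ^- 3 *: eps4 (T *m (invmx ga *m Ba *m (invmx ga)^T) *m T^T).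
    rewrite star2E iK /K.
    have -> : (d ^- 2 *: (T *m invmx ga *m T^T)) *m Bb *m (d ^- 2 *: (T *m invmx ga *m T^T))^T =
       d ^- 3 *: (T *m (invmx ga *m Ba *m (invmx ga)^T) *m T^T).
      have KT : (T *m invmx ga *m T^T)^T = T *m invmx ga *m T^T.
        by rewrite !trmx_mul trmxK iga mulmxA.
      have KBK : (T *m invmx ga *m T^T) *m Bb *m (T *m invmx ga *m T^T) =
          d *: (T *m (invmx ga *m Ba *m (invmx ga)^T) *m T^T).
        transitivity (T *m invmx ga *m (T^T *m Bb *m T) *m invmx ga *m T^T); first by rewrite !mulmxA.
        by rewrite BT -scalemxAr -!scalemxAl iga !mulmxA.
      have KT' : (d ^- 2 *: (T *m invmx ga *m T^T))^T = d ^- 2 *: (T *m invmx ga *m T^T).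
        by rewrite linearZ /= KT.
      rewrite KT' -!scalemxAl -scalemxAr scalerA KBK scalerA; congr (_ *: _).
      by field.
    have eZ (s : R) M : eps4 (s *: M) = s *: eps4 M.
      apply/matrixP => i j; rewrite !mxE [RHS]mulrCA; congr (_ * _); rewrite mulr_sumr; apply: eq_bigr => k _.
      by rewrite mulr_sumr; apply: eq_bigr => l _; rewrite mxE mulrA.
    by rewrite eZ.
  rewrite -scalemxAr -scalemxAl eps4_congr scalerA -dT star2E; congr (_ *: _).
  by field.
have aT : T^T *m asd_form gb Bb *m T = d *: asd_form ga Ba.
  by rewrite /asd_form -scalemxAr -scalemxAl mulmxBr mulmxBl BT sT -scalerBr scalerA mulrC -scalerA.
have aT' : T^T *m (asd_form gb Bb)^T *m T = d *: (asd_form ga Ba)^T.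
  have tZ (M : 'M[R]_4) : d *: M^T = (d *: M)^T by apply/matrixP => i j; rewrite !mxE.
  rewrite tZ.
  by rewrite -aT !trmx_mul trmxK mulmxA.
rewrite /endo_of_form iK /K -!scalemxAl.
have -> : T *m invmx ga *m T^T *m (asd_form gb Bb)^T *m T =
   T *m invmx ga *m (T^T *m (asd_form gb Bb)^T *m T) by rewrite !mulmxA.
rewrite aT' -scalemxAr scalerA mulmxA; congr (_ *: _).
by field.
Qed.

Section Charts.
Context {R : realType} {n : nat} (M : manifold R n).
Implicit Types (V : set M) (a b : atlas M) (p : M).

Lemma cdom_chart V a p : V p -> chart_dom a p -> cdom V a (chart a p).
Proof. by move=> Vp ap; exists p. Qed.

Lemma cdom_open V a : open V -> open (cdom V a).
Proof.
move=> oV.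
have -> : cdom V a = (chart a @` chart_dom a) `&` [set y | V (chart_inv a y)].
  apply/seteqP; split=> [y [p [Vp ap] <-]|y [[p ap <-] /=]].
    by split; [exists p|rewrite /= chartK].
  by rewrite chartK // => Vp; exists p.
rewrite openE => y [ay /= Vy].
have oa := @chart_open _ _ M a; rewrite openE in oa.
have c := chart_inv_continuous ay.
have nV : nbhs (chart_inv a y) V by apply: open_nbhs_nbhs.
have nI := c _ nV.
by apply: filterI => //; exact: oa.
Qed.

Lemma cdomS V V' a : V `<=` V' -> cdom V a `<=` cdom V' a.
Proof. by move=> VV y [p [Vp ap] <-]; exists p => //; split=> //; exact: VV. Qed.

Lemma smooth_sub (U U' : set 'cV[R]_n) (k l : nat) (f : 'cV[R]_n -> 'M[R]_(k, l)) :
  U' `<=` U -> smooth_mx U f -> smooth_mx U' f.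
Proof. by move=> UU sf i j m; apply: (Ck_sub UU); exact: sf. Qed.

Definition transition a b : 'cV[R]_n -> 'cV[R]_n := fun y => chart b (chart_inv a y).

Definition overlap V a b : set 'cV[R]_n := cdom (V `&` chart_dom b) a.

Lemma overlap_open V a b : open V -> open (overlap V a b).
Proof. by move=> oV; apply: cdom_open; apply: openI => //; exact: chart_dom_open. Qed.

Lemma smooth_transition V a b : smooth_mx (overlap V a b) (transition a b).
Proof.
apply: smooth_sub (transition_smooth a b).
by move=> y [p [[Vp bp] ap] <-]; exists p.
Qed.

Lemma transition_cdom V a b y : overlap V a b y -> cdom V b (transition a b y).
Proof. by case=> p [[Vp bp] ap] <-; rewrite /transition chartK //; exact: cdom_chart. Qed.

Lemma tjacE V a b y : overlap V a b y -> tjac a b (chart_inv a y) = jac (transition a b) y.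
Proof. by case=> p [[Vp bp] ap] <-; rewrite /tjac chartK. Qed.

Lemma log_detE V a b p : open V -> V p -> chart_dom a p -> chart_dom b p ->
  grad (fun y => ln `|\det (tjac a b (chart_inv a y))|) (chart a p) =
  log_det (transition a b) (chart a p).
Proof.
move=> oV Vp ap bp; apply/matrixP => c i; rewrite [LHS]mxE [RHS]mxE.
have Up : overlap V a b (chart a p) by exists p.
by apply: (pd_eq i (@overlap_open V a b oV) Up) => z Uz; rewrite (tjacE Uz).
Qed.

Lemma overlap_cdom V a b : overlap V a b `<=` cdom V a.
Proof. by apply: cdomS => p []. Qed.

Lemma det_transition V a b y : oriented M -> overlap V a b y ->
  0 < \det (jac (transition a b) y).
Proof.
move=> or Uy; rewrite -(tjacE Uy); case: Uy => p [[Vp bp] ap] <-.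
by rewrite chartK //; exact: or.
Qed.

Lemma density_overlap w V s a b y : density w V s -> overlap V a b y ->
  s b (transition a b y) = dens_scale (transition a b) w y * s a y.
Proof. by move=> [_ H] [p [[Vp bp] ap] <-]; rewrite /transition chartK // (H a b). Qed.

Lemma weyl_overlap V D a b y : open V -> weyl_derivative V D -> overlap V a b y ->
  D a y = D b (transition a b y) *m jac (transition a b) y
    + n%:R^-1 *: log_det (transition a b) y.
Proof.
move=> oV [_ H] [p [[Vp bp] ap] <-]; rewrite -(log_detE oV Vp ap bp).
by rewrite (H a b p Vp ap bp) /transition chartK.
Qed.

Lemma weyl_glue V D : open V -> (forall a, smooth_mx (cdom V a) (D a)) ->
  (forall a b y, overlap V a b y -> D a y = D b (transition a b y) *m jac (transition a b) y
    + n%:R^-1 *: log_det (transition a b) y) -> weyl_derivative V D.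
Proof.
move=> oV sD H; split=> // a b p Vp ap bp; rewrite (log_detE oV Vp ap bp).
by rewrite (H a b) ?/transition ?chartK //; exists p.
Qed.

Lemma weyl_sub V V' (D : chart_field M 'rV[R]_n) : V `<=` V' ->
  weyl_derivative V' D -> weyl_derivative V D.
Proof.
move=> VV [sD H]; split=> [a|a b p Vp]; first by apply: smooth_sub (sD a); exact: cdomS.
by apply: H; exact: VV.
Qed.

(** Weyl derivatives form an affine space modelled on the 1-forms. *)
Lemma weyl_affine V (D1 D2 D3 : chart_field M 'rV[R]_n) : open V ->
  weyl_derivative V D1 -> weyl_derivative V D2 -> weyl_derivative V D3 ->
  weyl_derivative V (fun a y => D1 a y + D2 a y - D3 a y).
Proof.
move=> oV H1 H2 H3; apply: weyl_glue => // [a|a b y Uy].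
  have oU := @cdom_open V a oV; case: H1 H2 H3 => s1 _ [s2 _] [s3 _].
  by apply: smooth_mxD => //; [exact: smooth_mxD|exact: smooth_mxN].
rewrite (weyl_overlap oV H1 Uy) (weyl_overlap oV H2 Uy) (weyl_overlap oV H3 Uy).
rewrite mulmxBl mulmxDl; move: (_ *m _) (_ *m _) (_ *m _) (_ *: _) => *.
by apply/matrixP => i j; rewrite !mxE; ring.
Qed.

(** The Weyl derivative for which tau is parallel is the logarithmic derivative of tau. *)
Lemma weyl_of_density V (tau : chart_field M R) : (0 < n)%N -> oriented M -> open V ->
  density (-1) V tau -> (forall a y, cdom V a y -> tau a y != 0) ->
  weyl_derivative V (fun a y => (tau a y)^-1 *: grad (tau a) y).
Proof.
move=> n0 or oV dtau tau0; have [st _] := dtau.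
apply: weyl_glue => // [a i j|a b y Uy].
  have oU := @cdom_open V a oV; rewrite ord1.
  apply: (smooth_eq oU (f := fun y => (tau a y)^-1 * pd j (tau a) y)) => [y _|]; first by rewrite !mxE.
  by apply: (smoothM oU); [apply: (smoothV oU) => // y; exact: tau0|exact: smooth_pd].
have ta0 : tau a y != 0 by apply: tau0; exact: overlap_cdom Uy.
have sta : smooth_on (overlap V a b) (tau a).
  by move=> k; apply: (Ck_sub (@overlap_cdom V a b)); exact: st.
have L := log_derivative_change (@overlap_open V a b oV) (@cdom_open V b oV) (@smooth_transition V a b)
  (@transition_cdom V a b) (fun z Uz => det_transition or Uz) sta (st b)
  (fun z Uz => density_overlap dtau Uz) Uy ta0.
rewrite -scalemxAl L mulN1r -addrA -scalerDl addNr scale0r addr0.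
by [].
Qed.

End Charts.

Section LocalSquare.
Context {R : realType}.
Variables (U : set 'cV[R]_4) (oU : open U).
Variables (g E : 'cV[R]_4 -> 'M[R]_4) (th th0 : 'cV[R]_4 -> 'rV[R]_4) (xi : 'cV[R]_4 -> 'cV[R]_4).
Hypotheses (sE : smooth_mx U E) (sth : smooth_mx U th) (sth0 : smooth_mx U th0)
  (sxi : smooth_mx U xi)
  (EtE : forall y, U y -> (E y)^T *m E y = g y) (dE : forall y, U y -> \det (E y) = 1).
Local Notation B := (fun y => asd_endo (g y) (cov_vector (-1) th0 g th xi y)).
Local Notation X := (Ei E).
Let N y := E y *m cov_vector (-1) th0 g th xi y *m X y.
Let K y := Kmat (fun m => p m (N y)).

Let BE y : U y -> B y = X y *m K y *m E y.
Proof. by move=> Uy; exact: (asd_endo_frame th th0 xi EtE dE Uy). Qed.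

Lemma smooth_asd_endo : smooth_mx U B.
Proof.
have sN := smooth_N oU sE sth sth0 sxi EtE dE.
have sp m : smooth_on U (fun y => p m (N y)) by apply: (smooth_p oU m); exact: sN.
have sK : smooth_mx U K.
  move=> a b; apply: (smooth_eq oU (f := fun z =>
    p T1 (N z) * Bu T1 a b + p T2 (N z) * Bu T2 a b + p T3 (N z) * Bu T3 a b)).
    by move=> z _; rewrite mxE.
  by sm.
have sX := smooth_Ei oU sE dE.
have sXKE : smooth_mx U (fun y => X y *m K y *m E y).
  by apply: smooth_mulmx => //; exact: smooth_mulmx.
move=> i j; apply: (smooth_eq oU _ (sXKE i j)) => y Uy.
by rewrite (BE Uy).
Qed.

(** The antiselfdual endomorphisms are the imaginary quaternions. *)
Lemma asd_endo_square y : U y -> exists s : R,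
  [/\ 0 <= s, B y *m B y = - s%:M & B y != 0 -> 0 < s].
Proof.
move=> Uy; pose k m := p m (N y).
exists (k T1 ^+ 2 + k T2 ^+ 2 + k T3 ^+ 2).
have s0 : 0 <= k T1 ^+ 2 + k T2 ^+ 2 + k T3 ^+ 2 by rewrite !addr_ge0 ?sqr_ge0.
split=> //.
  rewrite (BE Uy) !mulmxA -[X y *m K y *m E y *m X y]mulmxA (EEi dE Uy) mulmx1.
  rewrite -[X y *m K y *m K y]mulmxA Kmat_sqr mulmxN mulNmx mul_mx_scalar -scalemxAl (EiE dE Uy).
  by rewrite scalemx1.
rewrite lt_neqAle s0 andbT eq_sym; apply: contra => /eqP k0.
suff K0 : K y = 0 by rewrite (BE Uy) K0 mulmx0 mul0mx.
have h1 := sqr_ge0 (k T1); have h2 := sqr_ge0 (k T2); have h3 := sqr_ge0 (k T3).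
have km m : k m = 0.
  by apply/eqP; rewrite -sqrf_eq0; apply/eqP; case: m; lra.
apply/matrixP => a b; rewrite mxE [RHS]mxE -/(k T1) -/(k T2) -/(k T3) !km.
by rewrite !mul0r !addr0.
Qed.

End LocalSquare.

Section Global.
Context {R : realType} (M : manifold R 4) (c : chart_field M 'M[R]_4).
Variables (Dew D0 : chart_field M 'rV[R]_4) (xi : chart_field M 'cV[R]_4).
Hypotheses (hDew : selfdual_einstein_weyl c Dew) (hxi : congruence c xi)
  (hsub : conformal_submersion c xi) (hD0 : minimal_weyl c xi D0) (hF0 : selfdual_faraday c D0).
Local Notation B := (asd_deriv c D0 Dew xi).
Local Notation U a := (cdom (@setT M) a).

Let or : oriented M. Proof. by case: hDew. Qed.
Let sc a : smooth_mx (U a) (c a). Proof. by case: hDew => _ [sc _] _ _; exact: sc. Qed.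
Let cT a y : U a y -> (c a y)^T = c a y.
Proof. by case: hDew => _ [_ [_ H]] _ _ Uy; case: (H a y Uy). Qed.
Let dc a y : U a y -> \det (c a y) = 1.
Proof. by case: hDew => _ [_ [_ H]] _ _ Uy; case: (H a y Uy). Qed.
Let dc0 a y : U a y -> \det (c a y) != 0. Proof. by move=> Uy; rewrite dc // oner_eq0. Qed.
Let wDew : weyl_derivative setT Dew. Proof. by case: hDew => _ _ _ []. Qed.
Let wD0 : weyl_derivative setT D0. Proof. by case: hD0. Qed.
Let sDew a : smooth_mx (U a) (Dew a). Proof. by case: wDew => s _; exact: s. Qed.
Let sD0 a : smooth_mx (U a) (D0 a). Proof. by case: wD0 => s _; exact: s. Qed.
Let sxi a : smooth_mx (U a) (xi a). Proof. by case: hxi => [[s _] _]; exact: s. Qed.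
Let oU a : open (U a). Proof. exact: (@cdom_open _ _ M setT a openT). Qed.

Let frame a : exists E : 'cV[R]_4 -> 'M[R]_4, [/\ smooth_mx (U a) E,
  forall y, U a y -> (E y)^T *m E y = c a y & forall y, U a y -> \det (E y) = 1].
Proof.
have [E [sE EtE dE]] : exists E : 'cV[R]_4 -> 'M[R]_4, [/\ smooth_mx (U a) E,
    forall y, U a y -> (E y)^T *m E y = c a y & forall y, U a y -> 0 < \det (E y)].
  have P y : U a y -> forall v : 'cV[R]_4, v != 0 -> 0 < (v^T *m c a y *m v) 0 0.
    by move=> Uy; case: hDew => _ [_ [_ H]] _ _; case: (H a y Uy).
  exact: (smooth_cholesky (@oU a) (@sc a) (@cT a) P).
exists E; split=> // y Uy; have := congr1 determinant (EtE y Uy).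
rewrite det_mulmx det_tr dc // => /eqP; rewrite -expr2 sqrf_eq1 => /orP[/eqP //|/eqP d1].
by have := dE y Uy; rewrite d1; lra.
Qed.

(** The base provides the coordinates in which the fibres are level sets. *)
Let V0skew a y : U a y ->
  let V0 := cov_vector (-1) (D0 a) (c a) (D0 a) (xi a) y in c a y *m V0 + V0^T *m c a y = 0.
Proof.
case=> q [_ aq] <- {y}.
have [N [h [f [[sh _] [cf sf] _ Hf]]]] := hsub.
have [b bq] := chart_dom_cover (f q).
pose U' := cdom (f @^-1` chart_dom b) a.
have oU' : open U'.
  apply: cdom_open; move/continuousP: cf; apply; exact: chart_dom_open.
have U'U : U' `<=` U a by apply: cdomS.
pose W := cdom (@setT N) b.
have oW : open W by exact: (@cdom_open _ _ N setT b openT).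
have sphi : smooth_mx U' (chart_map f a b).
  apply: smooth_sub (sf a b) => y [p [bp ap] <-]; exists p => //; split.
have UW y : U' y -> W (chart_map f a b y).
  by case=> p [bp ap] <-; rewrite /chart_map chartK //; exists (f p).
have Pxi y : U' y -> jac (chart_map f a b) y *m xi a y = 0.
  by case=> p [bp ap] <-; have [_ H _] := Hf a b p ap bp.
have conf y : U' y -> exists2 mu : R, 0 < mu & forall v w : 'cV[R]_4,
    (v^T *m c a y *m xi a y) 0 0 = 0 -> (w^T *m c a y *m xi a y) 0 0 = 0 ->
    ((jac (chart_map f a b) y *m v)^T *m h b (chart_map f a b y) *m (jac (chart_map f a b) y *m w)) 0 0
     = mu * (v^T *m c a y *m w) 0 0.
  case=> p [bp ap] <-; have [_ _ [mu mu0 H]] := Hf a b p ap bp; exists mu => // v w hv hw.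
  by rewrite /chart_map chartK //; exact: H.
have sub p q' (F : 'cV[R]_4 -> 'M[R]_(p, q')) : smooth_mx (U a) F -> smooth_mx U' F by exact: smooth_sub.
apply: (@submersion_skew R 3 U' oU' isT (c a) (D0 a) (xi a) (sub _ _ _ (@sc a))
  (sub _ _ _ (@sxi a)) _ _ _ _ _ W oW (chart_map f a b) (h b) sphi (sh b) UW Pxi conf).
- by move=> y /U'U; exact: cT.
- by move=> y /U'U; exact: dc0.
- by move=> y /U'U Uy; case: hxi => _; apply.
- by move=> y /U'U Uy; case: hD0 => _ H; case: (H a y Uy).
- by move=> y /U'U Uy; case: hD0 => _ H; case: (H a y Uy).
- by exists q.
Qed.

Lemma smooth_asd_deriv a : smooth_mx (U a) (B a).
Proof.
have [E [sE EtE dE]] := frame a.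
exact: (smooth_asd_endo (@oU a) sE (@sDew a) (@sD0 a) (@sxi a) EtE dE).
Qed.

Lemma asd_deriv_square a y : U a y -> exists s : R,
  [/\ 0 <= s, B a y *m B a y = - s%:M & B a y != 0 -> 0 < s].
Proof.
move=> Uy; have [E [sE EtE dE]] := frame a.
exact: (asd_endo_square (Dew a) (D0 a) (xi a) EtE dE Uy).
Qed.

Lemma asd_deriv_change a b y : overlap setT a b y ->
  B b (transition a b y) *m jac (transition a b) y =
  dens_scale (transition a b) (-1) y *: (jac (transition a b) y *m B a y).
Proof.
move=> Uy; have oO := @overlap_open _ _ M setT a b openT.
have dT z (Uz : overlap setT a b z) := det_transition or Uz.
have OU := @overlap_cdom _ _ M setT a b.
have UU := @transition_cdom _ _ M setT a b.
have d0 := dens_scale_gt0 dT 1 Uy.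
have gch z : overlap setT a b z -> (jac (transition a b) z)^T *m c b (transition a b z) *m
    jac (transition a b) z = dens_scale (transition a b) 2 z *: c a z.
  by case=> q [[_ bq] aq] <-; case: hDew => _ [_ [H _]] _ _; rewrite /transition chartK // -(H a b q aq bq).
have xch z : overlap setT a b z -> xi b (transition a b z) =
    dens_scale (transition a b) (-1) z *: (jac (transition a b) z *m xi a z).
  by case=> q [[_ bq] aq] <-; case: hxi => [[_ H] _]; rewrite /transition chartK // (H a b q).
have sub p q' (F : 'cV[R]_4 -> 'M[R]_(p, q')) : smooth_mx (U a) F -> smooth_mx (overlap setT a b) F.
  exact: smooth_sub.
have L := skew_form_change oO (@oU b) (@smooth_transition _ _ M setT a b) UU dT
  (sub _ _ _ (@sc a)) (@sc b) (sub _ _ _ (@sxi a)) (@sxi b) (fun z Uz => cT (OU z Uz)) (@cT b)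
  (fun z Uz => dc0 (OU z Uz)) (@dc0 b) gch (fun z Uz => weyl_overlap openT wDew Uz)
  (fun z Uz => weyl_overlap openT wD0 Uz) xch Uy.
rewrite (dens_scaleN dT _ Uy); apply: asd_endo_change L => //.
- by rewrite -(dens_scale_det dT isT Uy) !exprS expr0 mulr1 !(dens_scaleD dT _ _ Uy); congr dens_scale; ring.
- exact: dc0 (OU _ Uy).
- exact: cT (OU _ Uy).
- by rewrite gch // expr2 (dens_scaleD dT _ _ Uy).
Qed.

Section Decomposition.
Variables (V : set M) (tau : chart_field M R) (J : chart_field M 'M[R]_4).
Hypotheses (oV : open V) (dec : asd_decomposition c D0 Dew xi V tau J).
Local Notation D := (gauge_change D0 Dew tau).

Let dtau : density (-1) V tau. Proof. by case: dec => [[]]. Qed.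
Let tau0 a y : cdom V a y -> tau a y != 0. Proof. by case: dec => [[_ H]] _ _ _; exact: H. Qed.
Let VU a : cdom V a `<=` U a. Proof. exact: cdomS. Qed.
Let Dt : weyl_derivative V (fun a y => (tau a y)^-1 *: grad (tau a) y).
Proof. exact: weyl_of_density. Qed.

Lemma gauge_changeE a y : cdom V a y ->
  D a y = Dew a y + D0 a y - (tau a y)^-1 *: grad (tau a) y.
Proof.
move=> Uy; rewrite /gauge_change /dens_deriv mulN1r scalerDr scalerA mulrN mulVf ?tau0 //.
by rewrite scaleN1r opprD opprK addrA addrAC.
Qed.

Lemma weyl_gauge_change : weyl_derivative V D.
Proof.
have [sD law] := weyl_affine oV (weyl_sub (@subsetT _ V) wDew) (weyl_sub (@subsetT _ V) wD0) Dt.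
split=> [a i j|a b p Vp ap bp].
  apply: (smooth_eq (@cdom_open _ _ M V a oV) _ (sD a i j)) => y Uy.
  by rewrite -gauge_changeE.
rewrite !gauge_changeE; [exact: law|exact: cdom_chart|exact: cdom_chart].
Qed.

Theorem kahler_of_decomposition : kahler_weyl c V J D.
Proof.
have [_ [sJ lJ] JJ tJ] := dec.
have local a : (forall y, cdom V a y -> (J a y)^T *m c a y *m J a y = c a y) /\
    (forall y, cdom V a y -> forall i k l, cov_endo (c a) (D a) (J a) y i k l = 0).
  have [E [sE EtE dE]] := frame a.
  have oVa := @cdom_open _ _ M V a oV.
  have sub p q (F : 'cV[R]_4 -> 'M[R]_(p, q)) : smooth_mx (U a) F -> smooth_mx (cdom V a) F.
    by apply: smooth_sub; exact: VU.
  have EtE' y (Uy : cdom V a y) := EtE y (VU Uy).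
  have dE' y (Uy : cdom V a y) := dE y (VU Uy).
  have [st _] := dtau.
  have tJ' y (Uy : cdom V a y) : asd_endo (c a y) (cov_vector (-1) (D0 a) (c a) (Dew a) (xi a) y)
     = tau a y *: J a y := tJ a y Uy.
  split=> y Uy.
    by apply: (J_orthogonal EtE' dE' (@tau0 a) (JJ a) tJ' Uy).
  move=> i k l.
  apply: (J_parallel oVa (sub _ _ _ sE) (sub _ _ _ (@sDew a)) (sub _ _ _ (@sD0 a))
    (sub _ _ _ (@sxi a)) EtE' dE' _ _ _ _ (st a) (@tau0 a) (sJ a) (JJ a) tJ' i k l Uy).
  - by move=> z Uz; exact: V0skew (VU Uz).
  - by move=> z Uz; case: hDew => _ _ H _; exact: H (VU Uz).
  - by move=> z Uz; case: hDew => _ _ _ [_ H]; exact: H (VU Uz).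
  - by move=> z Uz; exact: hF0 (VU Uz).
split=> //; first by split=> //; exact: weyl_gauge_change.
- by move=> a y Uy; case: (local a) => H _; exact: H.
- move=> a X Y sX sY y Uy; have [_ H] := local a.
  have oVa := @cdom_open _ _ M V a oV.
  apply: (nijenhuis_parallel oVa (G := fun i => Gm (c a) (D a) i y) Uy (sJ a) sX sY _ (JJ a y Uy)).
    move=> i j k; rewrite [LHS]mxE [RHS]mxE.
    apply: (Gamma_symmetric oVa) Uy => z Uz; exact: cT (VU Uz).
  move=> i; apply/matrixP => k l; have := H y Uy i k l.
  have ent (M1 M2 M3 M4 : 'M[R]_4) : (M1 *m M2 - M3 *m M4) k l =
      \sum_j M1 k j * M2 j l - \sum_j M3 k j * M4 j l by rewrite !mxE.
  rewrite /cov_endo ent => h.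
  have -> : dmx i (J a) y k l = pd i (fun z => J a z k l) y by rewrite mxE.
  apply/eqP; rewrite -subr_eq0 -[X in _ == X]h opprB addrA; apply/eqP.
  congr (_ + _ - _).
    by apply: eq_bigr => j _; rewrite [Gm _ _ _ _ _ _]mxE.
  by apply: eq_bigr => j _; rewrite [Gm _ _ _ _ _ _]mxE.
- by move=> a y Uy; case: (local a) => _ H; exact: H.
Qed.

Theorem parallel_weyl_derivative : exists Dtau : chart_field M 'rV[R]_4,
  [/\ weyl_derivative V Dtau,
      forall a y, cdom V a y -> dens_deriv (-1) (Dtau a) (tau a) y = 0,
      forall a y, cdom V a y -> D a y = Dew a y + D0 a y - Dtau a y
    & forall Dtau' : chart_field M 'rV[R]_4, weyl_derivative V Dtau' ->
        (forall a y, cdom V a y -> dens_deriv (-1) (Dtau' a) (tau a) y = 0) ->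
        forall a y, cdom V a y -> Dtau' a y = Dtau a y].
Proof.
exists (fun a y => (tau a y)^-1 *: grad (tau a) y); split=> //.
- move=> a y Uy; rewrite /dens_deriv mulN1r scalerA mulNr mulfV ?tau0 // scaleN1r.
  by rewrite subrr.
- exact: gauge_changeE.
- move=> Dt' _ H a y Uy; have := H a y Uy; rewrite /dens_deriv mulN1r scaleNr => /eqP.
  rewrite subr_eq0 => /eqP ->; rewrite scalerA mulVf ?tau0 // scale1r.
  by [].
Qed.

End Decomposition.

Local Notation W := (asd_deriv_support c D0 Dew xi).

Local Opaque asd_deriv.

Lemma asd_deriv_neq0 a y : cdom W a y -> B a y != 0.
Proof.
case=> p [[b bp B0] ap] <-; apply: contraNneq B0 => Ba0.
have Op : overlap setT a b (chart a p) by exists p.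
have := asd_deriv_change Op; rewrite /transition chartK // Ba0 mulmx0 scaler0 => H.
have uT : jac (transition a b) (chart a p) \in unitmx.
  by rewrite unitmxE unitfE gt_eqF // (det_transition or Op).
by rewrite -[B b _](mulmxK uT) H mul0mx.
Qed.

Lemma asd_deriv_support_open : open W.
Proof.
rewrite openE => p [a ap B0].
have [i [j Bij]] : exists i j, B a (chart a p) i j != 0.
  case: (pselect (exists i j, B a (chart a p) i j != 0)) => // H.
  case/eqP: B0; apply/matrixP => i j; rewrite [RHS]mxE; apply/eqP.
  by apply: contra_notT H => H; exists i, j.
have Up : U a (chart a p) by exists p.
have cB : {for chart a p, continuous (fun y => B a y i j)}.
  by have [cB _] := @smooth_asd_deriv a i j 0%N; exact: cB.
have cc : {for p, continuous (fun q => B a (chart a q) i j)}.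
  by apply: (@continuous_comp _ _ _ (chart a) (fun y => B a y i j)) => //; exact: chart_continuous.
have oN : open [set t : R | t != 0] by exact: open_neq.
have n1 : nbhs p [set q | B a (chart a q) i j != 0].
  by have n0 := cc [set t : R | t != 0] (open_nbhs_nbhs (conj oN Bij)); exact: n0.
have n2 : nbhs p (chart_dom a) by apply: open_nbhs_nbhs; split=> //; exact: chart_dom_open.
suff S : chart_dom a `&` [set q | B a (chart a q) i j != 0] `<=` W.
  have n3 : nbhs p (chart_dom a `&` [set q | B a (chart a q) i j != 0]) by exact: filterI.
  change (nbhs p W).
  exact: (filterS S).
move=> q [aq Bq]; exists a; first exact: aq.
have {}Bq : B a (chart a q) i j != 0 by exact: Bq.
by apply: contraNneq Bq => ->; rewrite mxE.
Qed.

Definition asd_norm : chart_field M R := fun a y => Num.sqrt (- 4^-1 * \tr (B a y *m B a y)).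
Definition asd_unit : chart_field M 'M[R]_4 := fun a y => (asd_norm a y)^-1 *: B a y.

Lemma asd_norm_spec a y : cdom W a y ->
  [/\ 0 < - 4^-1 * \tr (B a y *m B a y), 0 < asd_norm a y
    & B a y *m B a y = - (asd_norm a y ^+ 2)%:M].
Proof.
move=> Wy; have Uy : U a y by exact: cdomS Wy.
have [s [s0 Bs Bn]] := asd_deriv_square Uy.
have sp : 0 < s by apply: Bn; exact: asd_deriv_neq0.
have e : - 4^-1 * \tr (B a y *m B a y) = s.
  by rewrite Bs linearN /= mxtrace_scalar -mulr_natr; field.
by rewrite /asd_norm e; split; rewrite ?sqrtr_gt0 // Bs sqr_sqrtr // ltW.
Qed.

Lemma asd_norm_decomposition : asd_decomposition c D0 Dew xi W asd_norm asd_unit.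
Proof.
have oW := asd_deriv_support_open.
have tgt a y (Wy : cdom W a y) : 0 < asd_norm a y by have [] := asd_norm_spec Wy.
have t0 a y (Wy : cdom W a y) : asd_norm a y != 0 by rewrite gt_eqF ?tgt.
have sB a : smooth_mx (cdom W a) (B a).
  by apply: smooth_sub (@smooth_asd_deriv a); exact: cdomS.
have st a : smooth_on (cdom W a) (asd_norm a).
  have oWa := @cdom_open _ _ M W a oW.
  apply: (smooth_sqrt oWa) => [y Wy|]; first by have [] := asd_norm_spec Wy.
  apply: (smoothM oWa (smooth_cst _ _)); apply: (smooth_sum oWa) => i _.
  exact: (smooth_mulmx oWa (sB a) (sB a)).
have law a b p : W p -> chart_dom a p -> chart_dom b p ->
   asd_norm b (chart b p) = dens_factor (-1) a b p * asd_norm a (chart a p) /\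
   B b (chart b p) *m tjac a b p = dens_factor (-1) a b p *: (tjac a b p *m B a (chart a p)).
  move=> Wp ap bp; have Op : overlap setT a b (chart a p) by exists p.
  have := asd_deriv_change Op.
  have -> : transition a b (chart a p) = chart b p by rewrite /transition chartK.
  rewrite -/(tjac a b p) -/(dens_factor (-1) a b p) => H; split=> //.
  have d0 : 0 <= dens_factor (-1) a b p by exact: powR_ge0.
  have uT : tjac a b p \in unitmx by rewrite unitmxE unitfE gt_eqF // or.
  rewrite -[LHS](ger0_norm (ltW (tgt _ _ (cdom_chart Wp bp)))) -sqrtr_sqr.
  rewrite -[RHS]ger0_norm ?mulr_ge0 // ?ltW ?tgt //; last exact: cdom_chart.
  rewrite -sqrtr_sqr; congr Num.sqrt.
  have [_ _ Bb] := asd_norm_spec (cdom_chart Wp bp).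
  have [_ _ Ba] := asd_norm_spec (cdom_chart Wp ap).
  have : B b (chart b p) *m B b (chart b p) *m tjac a b p =
      dens_factor (-1) a b p ^+ 2 *: (tjac a b p *m (B a (chart a p) *m B a (chart a p))).
    have gen (Bb' T Ba' : 'M[R]_4) (d : R) : Bb' *m T = d *: (T *m Ba') ->
        Bb' *m Bb' *m T = d ^+ 2 *: (T *m (Ba' *m Ba')).
      by move=> h; rewrite -mulmxA h -scalemxAr [Bb' *m (T *m _)]mulmxA h -scalemxAl scalerA -mulmxA.
    exact: gen H.
  rewrite Bb Ba mulmxN mulNmx mul_scalar_mx mul_mx_scalar scalerN scalerA => /oppr_inj e.
  have e2 := congr1 (mulmx^~ (invmx (tjac a b p))) e.
  move: e2; rewrite /= -!scalemxAl mulmxV // !scalemx1 => /matrixP/(_ o0 o0).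
  by rewrite mxE [RHS]mxE eqxx !mulr1n exprMn.
split.
- split=> //; split=> // a b p Wp ap bp; by case: (law a b p Wp ap bp).
- split=> [a i j|a b p Wp ap bp].
    have oWa := @cdom_open _ _ M W a oW.
    have sv := smoothV oWa (@t0 a) (@st a).
    apply: (smooth_eq oWa _ (smoothM oWa sv (sB a i j))) => y _.
    by rewrite [RHS]mxE.
  have [e1 e2] := law a b p Wp ap bp.
  have da0 : dens_factor (-1) a b p != 0.
    apply: contra_eq_neq e1 => ->; rewrite mul0r; exact: (t0 _ _ (cdom_chart Wp bp)).
  have gen (Bb T Ba : 'M[R]_4) (nb na d : R) : d != 0 -> nb = d * na -> Bb *m T = d *: (T *m Ba) ->
      (nb^-1 *: Bb) *m T = 1 *: (T *m (na^-1 *: Ba)).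
    move=> dn -> h; rewrite -scalemxAl h -scalemxAr scalerA scale1r invfM mulrAC mulVf //.
    by rewrite mul1r.
  have -> : dens_factor 0 a b p = 1 by rewrite /dens_factor mul0r powRr0.
  exact: gen da0 e1 e2.
- move=> a y Wy; rewrite /asd_unit -scalemxAl -scalemxAr scalerA.
  have [_ _ ->] := asd_norm_spec Wy.
  by rewrite scalerN scale_scalar_mx expr2 mulrACA mulVf ?t0 // mulr1.
- by move=> a y Wy; rewrite scalerA mulfV ?t0 // scale1r.
Qed.

Lemma asd_decomposition_unique (tau' : chart_field M R) (J' : chart_field M 'M[R]_4) :
  asd_decomposition c D0 Dew xi W tau' J' ->
  (forall a y, cdom W a y -> 0 < tau' a y) ->
  forall a y, cdom W a y -> tau' a y = asd_norm a y /\ J' a y = asd_unit a y.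
Proof.
move=> [_ _ JJ tJ] tp a y Wy; have [_ np e] := asd_norm_spec Wy.
have tE : tau' a y = asd_norm a y.
  have : tau' a y ^+ 2 = asd_norm a y ^+ 2.
    move: e; rewrite tJ // -scalemxAl -scalemxAr scalerA JJ // scalerN scalemx1 => /oppr_inj.
    by move=> /matrixP/(_ o0 o0); rewrite mxE [RHS]mxE eqxx !mulr1n -expr2.
  move/eqP; rewrite eqf_sqr => /orP[/eqP //|/eqP h].
  by have := tp a y Wy; rewrite h oppr_gt0 ltNge ltW.
split=> //; rewrite /asd_unit tJ // -tE scalerA mulVf ?scale1r // gt_eqF //; exact: tp.
Qed.

End Global.

Theorem mainTheorem3 (R : realType) (M : manifold R 4) (c : chart_field M 'M[R]_4)
    (Dew D0 : chart_field M 'rV[R]_4) (xi : chart_field M 'cV[R]_4)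
    (hDew : selfdual_einstein_weyl c Dew)
    (hxi : congruence c xi)
    (hsub : conformal_submersion c xi)
    (hD0 : minimal_weyl c xi D0)
    (hF0 : selfdual_faraday c D0) :
  (* the canonical structure on the open set where the antiselfdual part is
     nonzero; tau is normalised to be positive *)
  (let W := asd_deriv_support c D0 Dew xi in
   open W /\
   exists (tau : chart_field M R) (J : chart_field M 'M[R]_4),
     [/\ asd_decomposition c D0 Dew xi W tau J,
         forall a y, cdom W a y -> 0 < tau a y,
         kahler_weyl c W J (gauge_change D0 Dew tau)
       & forall (tau' : chart_field M R) (J' : chart_field M 'M[R]_4),
           asd_decomposition c D0 Dew xi W tau' J' ->
           (forall a y, cdom W a y -> 0 < tau' a y) ->
           forall a y, cdom W a y -> tau' a y = tau a y /\ J' a y = J a y]) /\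
  (* any decomposition, over any open set *)
  (forall (V : set M) (tau : chart_field M R) (J : chart_field M 'M[R]_4),
     open V -> asd_decomposition c D0 Dew xi V tau J ->
     kahler_weyl c V J (gauge_change D0 Dew tau) /\
     exists Dtau : chart_field M 'rV[R]_4,
       [/\ weyl_derivative V Dtau,
           forall a y, cdom V a y -> dens_deriv (-1) (Dtau a) (tau a) y = 0,
           forall a y, cdom V a y ->
             gauge_change D0 Dew tau a y = Dew a y + D0 a y - Dtau a y
         & forall Dtau' : chart_field M 'rV[R]_4,
             weyl_derivative V Dtau' ->
             (forall a y, cdom V a y ->
                dens_deriv (-1) (Dtau' a) (tau a) y = 0) ->
             forall a y, cdom V a y -> Dtau' a y = Dtau a y]).
Proof.
have dec := asd_norm_decomposition hDew hxi hD0.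
have oW := asd_deriv_support_open hDew hxi hD0.
split.
  split=> //; exists (asd_norm c Dew D0 xi), (asd_unit c Dew D0 xi); split=> //.
  - by move=> a y Wy; have [] := asd_norm_spec hDew hxi hD0 Wy.
  - exact: (kahler_of_decomposition hDew hxi hsub hD0 hF0 oW dec).
  - exact: (asd_decomposition_unique hDew hxi hD0).
move=> V tau J oV decV; split.
  exact: (kahler_of_decomposition hDew hxi hsub hD0 hF0 oV decV).
exact: (parallel_weyl_derivative hDew oV decV).
Qed.
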